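(* (Random positive matrices.) Let $A=\{A_\omega:\omega\in\Omega\}$, $A_\omega=(p^\omega_{ij}:i\in\mathcal{W}^1_\omega,j\in\mathcal{W}^1_{\theta\omega})$, be a summable random matrix with the b.i.p.-property (see context), and write $A^n_\omega=A_\omega A_{\theta\omega}\cdots A_{\theta^{n-1}\omega}$. Then there exist a positive random variable $\lambda$ and strictly positive random vectors $h=\{h^\omega\}$, $\mu=\{\mu^\omega\}$, with $h^\omega,\mu^\omega$ indexed by $\mathcal{W}^1_\omega$, $\sum_{i}\mu^\omega_i=1$ and $\sum_ih^\omega_i\mu^\omega_i=1$, such that for a.e. $\omega$ $$(h^\omega)^tA_\omega=\lambda_\omega(h^{\theta\omega})^t,\qquad A_\omega\mu^{\theta\omega}=\lambda_\omega\mu^\omega,$$ and such that, with $\Lambda_n(\omega)=\prod_{i=0}^{n-1}\lambda_{\theta^i\omega}$: (a) there are $s\in(0,1)$ and a positive random variable $C_\omega$ such that for a.e. $\omega$ and all $n\in\mathbb{N}$ $$\sup_{i\in\mathcal{W}^1_\omega,\,j\in\mathcal{W}^1_{\theta^n\omega}}\left|\frac{(A^n_\omega)_{ij}}{\Lambda_n(\omega)\,h^{\theta^n\omega}_j}-\mu^\omega_i\right|\le C_\omega s^n,\qquad\big\|\Lambda_n(\omega)^{-1}A^n_\omega-\mu^\omega(h^{\theta^n\omega})^t\big\|_\infty\le C_\omega\Big(\sup_jh^{\theta^n\omega}_j\Big)s^n,$$ where $\|\cdot\|_\infty$ is the supremum of the absolute values of the entries; (b) for the random matrix $\tilde A$ with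 entries $(\tilde A_\omega)_{ij}=(A_\omega)_{ij}h^\omega_i/(\lambda_\omega h^{\theta\omega}_j)$, there exist $t\in(0,1)$, random sequences $(l_n(\omega))$ and $(k_n(\omega))$ in $\mathbb{N}$ and a positive random vector $\{\nu^\omega\}$ with $\sum_{i\in\mathcal{W}^1_\omega}\nu^\omega_i=1$ a.s. such that for a.e. $\omega$ and all $n\in\mathbb{N}$, writing $l_n=l_n(\omega)$, $k_n=k_n(\omega)$, $$\sup_{i\in\mathcal{W}^1_\omega,\,j\in\mathcal{W}^1_{\theta^{l_n}\omega}}\big|(\tilde A^{l_n}_\omega)_{ij}-\nu^\omega_i\big|\le4t^n,\qquad\sup_{i\in\mathcal{W}^1_{\theta^{-k_n}\omega},\,j\in\mathcal{W}^1_\omega}\big|(\tilde A^{k_n}_{\theta^{-k_n}\omega})_{ij}-\nu^{\theta^{-k_n}\omega}_i\big|\le4t^n.$$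
   Context: $\theta$ is an ergodic automorphism (invertible, bimeasurable, probability preserving, ergodic) of a probability space $(\Omega,\mathcal{F},P)$ and $\{\mathcal{W}^1_\omega\}$ is a measurable family of subsets of $\mathbb{N}$; $A_\omega$ has entries $p^\omega_{ij}\ge0$ a.s. and is measurable in $\omega$. $A$ is a **summable random matrix with the b.i.p.-property** if: (1) the signum of $A$, i.e. the $\{0,1\}$-matrices $(\alpha^\omega_{ij})=(\mathrm{sgn}\,p^\omega_{ij})$, defines a random topological Markov chain with the b.i.p.-property (below); (2) for a.e. $\omega\in\theta^{-1}(\Omega_{\rm bi}\cup\Omega_{\rm bp})$, $\sup\{p^\omega_{ij}/p^\omega_{ik}:i\in\mathcal{W}^1_\omega,\ j,k\in\mathcal{W}^1_{\theta\omega},\ p^\omega_{ik}\neq0\}<\infty$; (3) the random variable $\omega\mapsto\sup_{j\in\mathcal{W}^1_{\theta\omega}}|\log\sum_{i\in\mathcal{W}^1_\omega}p^\omega_{ij}|$ is in $L^1(P)$. **Random topological Markov chain with b.i.p.** The matrices satisfy $\sum_{j\in\mathcal{W}^1_{\theta\omega}}\alpha^\omega_{ij}>0$ and $\sum_{j\in\mathcal{W}^1_{\theta^{-1}\omega}}\alpha^{\theta^{-1}\omega}_{ji}>0$ for all $i\in\mathcal{W}^1_\omega$, a.s. $X_\omega=\{(x_0,x_1,\dots):\alpha^{\theta^i\omega}_{x_ix_{i+1}}=1\ \forall i\ge0\}$, $T_\omega:X_\omega\to X_{\theta\omega}$ is the shift, $T^n_\omega=T_{\theta^{n-1}\omega}\circ\cdots\circ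 T_\omega$; $\mathcal{W}^n_\omega$ is the set of admissible words of length $n$ ($x_i\in\mathcal{W}^1_{\theta^i\omega}$, $\alpha^{\theta^i\omega}_{x_ix_{i+1}}=1$ for consecutive letters), $[a]_\omega$ the cylinder of sequences in $X_\omega$ starting with $a$, $\Omega_a=\{\omega:[a]_\omega\ne\emptyset\}$, $\mathcal{W}^1=\{a\in\mathbb{N}:P(\Omega_a)>0\}$. It is topologically mixing if for all $a,b\in\mathcal{W}^1$ there is an $\mathbb{N}$-valued random variable $N_{ab}$ with $[a]_\omega\cap(T^n_\omega)^{-1}[b]_{\theta^n\omega}\neq\emptyset$ whenever $n\ge N_{ab}(\omega)$, $a\in\mathcal{W}^1_\omega$, $\theta^n\omega\in\Omega_b$. It has the b.i.p.-property if it is topologically mixing and there are $\Omega_{\rm bi},\Omega_{\rm bp}\subset\Omega$ of positive measure and a finite $\mathcal{I}\subset\mathbb{N}$ such that for $\omega\in\Omega_{\rm bi}$, $a\in\mathcal{W}^1_{\theta^{-1}\omega}$ there is $b\in\mathcal{I}$ with $ab\in\mathcal{W}^2_{\theta^{-1}\omega}$, and for $\omega\in\Omega_{\rm bp}$, $a\in\mathcal{W}^1_\omega$ there is $b\in\mathcal{I}$ with $ba\in\mathcal{W}^2_{\theta^{-1}\omega}$. A random sequence is a sequence of measurable $\mathbb{N}$-valued functions of $\omega$; $\tilde A^n_\omega=\tilde A_\omega\tilde A_{\theta\omega}\cdots\tilde A_{\theta^{n-1}\omega}$. *)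

(* Defs.v *)
From HB Require Import structures.
From mathcomp Require Import all_boot all_order all_algebra.
From mathcomp Require Import all_classical all_reals all_analysis.

Set Implicit Arguments.
Unset Strict Implicit.
Unset Printing Implicit Defensive.

Import Order.TTheory GRing.Theory Num.Theory.

Local Open Scope classical_set_scope.
Local Open Scope ring_scope.

(* MathComp-Analysis, over an arbitrary R : realType. The base automorphism is
   given together with its inverse: th is theta and thi is theta^-1. *)

Record ergodic_automorphism (d : measure_display) (Omega : measurableType d)
    (R : realType) (P : probability Omega R) (th thi : Omega -> Omega) : Prop := {
  ea_measurable : measurable_fun setT th ;
  ea_measurable_inv : measurable_fun setT thi ;
  ea_thK : cancel th thi ;
  ea_thiK : cancel thi th ;
  ea_preserving : forall A : set Omega, measurable A -> P (th @^-1` A) = P A ;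
  ea_ergodic : forall A : set Omega, measurable A -> th @^-1` A = A ->
    P A = 0%E \/ P A = 1%E }.

Definition measurable_family (d : measure_display) (Omega : measurableType d)
    (W : Omega -> set nat) : Prop :=
  forall a : nat, measurable [set w | W w a].

(* Vectors and matrices are indexed by all of nat; only the entries whose
   indices lie in W are meaningful, so measurability in w is required only
   where the entry is defined. *)
Definition random_vector (d : measure_display) (Omega : measurableType d)
    (R : realType) (W : Omega -> set nat) (v : Omega -> nat -> R) : Prop :=
  forall i : nat, measurable_fun [set w | W w i] (fun w => v w i).

Definition random_matrix (d : measure_display) (Omega : measurableType d)
    (R : realType) (th : Omega -> Omega) (W : Omega -> set nat)
    (B : Omega -> nat -> nat -> R) : Prop :=
  forall i j : nat,
    measurable_fun [set w | W w i /\ W (th w) j] (fun w => B w i j).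

Section RandomMarkovChain.
Context (d : measure_display) (Omega : measurableType d) (R : realType).
Variables (P : probability Omega R) (th thi : Omega -> Omega).
Variables (W : Omega -> set nat) (alpha : Omega -> nat -> nat -> R).

Record random_markov_chain : Prop := {
  rmc_measurable : random_matrix th W alpha ;
  rmc_zero_one : {ae P, forall w, forall i j, W w i -> W (th w) j ->
    alpha w i j = 0 \/ alpha w i j = 1} ;
  rmc_row : {ae P, forall w, forall i, W w i ->
    (0 < \esum_(j in W (th w)) (alpha w i j)%:E)%E} ;
  rmc_col : {ae P, forall w, forall i, W w i ->
    (0 < \esum_(j in W (thi w)) (alpha (thi w) j i)%:E)%E} }.

(* X_w *)
Definition sequence_space (w : Omega) : set (nat -> nat) :=
  [set x | forall i, W (iter i th w) (x i) /\
                     alpha (iter i th w) (x i) (x i.+1) = 1].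

(* T_w is the restriction of shift to X_w, so T_w^n is that of iter n shift. *)
Definition shift (x : nat -> nat) : nat -> nat := fun n => x n.+1.

(* W^n_w *)
Definition words (n : nat) (w : Omega) : set (seq nat) :=
  [set s | [/\ size s = n,
    (forall i, (i < n)%N -> W (iter i th w) (nth 0%N s i)) &
    (forall i, (i.+1 < n)%N ->
       alpha (iter i th w) (nth 0%N s i) (nth 0%N s i.+1) = 1)]].

Definition cylinder (w : Omega) (s : seq nat) : set (nat -> nat) :=
  [set x | sequence_space w x /\
           forall i, (i < size s)%N -> x i = nth 0%N s i].

(* Omega_a *)
Definition letter_event (a : nat) : set Omega :=
  [set w | cylinder w [:: a] !=set0].

(* The set of a with P(Omega_a) > 0. Omega_a is only almost surely equal to the
   measurable set {w | W w a}, and P is unspecified on non-measurable sets; hence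
   "positive measure" is expressed as "not contained in a measurable null set". *)
Definition letters : set nat := [set a | ~ P.-negligible (letter_event a)].

Definition topologically_mixing : Prop :=
  forall a b : nat, letters a -> letters b ->
  exists N : {RV P >-> nat}, {ae P, forall w, forall n : nat,
    (N w <= n)%N -> W w a -> letter_event b (iter n th w) ->
    (cylinder w [:: a] `&`
       (iter n shift) @^-1` cylinder (iter n th w) [:: b]) !=set0}.

(* The b.i.p.-property, with the sets Omega_bi and Omega_bp exposed because
   the summability condition on the matrix refers to them. *)
Record markov_chain_bip (Obi Obp : set Omega) : Prop := {
  bip_chain : random_markov_chain ;
  bip_mixing : topologically_mixing ;
  bip_mbi : measurable Obi ;
  bip_mbp : measurable Obp ;
  bip_bi_gt0 : (0 < P Obi)%E ;
  bip_bp_gt0 : (0 < P Obp)%E ;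
  bip_letters : exists2 I : set nat, finite_set I &
    (forall w, Obi w -> forall a, W (thi w) a ->
       exists2 b, I b & words 2 (thi w) [:: a; b]) /\
    (forall w, Obp w -> forall a, W w a ->
       exists2 b, I b & words 2 (thi w) [:: b; a]) }.

End RandomMarkovChain.

Section SummableMatrix.
Context (d : measure_display) (Omega : measurableType d) (R : realType).
Variables (P : probability Omega R) (th thi : Omega -> Omega).
Variables (W : Omega -> set nat) (A : Omega -> nat -> nat -> R).

(* lne is the extended logarithm, with lne 0 = -oo and lne +oo = +oo. Since
   ereal_sup set0 = -oo, the integrability condition also forces W w to be
   nonempty almost surely. *)
Definition summable_matrix_bip : Prop :=
  exists Obi Obp : set Omega,
  [/\ markov_chain_bip P th thi W (fun w i j => Num.sg (A w i j)) Obi Obp,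
      {ae P, forall w, (th @^-1` (Obi `|` Obp)) w ->
        (ereal_sup [set r | exists i j k : nat,
           [/\ W w i, W (th w) j, W (th w) k, A w i k != 0%R &
               r = (A w i j / A w i k)%:E]] < +oo)%E} &
      P.-integrable setT (fun w =>
        ereal_sup [set `|lne (\esum_(i in W w) (A w i j)%:E)|%E
                  | j in W (th w)])].

End SummableMatrix.

Section MatrixCocycle.
Context (d : measure_display) (Omega : measurableType d) (R : realType).
Variables (th : Omega -> Omega) (W : Omega -> set nat).

(* B^n_w = B_w B_{th w} ... B_{th^(n-1) w}, with B^0_w the identity. The entries
   are sums of countably many nonnegative terms, hence extended reals. *)
Fixpoint mxcocycle (B : Omega -> nat -> nat -> R) (n : nat) (w : Omega)
    (i j : nat) : \bar R :=
  if n is m.+1 then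
    \esum_(k in W (th w)) ((B w i k)%:E * mxcocycle B m (th w) k j)%E
  else ((i == j)%:R)%:E.

Definition birkhoff_prod (lam : Omega -> R) (n : nat) (w : Omega) : R :=
  \prod_(i < n) lam (iter i th w).

Definition normalized_matrix (A : Omega -> nat -> nat -> R) (lam : Omega -> R)
    (h : Omega -> nat -> R) (w : Omega) (i j : nat) : R :=
  A w i j * h w i / (lam w * h (th w) j).

End MatrixCocycle.

Definition sup_norm (R : realType) (I J : set nat) (M : nat -> nat -> \bar R) :
    \bar R :=
  ereal_sup [set `|M i j|%E | i in I & j in J].

(* Main.v *)
Require Import Defs.
From HB Require Import structures.
From mathcomp Require Import all_boot all_order all_algebra.
From mathcomp Require Import all_classical all_reals all_analysis.
From mathcomp Require Import measurable_realfun.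
From mathcomp Require Import ring lra zify.

Set Implicit Arguments.
Unset Strict Implicit.
Unset Printing Implicit Defensive.

Import Order.TTheory GRing.Theory Num.Theory.
Import numFieldNormedType.Exports.
Local Open Scope classical_set_scope.
Local Open Scope ring_scope.

(** Restrict the entries of [A] to the admissible pairs of letters and call [B]
    the result. By the b.i.p.-property and mixing, a path of suitable length n0
    that starts in [Obi] and ends in [Obp] has comparable columns: the entries
    B^n0_ij and B^n0_ik differ by a bounded factor, uniformly in i, j, k. Such a
    block contracts cross ratios: if m f0 <= f <= M f0, then m' f0 B^n0 <=
    f B^n0 <= M' f0 B^n0 with M' - m' <= (1 - eta) (M - m). The event [G] that
    the block starting at w is good, with fixed n0 and bound, has positive
    probability for some choice of them. By the maximal ergodic inequality,
    applied to [th] and to [thi], almost every orbit then visits [G] with positive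
    lower frequency in both directions, so that the oscillation decays
    exponentially. The limits of B^n_ij / (1 B^n)_j are the entries mu_i of the
    right eigenvector. The left eigenvector is [pi / mu], where [pi] is the
    vector that the same construction gives for the time reversal
    mu_i B_ji / mu_j over [thi]. *)

(** The alphabet may be infinite, so compactness gives no eigenvectors; order bounds replace it.
    Summability controls column sums only: at each point they lie between two positive constants,
    whereas row sums may diverge. Hence the indicator of the letters can be pushed forward as a row
    vector, and dividing by its image gives ratios in [0,1]; after one good block they are dominated
    by a single summable column, so no mass escapes in the limit. The transpose has no such control.
    Conjugation with [mu] repairs this: the columns of the reversed matrix sum exactly to the
    eigenvalue, and since cross ratios do not see transposition or diagonal factors, the same blocks
    serve. Only a positive lower frequency of visits is required, so a maximal inequality for
    integer-valued functions suffices and no pointwise ergodic theorem is invoked. For the rate,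
    unit vectors are compared with [h], whose image is known exactly. The initial gap is then 1/h_i,
    and a good block in the past bounds it uniformly in i. In (b) the normalization cancels this
    factor, which removes the random constant. *)

(** * Visit counts along an orbit *)

Section Visits.
Variables (T : Type) (f : T -> T) (G : set T).

Definition hit (w : T) : nat := `[< G w >].

Fixpoint visits (n : nat) (w : T) : nat :=
  if n is m.+1 then (hit w + visits m (f w))%N else 0%N.

Lemma hit_le1 w : (hit w <= 1)%N.
Proof. by rewrite /hit; case: asbool. Qed.

Lemma visits_le n w : (visits n w <= n)%N.
Proof. by elim: n w => //= n IH w; exact: (leq_add (hit_le1 w) (IH _)). Qed.

Lemma visitsD a b w :
  visits (a + b) w = (visits a w + visits b (iter a f w))%N.
Proof.
by elim: a w => //= a IH w; rewrite IH addnA -iterS iterSr.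
Qed.

(** The Birkhoff sums of 1 - q 1_G are unbounded above. One step along the orbit changes them by a
    bounded amount, which K absorbs, so the set is exactly invariant and ergodicity applies to it
    directly. *)
Definition sparse (q : nat) : set T :=
  [set w | forall K, exists n, (q * visits n w + K < n)%N].

Lemma sparse_invariant q : f @^-1` sparse q = sparse q.
Proof.
apply/seteqP; split=> w /= sw K.
- have [n] := sw K => hn; have [m] := sw (K + q)%N => hm.
  exists m.+1; apply: leq_ltn_trans (leqW hm).
  rewrite /= mulnDr -addnA addnC -!addnA !leq_add2l -[leqRHS]muln1.
  by rewrite leq_mul// hit_le1.
- have [[|n]//] := sw K.+1; rewrite /= addnS ltnS mulnDr => hn.
  exists n; apply: leq_trans hn.
  by rewrite ltnS leq_add2r leq_addl.
Qed.

End Visits.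

(** * Maximal ergodic inequality and positive lower frequency of visits *)

Section MaximalErgodic.
Context (d : measure_display) (Omega : measurableType d) (R : realType).
Variables (P : probability Omega R) (T : Omega -> Omega).
Hypothesis mT : measurable_fun setT T.
Hypothesis PT : forall A, measurable A -> P (T @^-1` A) = P A.
Hypothesis ergT : forall A, measurable A -> T @^-1` A = A ->
  P A = 0%E \/ P A = 1%E.
Variables (G : set Omega) (mG : measurable G).

Lemma measurable_preimage_iter n A : measurable A -> measurable (iter n T @^-1` A).
Proof.
elim: n A => //= n IH A mA.
have -> : (fun x => T (iter n T x)) @^-1` A = iter n T @^-1` (T @^-1` A) by [].
by apply: IH; rewrite -[X in measurable X]setTI; exact: mT.
Qed.

Lemma measurable_cst_set (Q : Prop) : measurable [set _ : Omega | Q].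
Proof.
have [q|q] := pselect Q.
- by rewrite (_ : [set _ | Q] = setT)//; apply/seteqP; split.
- by rewrite (_ : [set _ | Q] = set0)//; apply/seteqP; split.
Qed.

Lemma measurable_hit (Y : set nat) : measurable (hit G @^-1` Y).
Proof.
have -> : hit G @^-1` Y = (G `&` [set _ | Y 1%N]) `|` (~` G `&` [set _ | Y 0%N]).
  by apply/seteqP; split=> w; rewrite /hit /=; case: asboolP => Gw /=; tauto.
apply: measurableU; apply: measurableI => //; try exact: measurable_cst_set.
exact: measurableC.
Qed.

Lemma measurable_nat_pair (f g : Omega -> nat) :
  (forall Y, measurable (f @^-1` Y)) -> (forall Y, measurable (g @^-1` Y)) ->
  forall Q : nat -> nat -> Prop, measurable [set w | Q (f w) (g w)].
Proof.
move=> mf mg Q.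
rewrite (_ : [set w | _] = \bigcup_k (f @^-1` [set k] `&` g @^-1` [set l | Q k l])).
  by apply: bigcupT_measurable => k; exact: measurableI.
apply/seteqP; split=> [w /= Qw|w [k _ [/= -> //]]].
by exists (f w).
Qed.

Lemma measurable_visits n (Y : set nat) : measurable (visits T G n @^-1` Y).
Proof.
elim: n Y => [|n IH] Y; first exact: (measurable_cst_set (Y 0%N)).
apply: (@measurable_nat_pair (hit G) (fun w => visits T G n (T w)) _ _
  (fun a b => Y (a + b)%N)); first exact: measurable_hit.
by move=> Z; rewrite -[X in measurable X]setTI; exact: (mT measurableT (IH Z)).
Qed.

Lemma measurable_sparse q : measurable (sparse T G q).
Proof.
rewrite (_ : sparse _ _ _ = \bigcap_K \bigcup_n
    (visits T G n @^-1` [set v | (q * v + K < n)%N])).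
  apply: bigcapT_measurable => K; apply: bigcupT_measurable => n.
  exact: measurable_visits.
apply/seteqP; split=> w /=.
- by move=> h K _; have [n hn] := h K; exists n.
- by move=> h K; have [n _ hn] := h K I; exists n.
Qed.

(* The maximum of the Birkhoff sums of [1 - q 1_G] of length at most [n]; it is
   nonnegative because of the empty sum, so truncated subtraction is harmless. *)
Fixpoint excess (q n : nat) (w : Omega) : nat :=
  if n is m.+1 then (excess q m (T w)).+1 - q * hit G w else 0.

Lemma excess_le q n w : (excess q n w <= n)%N.
Proof.
by elim: n w => //= n IH w; rewrite (leq_trans (leq_subr _ _))// ltnS.
Qed.

Lemma excess_mono q n w : (excess q n w <= excess q n.+1 w)%N.
Proof.
by elim: n w => // n IH w; rewrite /= leq_sub2r// ltnS; exact: IH.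
Qed.

Lemma excess_ge q n w : (n <= excess q n w + q * visits T G n w)%N.
Proof.
elim: n w => //= n IH w; rewrite mulnDr addnA.
apply: (@leq_trans ((excess q n (T w)).+1 + q * visits T G n (T w))).
  by rewrite addSn ltnS.
by rewrite leq_add2r addnC -leq_subLR.
Qed.

(** Garsia's pointwise inequality: where the maximum is positive it is attained by a nonempty sum,
    so it equals 1 - q 1_G plus the maximum for n - 1 at [T w], which is at most the maximum for n
    there. *)
Lemma excess_maximal q n w : (excess q n w + q * (hit G w * (0 < excess q n w)) <=
  (0 < excess q n w) + excess q n (T w))%N.
Proof.
have [->|e0] := posnP (excess q n w); first by rewrite !muln0.
case: n e0 => // n; rewrite /= subn_gt0 => e0.
rewrite muln1 subnK; last exact: ltnW.
by rewrite add1n ltnS excess_mono.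
Qed.

Lemma measurable_excess q n (Y : set nat) : measurable (excess q n @^-1` Y).
Proof.
elim: n Y => [|n IH] Y; first exact: (measurable_cst_set (Y 0%N)).
apply: (@measurable_nat_pair (hit G) (fun w => excess q n (T w)) _ _
  (fun a b => Y (b.+1 - q * a)%N)); first exact: measurable_hit.
by move=> Z; rewrite -[X in measurable X]setTI; exact: (mT measurableT (IH Z)).
Qed.

Local Open Scope ereal_scope.

Lemma integral_preserving (f : Omega -> \bar R) : measurable_fun setT f ->
  (forall w, 0 <= f w) -> \int[P]_w f (T w) = \int[P]_w f w.
Proof.
move=> mf f0; rewrite [RHS](@eq_measure_integral _ _ _ _ (pushforward P T)).
  by rewrite ge0_integral_pushforward.
by move=> A mA _; exact/esym/PT.
Qed.

Lemma measurable_natE (f : Omega -> nat) : (forall Y, measurable (f @^-1` Y)) ->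
  measurable_fun setT (fun w => (f w)%:R%:E : \bar R).
Proof.
move=> mf _ Y mY; rewrite setTI.
by apply: (mf [set k | Y (k%:R%:E)]).
Qed.

(** Integral of [excess_maximal]: [excess q n] is bounded by n, so its integral is finite and
    cancels against that of its composition with [T]. What remains is at most P(E), hence at most
    1. *)
Lemma maximal_ergodic q n :
  q%:R%:E * P (G `&` [set w | (0 < excess q n w)%N]) <= 1.
Proof.
set E := [set w | _].
have mE : measurable E by exact: (measurable_excess q n [set k | (0 < k)%N]).
pose e w : \bar R := (excess q n w)%:R%:E.
have me : measurable_fun setT e by apply: measurable_natE; exact: measurable_excess.
have e0 w : 0 <= e w by rewrite lee_fin.
have mGE : measurable (G `&` E) by exact: measurableI.
have key w : e w + q%:R%:E * (\1_(G `&` E) w)%:E <= (\1_E w)%:E + e (T w).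
  rewrite /e !indicE in_setI -!EFinM -!EFinD lee_fin.
  have -> : (w \in E) = (0 < excess q n w)%N.
    by apply/idP/idP; rewrite inE.
  have -> : (w \in G) = (hit G w == 1%N) :> bool by rewrite /hit -[w \in G]/(`[< G w >]); case: asbool.
  have -> : (hit G w == 1%N) && (0 < excess q n w)%N = (hit G w * (0 < excess q n w))%N :> nat.
    by have := hit_le1 G w; case: (hit G w) => [|[]]// _; rewrite ?mul1n.
  by rewrite -natrM -!natrD ler_nat excess_maximal.
have ie : \int[P]_w e w \is a fin_num.
  rewrite ge0_fin_numE; last exact: integral_ge0.
  apply: (@le_lt_trans _ _ (\int[P]_w cst n%:R%:E w)).
    by apply: ge0_le_integral => //= w _; rewrite lee_fin ler_nat excess_le.
  by rewrite integral_cst//= probability_setT mule1 ltry.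
have : \int[P]_w (e w + q%:R%:E * (\1_(G `&` E) w)%:E) <=
       \int[P]_w ((\1_E w)%:E + e (T w)).
  apply: ge0_le_integral => //=.
  - by move=> w _; rewrite adde_ge0// mule_ge0// lee_fin.
  - apply: emeasurable_funD => //; apply: measurable_funeM.
    by apply/measurable_EFinP; exact: measurable_indic.
  - apply: emeasurable_funD; first by apply/measurable_EFinP; exact: measurable_indic.
    exact: (measurableT_comp me).
have meT : measurable_fun setT (fun w => e (T w)) by exact: (measurableT_comp me).
have m1 (A : set Omega) : measurable A ->
    measurable_fun setT (fun w => (\1_A w)%:E : \bar R).
  by move=> mA; apply/measurable_EFinP; exact: measurable_indic.
rewrite !ge0_integralD//=.
- rewrite ge0_integralZl//; last exact: m1.
  rewrite !integral_indic// !setIT integral_preserving// addeC leeD2rE//.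
  by move=> /le_trans; apply; exact: probability_le1.
- exact: m1.
- by apply: measurable_funeM; exact: m1.
Qed.

(** Take q > 1 / P(G). By ergodicity the sparse set has measure 0 or 1. In the second case almost
    every point of G has positive excess for some n (take K = 0 in [sparse]), and the maximal
    inequality passes to the increasing union, giving q P(G) <= 1, a contradiction. *)
Lemma positive_frequency : 0 < P G ->
  exists2 q : nat, (0 < q)%N & P (sparse T G q) = 0.
Proof.
move=> PG.
have PGfin : P G \is a fin_num by exact: fin_num_measure.
have [q hq] : exists q : nat, 1 < q%:R%:E * P G.
  have PG0 : (0 < fine (P G))%R by rewrite -lte_fin fineK.
  have i0 : (0 < (fine (P G))^-1)%R by rewrite invr_gt0.
  exists (Num.bound (fine (P G))^-1); rewrite -(fineK PGfin) -EFinM lte_fin.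
  by rewrite -ltr_pdivrMr// mul1r archi_boundP// ltW.
exists q.
  by case: q hq => //; rewrite mul0e ltNge lee_fin ler01.
have [//|P1] := ergT (measurable_sparse q) (sparse_invariant T G q).
have : q%:R%:E * P G <= 1.
  pose F n := G `&` [set w | (0 < excess q n w)%N].
  have mF n : measurable (F n).
    by apply: measurableI => //; exact: (measurable_excess q n [set k | (0 < k)%N]).
  have cF : P (F n) @[n --> \oo] --> P (\bigcup_n F n).
    apply: nondecreasing_cvg_mu => //; first exact: bigcupT_measurable.
    apply/nondecreasing_seqP => n; apply/subsetPset => w [Gw /= e0]; split => //=.
    exact: leq_trans (excess_mono _ _ _).
  have PF : P (\bigcup_n F n) = P G.
    apply/eqP; rewrite eq_le; apply/andP; split.
      apply: le_measure; rewrite ?inE//; first exact: bigcupT_measurable.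
      by move=> w [n _ []].
    have P0 : P (~` sparse T G q) = 0.
      by rewrite probability_setC ?P1 ?subee//; exact: measurable_sparse.
    rewrite -[leRHS]adde0 -P0; apply: le_trans (measureU2 _ _ _).
    - apply: le_measure; rewrite ?inE//.
        apply: measurableU; first exact: bigcupT_measurable.
        by apply: measurableC; exact: measurable_sparse.
      move=> w Gw; have [sw|sw] := pselect (sparse T G q w); last by right.
      left; have [n] := sw 0%N; rewrite addn0 => hn; exists n => //; split => //=.
      rewrite lt0n; apply/eqP => e0; have := excess_ge q n w.
      by rewrite e0 add0n leqNgt hn.
    - exact: bigcupT_measurable.
    - by apply: measurableC; exact: measurable_sparse.
  rewrite -PF -(cvg_lim _ cF)// -limeMl//; last by apply/cvg_ex; eexists; exact: cF.
  apply: lime_le; last by near=> n; exact: maximal_ergodic.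
  by apply: is_cvgeMl => //; apply/cvg_ex; eexists; exact: cF.
by rewrite leNgt hq.
Unshelve. all: by end_near. Qed.

End MaximalErgodic.

(** * Series of nonnegative extended reals *)

Section NonnegativeSeries.
Context (R : realType).
Local Open Scope ereal_scope.
Implicit Types f g : nat -> \bar R.

Lemma nneseries_ge_term f k : (forall i, 0 <= f i) -> f k <= \sum_(i <oo) f i.
Proof.
move=> f0; apply: le_trans (nneseries_lim_ge k.+1 _) => //.
by rewrite big_nat_recr//= leeDr// sume_ge0.
Qed.

Lemma nneseries_eq0 f k : (forall i, 0 <= f i) -> \sum_(i <oo) f i = 0 -> f k = 0.
Proof.
by move=> f0 s0; apply/eqP; rewrite eq_le f0 andbT -s0 nneseries_ge_term.
Qed.

(** The factor may be [+oo], because entries of matrix products are extended reals. Then either all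
    terms vanish or one positive term already makes both sides infinite. *)
Lemma ge0_nneseriesZl f x : (forall i, 0 <= f i) -> 0 <= x ->
  \sum_(i <oo) (x * f i) = x * \sum_(i <oo) f i.
Proof.
move=> f0; case: x => [r r0|_|//]; first exact: nneseriesZl.
have [s0|s0] := eqVneq (\sum_(i <oo) f i) 0.
  by rewrite s0 mule0 eseries0// => i _ _; rewrite (nneseries_eq0 i f0 s0) mule0.
rewrite gt0_mulye; last by rewrite lt0e s0 nneseries_ge0.
have [k fk] : exists k, f k != 0.
  apply: contrapT => /forallNP h; move/eqP : s0; apply.
  by apply: eseries0 => i _ _; exact/eqP/negPn/negP/h.
apply/eqP; rewrite -leye_eq.
apply: le_trans (nneseries_ge_term k _); last by move=> i; rewrite mule_ge0.
by rewrite gt0_mulye// lt0e fk f0.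
Qed.

Lemma ge0_nneseriesZr f x : (forall i, 0 <= f i) -> 0 <= x ->
  \sum_(i <oo) (f i * x) = (\sum_(i <oo) f i) * x.
Proof.
move=> f0 x0; rewrite muleC -ge0_nneseriesZl//.
by apply: eq_eseriesr => i _; rewrite muleC.
Qed.

Lemma nneseries_delta f j : (forall i, 0 <= f i) ->
  \sum_(i <oo) ((i == j)%:R%:E * f i) = f j.
Proof.
move=> f0; rewrite (nneseriesD1 (n := j))//=; last by move=> i _; rewrite mule_ge0// lee_fin.
rewrite eqxx mul1e eseries0 ?adde0// => i _ /negbTE ->.
by rewrite mul0e.
Qed.

Lemma nneseries_gt0 f k : (forall i, 0 <= f i) -> 0 < f k -> 0 < \sum_(i <oo) f i.
Proof. by move=> f0 fk; exact: lt_le_trans (nneseries_ge_term k f0). Qed.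

End NonnegativeSeries.

(** * Contraction by a matrix with bounded cross ratios *)

Section CrossRatio.
Context (R : realType).
Local Open Scope ereal_scope.

(** Written without division, so that zero entries are allowed. *)
Definition cross_ratio_ge (eta : R) (K : nat -> nat -> \bar R) :=
  forall i i' j j', eta%:E * (K i j' * K i' j) <= K i j * K i' j'.

Variables (K : nat -> nat -> \bar R) (eta : R).
Hypotheses (K0 : forall i j, 0 <= K i j) (eta0 : (0 <= eta)%R).
Hypothesis crK : cross_ratio_ge eta K.

Definition kapp (f : nat -> \bar R) (j : nat) := \sum_(i <oo) (f i * K i j).

Lemma kapp_ge0 f j : (forall i, 0 <= f i) -> 0 <= kapp f j.
Proof. by move=> f0; apply: nneseries_ge0 => i _ _; rewrite mule_ge0. Qed.

(** Both sides are double series with the same weights f_i g_k, and the cross ratio bound compares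
    them term by term. *)
Lemma cross_ratio_kapp f g j j' : (forall i, 0 <= f i) -> (forall i, 0 <= g i) ->
  eta%:E * (kapp f j' * kapp g j) <= kapp f j * kapp g j'.
Proof.
move=> f0 g0; rewrite /kapp -!ge0_nneseriesZr ?nneseries_ge0//; do ?
  by move=> *; rewrite ?nneseries_ge0// => *; rewrite !mule_ge0.
rewrite -ge0_nneseriesZl//; last first.
  by move=> i; rewrite mule_ge0// ?mule_ge0// nneseries_ge0// => k _ _; rewrite mule_ge0.
apply: lee_nneseries => i.
  by move=> _ _; rewrite mule_ge0// mule_ge0// ?mule_ge0// nneseries_ge0// => k _ _; rewrite mule_ge0.
rewrite -!ge0_nneseriesZl// ?mule_ge0//; do ?
  by move=> *; rewrite ?nneseries_ge0// => *; rewrite !mule_ge0.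
move=> _; apply: lee_nneseries => k; first by move=> _ _; rewrite !mule_ge0.
move=> _; rewrite [X in eta%:E * X]muleACA [leRHS]muleACA [leLHS]muleCA.
by apply: lee_wpmul2l; [rewrite mule_ge0|exact: crK].
Qed.

Lemma kapp_bounds f g (m M : R) j : (forall i, 0 <= f i) -> (forall i, 0 <= g i) ->
  (0 <= m)%R -> (0 <= M)%R ->
  (forall i, m%:E * f i <= g i <= M%:E * f i) ->
  m%:E * kapp f j <= kapp g j <= M%:E * kapp f j.
Proof.
move=> f0 g0 m0 M0 fg; rewrite /kapp -!ge0_nneseriesZl//; do ?
  by move=> *; rewrite !mule_ge0.
apply/andP; split; apply: lee_nneseries => i; rewrite ?mule_ge0// muleA;
  by move=> _; rewrite lee_wpmul2r//; have /andP[] := fg i.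
Qed.

(** Let a_j be the quotient of the images of f and f0, and apply the cross ratio bound to the pair M
    f0 - f and f0. This gives eta (M - a_j') <= M - a_j for all j, j' in X, hence sup a - inf a <=
    (1 - eta) (M - inf a). The new bracket is inf a, sup a; off X both images vanish. *)
Lemma cross_ratio_contract (X : set nat) f0 f (m M : R) :
  X !=set0 -> (forall i, 0 <= f0 i) -> (forall i, f0 i \is a fin_num) ->
  (forall i, 0 <= f i) -> (eta <= 1)%R ->
  (0 <= m)%R -> (m <= M)%R -> (forall i, m%:E * f0 i <= f i <= M%:E * f0 i) ->
  (forall j, X j -> 0 < kapp f0 j < +oo) -> (forall j, ~ X j -> kapp f0 j = 0) ->
  exists m' M', [/\ (m <= m')%R, (m' <= M')%R, (M' <= M)%R,
    (M' - m' <= (1 - eta) * (M - m))%R &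
    forall j, m'%:E * kapp f0 j <= kapp f j <= M'%:E * kapp f0 j].
Proof.
move=> [x0 Xx0] f00 f0f fge0 eta1 m0 mM fb kX kNX.
have M0 : (0 <= M)%R by exact: le_trans mM.
have fbK j : m%:E * kapp f0 j <= kapp f j <= M%:E * kapp f0 j by exact: kapp_bounds.
pose b j := fine (kapp f0 j); pose c j := fine (kapp f j).
have bE j : X j -> kapp f0 j = (b j)%:E.
  by move=> /kX /andP[k0 koo]; rewrite fineK// ge0_fin_numE// ltW.
have b0 j : X j -> (0 < b j)%R.
  by move=> Xj; have := kX _ Xj; rewrite bE// => /andP[].
have cE j : X j -> kapp f j = (c j)%:E.
  move=> Xj; rewrite fineK// ge0_fin_numE ?kapp_ge0//.
  by have /andP[_ /le_lt_trans->//] := fbK j; rewrite bE// -EFinM ltry.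
have cb j : X j -> (m * b j <= c j <= M * b j)%R.
  by move=> Xj; have := fbK j; rewrite bE// cE// -!EFinM !lee_fin.
pose F i := M%:E * f0 i - f i.
have F0 i : 0 <= F i.
  rewrite sube_ge0; first by have /andP[] := fb i.
  by rewrite fin_numM// orbT.
have ffin i : f i \is a fin_num.
  rewrite ge0_fin_numE//; have /andP[_ /le_lt_trans->//] := fb i.
  by rewrite -ge0_fin_numE ?mule_ge0// fin_numM.
have FE j : kapp F j + kapp f j = M%:E * kapp f0 j.
  rewrite /kapp -nneseriesD; try by move=> i _ _; rewrite mule_ge0.
  rewrite -ge0_nneseriesZl//; last by move=> i; rewrite mule_ge0.
  apply: eq_eseriesr => i _; rewrite -ge0_muleDl// /F subeK// muleA//.
have FK j : X j -> kapp F j = (M * b j - c j)%:E.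
  by move=> Xj; have := FE j; rewrite bE// cE// EFinB EFinM => <-; rewrite addeK.
pose a j := (c j / b j)%R.
have key j j' : X j -> X j' -> (eta * (M - a j') <= M - a j)%R.
  move=> Xj Xj'; have := cross_ratio_kapp j j' F0 f00.
  rewrite !FK// !bE// -!EFinM lee_fin => h.
  have bj := b0 _ Xj; have bj' := b0 _ Xj'.
  have -> : (M - a j = (M * b j - c j) / b j)%R by rewrite /a mulrBl mulfK ?gt_eqF.
  have -> : (M - a j' = (M * b j' - c j') / b j')%R by rewrite /a mulrBl mulfK ?gt_eqF.
  rewrite ler_pdivlMr// mulrA mulrAC ler_pdivrMr//.
  by move: h; rewrite mulrA.
have aE j : X j -> (m <= a j <= M)%R.
  by move=> Xj; rewrite ler_pdivlMr ?b0// ler_pdivrMr ?b0// cb.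
pose S := a @` X.
have S0 : S !=set0 by exists (a x0); exists x0.
have ubS : has_ubound S by exists M => _ [j Xj <-]; have /andP[] := aE _ Xj.
have lbS : has_lbound S by exists m => _ [j Xj <-]; have /andP[] := aE _ Xj.
exists (inf S), (sup S); split.
- by apply: lb_le_inf => // _ [j Xj <-]; have /andP[] := aE _ Xj.
- apply: (@le_trans _ _ (a x0)); first by apply: ge_inf => //; exists x0.
  by apply: ub_le_sup => //; exists x0.
- by apply: ge_sup => // _ [j Xj <-]; have /andP[] := aE _ Xj.
- have h1 j' : X j' -> (sup S <= M - eta * (M - a j'))%R.
    move=> Xj'; apply: ge_sup => // _ [j Xj <-].
    by have := key _ _ Xj Xj'; lra.
  have h2 : (sup S <= M - eta * (M - inf S))%R.
    have [->|e0] := eqVneq eta 0%R.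
      rewrite mul0r subr0.
      by apply: ge_sup => // _ [j Xj <-]; have /andP[] := aE _ Xj.
    have e00 : (0 < eta)%R by rewrite lt0r e0.
    suff : ((sup S - M) / eta + M <= inf S)%R.
      by rewrite -lerBrDr ler_pdivrMr//; lra.
    apply: lb_le_inf => // _ [j' Xj' <-].
    by rewrite -lerBrDr ler_pdivrMr//; have := h1 _ Xj'; lra.
  have h3 : (m <= inf S)%R.
    by apply: lb_le_inf => // _ [j Xj <-]; have /andP[] := aE _ Xj.
  by apply: (le_trans (y := ((1 - eta) * (M - inf S))%R)); nra.
- move=> j; have [Xj|Xj] := pselect (X j); last first.
    have := fbK j; rewrite kNX// !mule0 => /andP[k1 k2].
    by rewrite k1 k2.
  rewrite bE// cE// -!EFinM !lee_fin -ler_pdivlMr ?b0// -[X in _ && X]ler_pdivrMr ?b0//.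
  by rewrite ge_inf//= ?ub_le_sup//; exists j.
Qed.

End CrossRatio.

(** * Matrix products, their action on row vectors, and contraction along an orbit *)

Section Cocycle.
Context (R : realType) (Omega : Type) (th : Omega -> Omega).
Variable B : Omega -> nat -> nat -> R.
Hypothesis B0 : forall w i j, 0 <= B w i j.
Local Open Scope ereal_scope.
Implicit Types f g : nat -> \bar R.

Fixpoint cocycle (n : nat) (w : Omega) (i j : nat) : \bar R :=
  if n is m.+1 then \sum_(k <oo) ((B w i k)%:E * cocycle m (th w) k j)
  else (i == j)%:R%:E.

Fixpoint transfer (n : nat) (w : Omega) (f : nat -> \bar R) : nat -> \bar R :=
  if n is m.+1 then transfer m (th w) (kapp (fun i j => (B w i j)%:E) f) else f.

Lemma cocycle_ge0 n w i j : 0 <= cocycle n w i j.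
Proof.
elim: n w i => [|n IH] w i /=; first by rewrite lee_fin.
by apply: nneseries_ge0 => k _ _; rewrite mule_ge0// lee_fin.
Qed.

Lemma transferE n w f : (forall i, 0 <= f i) ->
  transfer n w f = kapp (cocycle n w) f.
Proof.
elim: n w f => [|n IH] w f f0; apply/funext => j.
  rewrite /kapp /= -[LHS](nneseries_delta j f0).
  by apply: eq_eseriesr => i _; rewrite muleC.
rewrite /= IH; last by move=> i; apply: kapp_ge0 => // *; rewrite lee_fin.
rewrite /kapp /=.
transitivity (\sum_(i <oo) \sum_(k <oo) (f k * (B w k i)%:E * cocycle n (th w) i j)).
  apply: eq_eseriesr => i _; rewrite ge0_nneseriesZr ?cocycle_ge0//.
  by move=> k; rewrite mule_ge0// lee_fin.
rewrite nneseries_interchange; last first.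
  by move=> i k; rewrite !mule_ge0 ?cocycle_ge0// lee_fin.
apply: eq_eseriesr => k _; rewrite -ge0_nneseriesZl//.
  by apply: eq_eseriesr => i _; rewrite muleA.
by move=> i; rewrite mule_ge0 ?cocycle_ge0// lee_fin.
Qed.

Lemma transfer_ge0 n w f j : (forall i, 0 <= f i) -> 0 <= transfer n w f j.
Proof. by move=> f0; rewrite transferE//; apply: kapp_ge0 => // *; exact: cocycle_ge0. Qed.

Lemma transferD a b w f : transfer (a + b) w f = transfer b (iter a th w) (transfer a w f).
Proof. by elim: a w f => //= a IH w f; rewrite IH -iterS iterSr. Qed.

Lemma transferS n w f :
  transfer n.+1 w f = kapp (fun i j => (B (iter n th w) i j)%:E) (transfer n w f).
Proof. by rewrite -addn1 transferD. Qed.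

Lemma transferZ n w f x : (forall i, 0 <= f i) -> 0 <= x ->
  transfer n w (fun i => x * f i) = fun j => x * transfer n w f j.
Proof.
move=> f0 x0; rewrite !transferE//; last by move=> i; rewrite mule_ge0.
apply/funext => j; rewrite /kapp -ge0_nneseriesZl//.
  by apply: eq_eseriesr => i _; rewrite muleA.
by move=> i; rewrite mule_ge0 ?cocycle_ge0.
Qed.

Lemma transfer_bounds n w f g (m M : R) j : (forall i, 0 <= f i) -> (forall i, 0 <= g i) ->
  (0 <= m)%R -> (0 <= M)%R -> (forall i, m%:E * f i <= g i <= M%:E * f i) ->
  m%:E * transfer n w f j <= transfer n w g j <= M%:E * transfer n w f j.
Proof.
move=> f0 g0 m0 M0 fg; rewrite !transferE//; apply: kapp_bounds => // *.
exact: cocycle_ge0.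
Qed.

Lemma le_transfer n w f g j : (forall i, 0 <= f i) -> (forall i, f i <= g i) ->
  transfer n w f j <= transfer n w g j.
Proof.
move=> f0 fg; have g0 i : 0 <= g i by exact: le_trans (fg i).
rewrite !transferE// /kapp; apply: lee_nneseries => i.
  by move=> _ _; rewrite mule_ge0 ?cocycle_ge0.
by move=> _; rewrite lee_wpmul2r ?cocycle_ge0.
Qed.

Lemma transfer_delta n w i :
  transfer n w (fun k => (k == i)%:R%:E) = cocycle n w i.
Proof.
rewrite transferE; last by move=> k; rewrite lee_fin.
by apply/funext => j; rewrite /kapp nneseries_delta// => k; exact: cocycle_ge0.
Qed.

Lemma cocycleD a b w i j : cocycle (a + b) w i j =
  \sum_(k <oo) (cocycle a w i k * cocycle b (iter a th w) k j).
Proof.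
rewrite -!transfer_delta transferD transferE//.
by move=> k; rewrite transfer_ge0// => l; rewrite lee_fin.
Qed.

Lemma cocycleSr n w i j : cocycle n.+1 w i j =
  \sum_(k <oo) (cocycle n w i k * (B (iter n th w) k j)%:E).
Proof. by rewrite -!transfer_delta transferS. Qed.

Lemma cocycle_ge a b w i k j :
  cocycle a w i k * cocycle b (iter a th w) k j <= cocycle (a + b) w i j.
Proof.
rewrite cocycleD; apply: (nneseries_ge_term
  (f := fun k => cocycle a w i k * cocycle b (iter a th w) k j)) => l.
by rewrite mule_ge0 ?cocycle_ge0.
Qed.

Lemma cocycle1 w i j : cocycle 1 w i j = (B w i j)%:E.
Proof.
rewrite /= -[RHS](@nneseries_delta _ (fun k => (B w i k)%:E) j); last first.
  by move=> k; rewrite lee_fin.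
by apply: eq_eseriesr => k _; rewrite muleC.
Qed.

Variable W : Omega -> set nat.
Hypothesis Bsupp : forall w i j, B w i j != 0%R -> W w i /\ W (th w) j.

Lemma kapp_supp w f j : ~ W (th w) j -> kapp (fun i j => (B w i j)%:E) f j = 0.
Proof.
move=> Wj; apply: eseries0 => i _ _.
have [->|/Bsupp[]//] := eqVneq (B w i j) 0%R.
by rewrite mule0.
Qed.

Lemma transfer_supp n w f j : (0 < n)%N -> ~ W (iter n th w) j -> transfer n w f j = 0.
Proof. by case: n => // n _ Wj; rewrite transferS kapp_supp. Qed.

Lemma cocycle_supp n w i j : (0 < n)%N -> cocycle n w i j != 0 ->
  W w i /\ W (iter n th w) j.
Proof.
move=> n0 h; split; last first.
  by apply: contrapT => Wj; move: h; rewrite -transfer_delta transfer_supp ?eqxx.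
case: n n0 h => // n _ /=; apply: contraNP => Wi; apply/eqP; apply: eseries0 => k _ _.
by have [->|/Bsupp[]//] := eqVneq (B w i k) 0%R; rewrite mul0e.
Qed.

(** A row vector fit to be a denominator at all times. Two are used: the indicator of the letters,
    which produces the right eigenvector, and later the left eigenvector, which produces the
    rate. *)
Definition reference (w : Omega) (f : nat -> \bar R) := [/\ forall i, 0 <= f i,
  forall n j, transfer n w f j \is a fin_num,
  forall n j, W (iter n th w) j -> 0 < transfer n w f j &
  forall n j, ~ W (iter n th w) j -> transfer n w f j = 0].

Lemma reference_iter a w f : reference w f -> reference (iter a th w) (transfer a w f).
Proof.
move=> [f0 ffin fpos fsupp]; split.
- by move=> i; exact: transfer_ge0.
- by move=> n j; rewrite -transferD.
- by move=> n j; rewrite -iterD addnC -transferD; exact: fpos.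
- by move=> n j; rewrite -iterD addnC -transferD; exact: fsupp.
Qed.

Variables (D G : set Omega) (n0 : nat) (eta rho : R).
Hypotheses (Dth : forall w, D w -> D (th w)) (Wne : forall w, D w -> W w !=set0).
Hypotheses (n0_gt0 : (0 < n0)%N) (eta01 : (0 <= eta <= 1)%R) (rho01 : (0 < rho <= 1)%R).
Hypothesis rho_eta : (1 - eta <= rho ^+ n0)%R.
Hypothesis crG : forall w, D w -> G w -> cross_ratio_ge eta (cocycle n0 w).

Lemma invariant_iter n w : D w -> D (iter n th w).
Proof. by move=> Dw; elim: n => //= n; exact: Dth. Qed.

Lemma block_contraction w f0 f (m M : R) : D w -> G w -> reference w f0 ->
  (forall i, 0 <= f i) -> (0 <= m)%R -> (m <= M)%R ->
  (forall i, m%:E * f0 i <= f i <= M%:E * f0 i) ->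
  exists m' M', [/\ (m <= m')%R, (m' <= M')%R, (M' <= M)%R,
    (M' - m' <= (1 - eta) * (M - m))%R &
    forall j, m'%:E * transfer n0 w f0 j <= transfer n0 w f j <= M'%:E * transfer n0 w f0 j].
Proof.
move=> Dw Gw [f00 ffin fpos fsupp] fge0 m0 mM fb; have /andP[eta0 eta1] := eta01.
rewrite !transferE//; apply: (@cross_ratio_contract _ (cocycle n0 w) _ _ _ _ (W (iter n0 th w))) => //.
- by move=> i j; exact: cocycle_ge0.
- exact: crG.
- exact/Wne/invariant_iter.
- by move=> i; exact: (ffin 0%N).
- by move=> j Wj; rewrite -transferE// fpos//= ltey_eq ffin.
- by move=> j Wj; rewrite -transferE// fsupp.
Qed.

(** Good blocks may overlap, so they are picked greedily: a good point uses up n0 steps, any other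
    point one step. A block contains at most n0 visits and gains a factor 1 - eta <= rho^n0, so each
    visit can be charged a factor rho. The factor rho^n0 on the left pays for an unfinished last
    block. *)
Lemma contraction n w f0 f (m M : R) : D w -> reference w f0 ->
  (forall i, 0 <= f i) -> (0 <= m)%R -> (m <= M)%R ->
  (forall i, m%:E * f0 i <= f i <= M%:E * f0 i) ->
  exists m' M', [/\ (m <= m')%R, (m' <= M')%R, (M' <= M)%R,
    (rho ^+ n0 * (M' - m') <= rho ^+ visits th G n w * (M - m))%R &
    forall j, m'%:E * transfer n w f0 j <= transfer n w f j <= M'%:E * transfer n w f0 j].
Proof.
have /andP[rho0 rho1] := rho01; have /andP[eta0 eta1] := eta01.
have [N] := ubnP n; elim: N n w f0 f m M => // N IH [|n] w f0 f m M nN Dw reff fge0 m0 mM fb.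
  exists m, M; split => //=.
  by rewrite expr0 ler_wpM2r ?subr_ge0// exprn_ile1// ltW.
have f00 := let: And4 h _ _ _ := reff in h.
have M0 : (0 <= M)%R by exact: le_trans mM.
have [Gw|Gw] := pselect (G w); last first.
  have [] := IH n (th w) (transfer 1 w f0) (transfer 1 w f) m M => //.
  - exact: Dth.
  - exact: (reference_iter 1).
  - by move=> i; exact: transfer_ge0.
  - by move=> i; exact: transfer_bounds.
  move=> m' [M' [h1 h2 h3 h4 h5]]; exists m', M'; split => //=.
  by rewrite /hit; case: asboolP.
(* Fewer than n0 steps remain: no contraction is available, but there are also fewer than n0
   visits. *)
have [ln|nl] := ltnP n.+1 n0.
  exists m, M; split => //; last by move=> j; exact: transfer_bounds.
  rewrite ler_wpM2r ?subr_ge0// ler_wiXn2l ?(ltW rho0)//.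
  by rewrite (leq_trans (visits_le _ _ _ _))// ltnW.
have [m1 [M1 [a1 a2 a3 a4 a5]]] := block_contraction Dw Gw reff fge0 m0 mM fb.
have [] := IH (n.+1 - n0)%N (iter n0 th w) (transfer n0 w f0) (transfer n0 w f) m1 M1 => //.
- apply: leq_trans (nN : (n.+1 <= N)%N).
  by rewrite ltn_subrL n0_gt0.
- exact: invariant_iter.
- exact: reference_iter.
- by move=> i; exact: transfer_ge0.
- exact: le_trans a1.
move=> m' [M' [h1 h2 h3 h4 h5]]; exists m', M'; split => //.
- exact: le_trans a1 _.
- exact: le_trans h3 _.
- rewrite -(subnKC nl) visitsD exprD.
  apply: le_trans h4 _.
  rewrite mulrC [in leRHS]mulrAC ler_wpM2r ?exprn_ge0 ?(ltW rho0)//.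
  apply: le_trans a4 _; rewrite ler_wpM2r ?subr_ge0//.
  apply: le_trans rho_eta _.
  by rewrite ler_wiXn2l ?(ltW rho0)// visits_le.
- by move=> j; rewrite -(subnKC nl) !transferD; exact: h5.
Qed.

End Cocycle.

(** * Measurability of countable operations and dominated convergence of series *)

Section MeasurableAux.
Context (d : measure_display) (T : measurableType d) (R : realType).

Lemma measurable_fun_ereal_sup (f : nat -> T -> \bar R) :
  (forall k, measurable_fun setT (f k)) ->
  measurable_fun setT (fun x => ereal_sup (range (f^~ x))).
Proof.
move=> mf; have := measurable_fun_esups mf 0%N.
by apply: eq_measurable_fun => x _; rewrite /esups /sdrop /=; congr ereal_sup;
  apply/seteqP; split => _ [k _ <-]; exists k.
Qed.

Lemma measurable_fun_ereal_inf (f : nat -> T -> \bar R) :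
  (forall k, measurable_fun setT (f k)) ->
  measurable_fun setT (fun x => ereal_inf (range (f^~ x))).
Proof.
move=> mf; have := measurable_fun_einfs mf 0%N.
by apply: eq_measurable_fun => x _; rewrite /einfs /sdrop /=; congr ereal_inf;
  apply/seteqP; split => _ [k _ <-]; exists k.
Qed.

Lemma measurable_fun_fine (f : T -> \bar R) :
  measurable_fun setT f -> measurable_fun setT (fun x => fine (f x)).
Proof. by move=> mf; exact: measurableT_comp. Qed.

Lemma ge0_measurable_funV (f : T -> R) : (forall x, 0 <= f x) ->
  measurable_fun setT f -> measurable_fun setT (fun x => (f x)^-1).
Proof.
move=> f0 mf; rewrite (_ : (fun x => _) = fun x => f x `^ (- 1)).
  exact: (@measurableT_comp _ _ _ _ _ _ (@powR R ^~ (-1))).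
by apply/funext => x; rewrite powRN powRr1.
Qed.

Lemma measurable_fun_indicator (A : set T) : measurable A ->
  measurable_fun setT (fun x => (`[< A x >])%:R : R).
Proof.
move=> mA; rewrite (_ : (fun x => _) = \1_A); first exact: measurable_indic.
by apply/funext => x; rewrite indicE.
Qed.

Lemma measurable_fun_nneseries (f : nat -> T -> \bar R) :
  (forall k x, (0 <= f k x)%E) -> (forall k, measurable_fun setT (f k)) ->
  measurable_fun setT (fun x => (\sum_(k <oo) f k x)%E).
Proof. by move=> f0 mf; apply: ge0_emeasurable_sum. Qed.

End MeasurableAux.

Section DominatedSeries.
Context (R : realType).
Local Open Scope ereal_scope.

(** Dominated convergence for the counting measure. The bound holds only from some N on, hence the
    shift of the sequence by N. *)
Lemma nneseries_dominated (f : nat -> nat -> R) (l g : nat -> R) :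
  (forall n i, (0 <= f n i)%R) ->
  (forall i, (f n i) @[n --> \oo] --> l i) ->
  (\forall n \near \oo, forall i, (f n i <= g i)%R) ->
  \sum_(i <oo) (g i)%:E < +oo ->
  \sum_(i <oo) (f n i)%:E @[n --> \oo] --> \sum_(i <oo) (l i)%:E.
Proof.
move=> f0 fl [N _ fg] goo.
have l0 i : (0 <= l i)%R.
  have hl : lim (f n i @[n --> \oo]) = l i by apply/cvg_lim => //; exact: fl.
  rewrite -hl; apply: limr_ge; first by apply/cvg_ex; exists (l i); exact: fl.
  by near=> n; exact: f0.
have g0 i : (0 <= g i)%R by apply: le_trans (f0 N i) (fg N _ i) => /=.
rewrite -(cvg_shiftn N) /=.
have mnat (h : nat -> \bar R) : measurable_fun setT h by [].
have := @dominated_convergence _ _ R (@counting nat R) setT measurableT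
  (fun n i => (f (n + N)%N i)%:E) (fun i => (l i)%:E) (fun i => (g i)%:E).
case => //.
- apply: aeW => i _; apply: cvg_EFin; first by near=> n.
  rewrite /comp /=; have := fl i; rewrite -(cvg_shiftn N); exact.
- apply/integrableP; split => //.
  by rewrite ge0_integral_count//; under eq_eseriesr do rewrite gee0_abs ?lee_fin//.
- apply: aeW => i n _; rewrite gee0_abs ?lee_fin//.
  by apply: fg => /=; rewrite leq_addl.
move=> _ _; rewrite ge0_integral_count; last by move=> i; rewrite lee_fin.
rewrite [X in X @ _](_ : _ = fun n => \sum_(i <oo) (f (n + N)%N i)%:E)//.
by apply/funext => n /=; rewrite ge0_integral_count// => i; rewrite lee_fin.
Unshelve. all: by end_near. Qed.

End DominatedSeries.

(** * The right eigenvector as a limit of normalized columns *)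

Section LetterIndicator.
Context (R : realType) (Omega : Type) (W : Omega -> set nat).

Definition letter_one (w : Omega) (i : nat) : \bar R := (`[< W w i >])%:R%:E.

Lemma letter_one_ge0 w i : (0 <= letter_one w i)%E.
Proof. by rewrite lee_fin. Qed.

Lemma letter_oneT w i : W w i -> letter_one w i = 1%E.
Proof. by move=> Wi; rewrite /letter_one; case: asboolP. Qed.

Lemma letter_oneF w i : ~ W w i -> letter_one w i = 0%E.
Proof. by move=> Wi; rewrite /letter_one; case: asboolP. Qed.

End LetterIndicator.
#[local] Hint Resolve letter_one_ge0 : core.

Section ConformalVector.
Context (d : measure_display) (Omega : measurableType d) (R : realType).
Variables (th : Omega -> Omega) (W : Omega -> set nat).
Variable B : Omega -> nat -> nat -> R.
Hypothesis B0 : forall w i j, 0 <= B w i j.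
Hypothesis Bsupp : forall w i j, B w i j != 0%R -> W w i /\ W (th w) j.
Variables (D G : set Omega) (n0 : nat) (eta rho : R).
Hypotheses (Dth : forall w, D w -> D (th w)) (Wne : forall w, D w -> W w !=set0).
Hypotheses (n0_gt0 : (0 < n0)%N) (eta01 : (0 < eta <= 1)%R) (rho01 : (0 < rho < 1)%R).
Hypothesis rho_eta : (1 - eta <= rho ^+ n0)%R.
Hypothesis crG : forall w, D w -> G w -> cross_ratio_ge eta (cocycle th B n0 w).
Hypothesis Bcol : forall w, D w -> exists s S : R, (0 < s)%R /\
  forall j, W (th w) j -> (s%:E <= \sum_(i <oo) (B w i j)%:E <= S%:E)%E.
Hypothesis Brow : forall w, D w -> forall i, W w i -> exists j, B w i j != 0.
Hypothesis Gvisits : forall w, D w -> forall N, exists n, (N <= visits th G n w)%N.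

Local Open Scope ereal_scope.

Local Notation one := (letter_one R W).
Local Notation oneT := (letter_oneT R).
Local Notation oneF := (letter_oneF R).

Let Bk w i j : \bar R := (B w i j)%:E.
Let Bk0 w i j : 0 <= Bk w i j. Proof. by rewrite lee_fin. Qed.

Lemma kapp_one w j : kapp (Bk w) (one w) j = \sum_(i <oo) (B w i j)%:E.
Proof.
apply: eq_eseriesr => i _; rewrite /Bk; have [Wi|Wi] := pselect (W w i).
  by rewrite oneT// mul1e.
have [->|/Bsupp[]//] := eqVneq (B w i j) 0%R.
by rewrite mule0.
Qed.

Definition mass n w := transfer th B n w (one w).

Lemma mass_ge0 n w j : 0 <= mass n w j.
Proof. exact: transfer_ge0. Qed.

Lemma mass_bounds n w : D w -> exists c C : R, [/\ (0 < c)%R, (0 < C)%R &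
  forall j, c%:E * one (iter n th w) j <= mass n w j <= C%:E * one (iter n th w) j].
Proof.
move=> Dw; elim: n => [|n [c [C [c0 C0 IH]]]].
  by exists 1%R, 1%R; split => // j; rewrite mul1e lexx.
have Dn : D (iter n th w) by exact: invariant_iter.
have [s [S [s0 hs]]] := Bcol Dn.
exists (c * s)%R, (C * Num.max S 1)%R.
have S0 : (0 < Num.max S 1)%R by rewrite lt_max ltr01 orbT.
split; rewrite ?mulr_gt0// => j.
rewrite /mass transferS; have [Wj|Wj] := pselect (W (iter n.+1 th w) j); last first.
  by rewrite (kapp_supp Bsupp)// oneF// !mule0 lexx.
rewrite oneT// !mule1.
have /andP[h1 h2] := hs _ Wj.
have /andP[k1 k2] := kapp_bounds (Bk0 (iter n th w)) j (letter_one_ge0 _ _ _) (mass_ge0 n w) (ltW c0) (ltW C0) IH.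
rewrite -/(Bk (iter n th w)); apply/andP; split.
  apply: le_trans k1; rewrite kapp_one EFinM.
  by apply: lee_wpmul2l => //; rewrite lee_fin ltW.
apply: (le_trans k2); rewrite kapp_one EFinM.
apply: lee_wpmul2l; first by rewrite lee_fin ltW.
by apply: le_trans h2 _; rewrite lee_fin le_max lexx.
Qed.

Lemma reference_one w : D w -> reference th B W w (one w).
Proof.
move=> Dw; split => //.
- move=> n j; have [c [C [c0 C0 h]]] := mass_bounds n Dw.
  rewrite ge0_fin_numE ?mass_ge0//; have /andP[_ /le_lt_trans->//] := h j.
  by rewrite /letter_one -EFinM ltry.
- move=> n j Wj; have [c [C [c0 C0 h]]] := mass_bounds n Dw.
  by have /andP[/(lt_le_trans _)-> ] := h j; rewrite // oneT// mule1 lte_fin.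
- move=> n j Wj; have [c [C [c0 C0 h]]] := mass_bounds n Dw.
  by apply/eqP; rewrite eq_le mass_ge0 andbT; have /andP[_] := h j; rewrite oneF// mule0.
Qed.

Lemma mass_fin n w j : D w -> mass n w j \is a fin_num.
Proof. by move=> /reference_one[_ h _ _]; exact: h. Qed.

Lemma mass_gt0 n w j : D w -> W (iter n th w) j -> 0 < mass n w j.
Proof. by move=> /reference_one[_ _ h _]; exact: h. Qed.

Lemma mass_eq0 n w j : D w -> ~ W (iter n th w) j -> mass n w j = 0.
Proof. by move=> /reference_one[_ _ _ h]; exact: h. Qed.

Lemma delta_le_one w i k : W w i -> (k == i)%:R%:E <= one w k.
Proof. by move=> Wi; have [->|_] := eqVneq k i; [rewrite oneT|exact: letter_one_ge0]. Qed.

Lemma cocycle_le_mass n w i j : W w i -> cocycle th B n w i j <= mass n w j.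
Proof.
move=> Wi; rewrite -transfer_delta//; apply: le_transfer => // k; exact: delta_le_one.
Qed.

Lemma cocycle_fin n w i j : D w -> W w i -> cocycle th B n w i j \is a fin_num.
Proof.
move=> Dw Wi; rewrite ge0_fin_numE ?cocycle_ge0//.
by rewrite (le_lt_trans (cocycle_le_mass n j Wi))// ltey_eq mass_fin.
Qed.

(** At inadmissible columns [mass] vanishes and the inverse of 0 is 0. The ratio is thus 0 there,
    and suprema may run over all of [nat]. *)
Definition ratio n w i j : R := (fine (cocycle th B n w i j) * (fine (mass n w j))^-1)%R.

Lemma ratio_ge0 n w i j : (0 <= ratio n w i j)%R.
Proof. by rewrite mulr_ge0 ?invr_ge0// fine_ge0 ?cocycle_ge0 ?mass_ge0. Qed.

Lemma ratio_mass n w i j : D w -> W w i ->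
  (ratio n w i j)%:E * mass n w j = cocycle th B n w i j.
Proof.
move=> Dw Wi; have [Wj|Wj] := pselect (W (iter n th w) j); last first.
  rewrite mass_eq0// mule0; apply/esym/eqP; rewrite eq_le cocycle_ge0// andbT.
  by rewrite -(mass_eq0 Dw Wj) cocycle_le_mass.
rewrite -[X in _ * X]fineK ?mass_fin// -EFinM /ratio divfK ?fineK ?cocycle_fin//.
by rewrite gt_eqF// fine_gt0// mass_gt0//= ltey_eq mass_fin.
Qed.

Lemma ratio_bounds n w i (m M : R) : D w -> W w i ->
  (forall j, W (iter n th w) j -> (m <= ratio n w i j <= M)%R) <->
  (forall j, m%:E * mass n w j <= cocycle th B n w i j <= M%:E * mass n w j).
Proof.
move=> Dw Wi; split=> h j.
  have [Wj|Wj] := pselect (W (iter n th w) j); last first.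
    by rewrite -ratio_mass// mass_eq0// !mule0 lexx.
  have := h j Wj; rewrite -ratio_mass// -(fineK (mass_fin n j Dw)).
  by rewrite -!EFinM !lee_fin !ler_pM2r// fine_gt0// mass_gt0//= ltey_eq mass_fin.
move=> Wj; have := h j; rewrite -ratio_mass// -(fineK (mass_fin n j Dw)).
by rewrite -!EFinM !lee_fin !ler_pM2r// fine_gt0// mass_gt0//= ltey_eq mass_fin.
Qed.

(** A bracket for the ratios is an order relation between two row vectors, and a nonnegative matrix
    preserves it. *)
Lemma ratio_propagate n n' w i (m M : R) : D w -> W w i -> (0 <= m)%R -> (n <= n')%N ->
  (forall j, W (iter n th w) j -> (m <= ratio n w i j <= M)%R) ->
  forall j, W (iter n' th w) j -> (m <= ratio n' w i j <= M)%R.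
Proof.
move=> Dw Wi m0 nn' h.
have M0 : (0 <= M)%R.
  have [j Wj] := Wne (invariant_iter Dth n Dw).
  by have /andP[_] := h _ Wj; apply: le_trans; exact: ratio_ge0.
apply/ratio_bounds => // j; rewrite -(subnKC nn') /mass transferD.
rewrite -transfer_delta// transferD; apply: transfer_bounds => //.
- exact: mass_ge0.
- by move=> k; apply: transfer_ge0 => // l; rewrite lee_fin.
- by move=> k; rewrite transfer_delta//; exact: ((ratio_bounds n m M Dw Wi).1 h).
Qed.

Lemma ratio_le1 n w i j : D w -> W w i -> (ratio n w i j <= 1)%R.
Proof.
move=> Dw Wi; rewrite /ratio.
have [Wj|Wj] := pselect (W (iter n th w) j); last first.
  by rewrite mass_eq0//= invr0 mulr0.
rewrite ler_pdivrMr ?mul1r; last by rewrite fine_gt0// mass_gt0//= ltey_eq mass_fin.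
by rewrite fine_le ?cocycle_fin ?mass_fin ?cocycle_le_mass.
Qed.

(** The limit of the ratios, written with countable suprema and infima so that it is defined at
    every point and measurable without reference to convergence. *)
Definition conformal_vec w i : R :=
  fine (ereal_inf (range (fun n => ereal_sup (range (fun j => (ratio n w i j)%:E))))).

Lemma ratio_suppl n w i j : D w -> W (iter n th w) j -> ~ W w i -> ratio n w i j = 0%R.
Proof.
move=> Dw Wj Wi; rewrite /ratio (_ : cocycle th B n w i j = 0) ?mul0r//.
case: n Wj => [|n] Wj /=.
  by case: eqVneq Wj => // <-.
apply/eqP; apply: contrapT => /negP h.
by have [] := cocycle_supp B0 Bsupp (isT : (0 < n.+1)%N) h.
Qed.

Lemma ratio_suppr n w i j : D w -> ~ W (iter n th w) j -> ratio n w i j = 0%R.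
Proof. by move=> Dw Wj; rewrite /ratio mass_eq0//= invr0 mulr0. Qed.

Lemma conformal_supp w i : D w -> ~ W w i -> conformal_vec w i = 0%R.
Proof.
move=> Dw Wi; rewrite /conformal_vec (_ : (fun n => _) = fun=> 0).
  by rewrite (_ : range _ = [set 0]) ?ereal_inf1//; apply/seteqP; split=> [_ [_ _ <-]//|_ ->]; exists 0%N.
apply/funext => n; rewrite (_ : (fun j => _) = fun=> 0).
  by rewrite (_ : range _ = [set 0]) ?ereal_sup1//; apply/seteqP; split=> [_ [_ _ <-]//|_ ->]; exists 0%N.
apply/funext => j; congr EFin; have [Wj|Wj] := pselect (W (iter n th w) j).
  exact: ratio_suppl.
exact: ratio_suppr.
Qed.

(** The upper bound is the n-th term of the infimum. For the lower bound, the bracket at n and the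
    supremum at k both persist up to time max(n, k), where they bound the same ratio. *)
Lemma conformal_bracket n w i (m M : R) : D w -> W w i -> (0 <= m)%R ->
  (forall j, W (iter n th w) j -> (m <= ratio n w i j <= M)%R) ->
  (m <= conformal_vec w i <= M)%R.
Proof.
move=> Dw Wi m0 h.
have Dn k := invariant_iter Dth k Dw.
have [jn Wjn] := Wne (Dn n).
have M0 : (0 <= M)%R.
  by have /andP[_] := h _ Wjn; apply: le_trans; exact: ratio_ge0.
rewrite /conformal_vec; set E := ereal_inf _.
have ub : E <= M%:E.
  apply: (@le_trans _ _ (ereal_sup (range (fun j => (ratio n w i j)%:E)))).
    by apply: ereal_inf_lbound; exists n.
  apply: ge_ereal_sup => _ [j _ <-]; rewrite lee_fin.
  have [Wj|Wj] := pselect (W (iter n th w) j); first by have /andP[] := h _ Wj.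
  by rewrite ratio_suppr.
have lb : m%:E <= E.
  apply: le_ereal_inf_tmp => _ [k _ <-]; set e := ereal_sup _.
  have eub j : (ratio k w i j)%:E <= e by apply: ereal_sup_ubound; exists j.
  have e0 : 0 <= e by apply: le_trans (eub 0%N); rewrite lee_fin ratio_ge0.
  have e1 : e <= 1 by apply: ge_ereal_sup => _ [j _ <-]; rewrite lee_fin ratio_le1.
  have efin : e \is a fin_num by rewrite ge0_fin_numE// (le_lt_trans e1)// ltry.
  have hk j : W (iter k th w) j -> (0 <= ratio k w i j <= fine e)%R.
    by move=> _; rewrite ratio_ge0/= -lee_fin fineK.
  pose N := maxn n k.
  have [j Wj] := Wne (Dn N).
  have /andP[_ h1] := ratio_propagate Dw Wi (lexx _) (leq_maxr n k : (k <= N)%N) hk Wj.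
  have /andP[h2 _] := ratio_propagate Dw Wi m0 (leq_maxl n k : (n <= N)%N) h Wj.
  by rewrite -(fineK efin) lee_fin; exact: le_trans h1.
have Efin : E \is a fin_num.
  by rewrite fin_numE -ltNye -ltey (lt_le_trans _ lb) ?ltNyr//= (le_lt_trans ub)// ltry.
by rewrite -!lee_fin fineK// lb ub.
Qed.

Let eta0 : (0 < eta)%R. Proof. by have /andP[] := eta01. Qed.
Let rho0 : (0 < rho)%R. Proof. by have /andP[] := rho01. Qed.

Lemma exists_small_power (e : R) : (0 < e)%R -> exists N, forall n, (N <= n)%N -> (rho ^+ n <= e)%R.
Proof.
move=> e0; have /andP[_ rho1] := rho01.
have h : (rho ^+ n)%R @[n --> \oo] --> (0 : R)%R by apply: cvg_expr; rewrite gtr0_norm.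
have [N _ hN] := (@cvgrPdist_le _ _ _ _ _ _ _).1 h e e0.
exists N => n Nn; have := hN n Nn.
by rewrite sub0r normrN ger0_norm// exprn_ge0// ltW.
Qed.

(** The unit vector at i lies between 0 and 1 times the indicator of the letters; the initial gap 1
    shrinks with the number of visits, which is unbounded. *)
Lemma ratio_concentrates w i (e : R) : D w -> W w i -> (0 < e)%R ->
  exists n m M, [/\ (0 <= m)%R, (M - m <= e)%R &
    forall j, W (iter n th w) j -> (m <= ratio n w i j <= M)%R].
Proof.
move=> Dw Wi e0.
have rn0 : (0 < rho ^+ n0)%R by rewrite exprn_gt0.
have [N hN] := exists_small_power (mulr_gt0 rn0 e0).
have [n hn] := Gvisits Dw N.
have eta01' : (0 <= eta <= 1)%R by have /andP[/ltW -> ->] := eta01.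
have rho01' : (0 < rho <= 1)%R by have /andP[-> /ltW ->] := rho01.
have [] := contraction B0 Dth Wne n0_gt0 eta01' rho01' rho_eta crG n Dw (reference_one Dw)
  (f := fun k => (k == i)%:R%:E) (m := 0%R) (M := 1%R) => //.
  by move=> k; rewrite mul0e mul1e lee_fin ler0n /=; exact: delta_le_one.
move=> m [M [h1 h2 h3 h4 h5]]; exists n, m, M; split => //.
  rewrite -(ler_pM2l rn0) (le_trans h4)// subr0 mulr1.
  exact: hN.
apply/ratio_bounds => // j; have := h5 j; rewrite transfer_delta//.
Qed.

Lemma ratio_cvg w i (e : R) : D w -> W w i -> (0 < e)%R ->
  exists N, forall n j, (N <= n)%N -> W (iter n th w) j -> (`|conformal_vec w i - ratio n w i j| <= e)%R.
Proof.
move=> Dw Wi e0; have [N [m [M [m0 Mm h]]]] := ratio_concentrates Dw Wi e0.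
exists N => n j Nn Wj.
have /andP[a1 a2] := conformal_bracket Dw Wi m0 h.
have /andP[b1 b2] := ratio_propagate Dw Wi m0 Nn h Wj.
by rewrite ler_norml; apply/andP; split; lra.
Qed.

Lemma exists_hit n w : (0 < visits th G n w)%N -> exists k, G (iter k th w).
Proof.
elim: n w => //= n IH w; rewrite /hit; case: asboolP => [Gw _|_ /IH[k Gk]].
  by exists 0%N.
by exists k.+1; rewrite iterSr.
Qed.

(** Once a good block has been passed, the cross ratio bound for row i of the product and [mass]
    compares the ratios in any two columns, with a constant independent of i. *)
Lemma ratio_comparable w : D w -> exists n, forall i, W w i ->
  forall j j', W (iter n th w) j -> W (iter n th w) j' ->
  (eta * ratio n w i j' <= ratio n w i j)%R.
Proof.
move=> Dw; have [n1 hn1] := Gvisits Dw 1; have [k Gk] := exists_hit hn1.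
have Dk := invariant_iter Dth k Dw.
exists (k + n0)%N => i Wi j j' Wj Wj'.
have kc l : kapp (cocycle th B n0 (iter k th w)) (cocycle th B k w i) l = cocycle th B (k + n0) w i l.
  by rewrite cocycleD.
have km l : kapp (cocycle th B n0 (iter k th w)) (mass k w) l = mass (k + n0) w l.
  by rewrite -transferE//; [rewrite /mass transferD|exact: mass_ge0].
have := @cross_ratio_kapp _ (cocycle th B n0 (iter k th w)) eta
  (cocycle_ge0 th B0 _ _) (ltW eta0) (crG Dk Gk) (cocycle th B k w i) (mass k w) j j'
  (cocycle_ge0 th B0 _ _ _) (mass_ge0 _ _).
rewrite !kc !km -!(ratio_mass _ _ Dw Wi) -(fineK (mass_fin _ j Dw)) -(fineK (mass_fin _ j' Dw)).
have m0 : (0 < fine (mass (k + n0) w j))%R by rewrite fine_gt0// mass_gt0//= ltey_eq mass_fin.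
have m0' : (0 < fine (mass (k + n0) w j'))%R by rewrite fine_gt0// mass_gt0//= ltey_eq mass_fin.
rewrite -!EFinM lee_fin => h; rewrite -(ler_pM2r (mulr_gt0 m0 m0')).
lra.
Qed.

Lemma conformal_ge0 w i : (0 <= conformal_vec w i)%R.
Proof.
apply: fine_ge0; apply: le_ereal_inf_tmp => _ [n _ <-].
apply: (@le_trans _ _ (ratio n w i 0)%:E); first by rewrite lee_fin ratio_ge0.
by apply: ereal_sup_ubound; exists 0%N.
Qed.

(** Tightness: from time n on, all columns are dominated by a multiple of one fixed column, and that
    column has sum 1. *)
Lemma ratio_dominated w : D w -> exists n j C, [/\ W (iter n th w) j, (0 < C)%R &
  forall n' i j', (n <= n')%N -> W (iter n' th w) j' ->
    (ratio n' w i j' <= C * ratio n w i j)%R].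
Proof.
move=> Dw; have [n hn] := ratio_comparable Dw.
have [j Wj] := Wne (invariant_iter Dth n Dw).
exists n, j, (eta^-1)%R; split; rewrite ?invr_gt0// => n' i j' nn' Wj'.
have [Wi|Wi] := pselect (W w i); last by rewrite !ratio_suppl ?mulr0.
suff h : forall l, W (iter n th w) l -> (0 <= ratio n w i l <= eta^-1 * ratio n w i j)%R.
  by have /andP[] := ratio_propagate Dw Wi (lexx _) nn' h Wj'.
move=> l Wl; rewrite ratio_ge0/= mulrC ler_pdivlMr// mulrC.
exact: hn.
Qed.

Lemma cocycle_row_gt0 n w i : D w -> W w i -> exists2 j, W (iter n th w) j & 0 < cocycle th B n w i j.
Proof.
elim: n w i => [|n IH] w i Dw Wi.
  by exists i => //=; rewrite eqxx lte_fin.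
have [k Bk_neq0] := Brow Dw Wi.
have [_ Wk] := Bsupp Bk_neq0.
have [j Wj cj] := IH (th w) k (Dth Dw) Wk.
exists j; first by rewrite iterSr.
apply: (nneseries_gt0 (k := k)).
  by move=> l; rewrite mule_ge0 ?cocycle_ge0// lee_fin.
by rewrite mule_gt0// lte_fin lt0r Bk_neq0 B0.
Qed.

(** Row i of the product has a positive entry in some column j; comparability makes eta times that
    ratio a lower bound in every column, and the bound survives in the limit. *)
Lemma conformal_gt0 w i : D w -> W w i -> (0 < conformal_vec w i)%R.
Proof.
move=> Dw Wi; have [n hn] := ratio_comparable Dw.
have [j Wj cj] := cocycle_row_gt0 n Dw Wi.
have r0 : (0 < ratio n w i j)%R.
  rewrite -lte_fin; have := cj; rewrite -(ratio_mass n j Dw Wi).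
  by rewrite pmule_lgt0// mass_gt0.
have er0 : (0 < eta * ratio n w i j)%R by rewrite mulr_gt0.
apply: (lt_le_trans er0).
suff /andP[] : (eta * ratio n w i j <= conformal_vec w i <= 1)%R by [].
apply: (@conformal_bracket n) => //; first exact: ltW.
by move=> l Wl; rewrite hn//= ratio_le1.
Qed.

Lemma transfer_ratio n w f j : D w -> (forall i, 0 <= f i) -> W (iter n th w) j ->
  (forall i, ~ W w i -> f i = 0) ->
  transfer th B n w f j = (\sum_(i <oo) (f i * (ratio n w i j)%:E)) * mass n w j.
Proof.
move=> Dw f0 Wj fs; rewrite transferE// -ge0_nneseriesZr ?mass_ge0//; last first.
  by move=> i; rewrite mule_ge0// lee_fin ratio_ge0.
apply: eq_eseriesr => i _; have [Wi|Wi] := pselect (W w i); last by rewrite fs// !mul0e.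
by rewrite -(ratio_mass _ _ Dw Wi) muleA.
Qed.

Lemma ratio_sum1 n w j : D w -> W (iter n th w) j -> \sum_(i <oo) (ratio n w i j)%:E = 1.
Proof.
move=> Dw Wj; have := transfer_ratio Dw (letter_one_ge0 R W w) Wj (@letter_oneF R _ W w).
rewrite -/(mass n w) => /esym h.
have -> : \sum_(i <oo) (ratio n w i j)%:E = \sum_(i <oo) (one w i * (ratio n w i j)%:E).
  apply: eq_eseriesr => i _; have [Wi|Wi] := pselect (W w i); first by rewrite oneT// mul1e.
  by rewrite ratio_suppl// mule0.
set S := \sum_(i <oo) _ in h *.
have m0 := mass_gt0 Dw Wj; have mf := mass_fin n j Dw.
have m0' : (0 < fine (mass n w j))%R by rewrite fine_gt0// m0 ltey_eq mf.
by apply/eqP; rewrite eq_le -(lee_pmul2r mf m0) -[X in _ && X](lee_pmul2r mf m0) h mul1e lexx.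
Qed.

Section Averages.
Variables (w : Omega) (f : nat -> R) (C : R) (jn : nat -> nat).
Hypotheses (Dw : D w) (f0 : forall i, (0 <= f i)%R).
Hypothesis fC : forall i, (f i <= C)%R.
Hypothesis Wjn : forall n, W (iter n th w) (jn n).

Lemma ratio_average_cvg :
  \sum_(i <oo) (f i * ratio n w i (jn n))%:E @[n --> \oo] --> \sum_(i <oo) (f i * conformal_vec w i)%:E.
Proof.
have [N [j [K [Wj K0 hK]]]] := ratio_dominated Dw.
apply: (@nneseries_dominated _ _ _ (fun i => C * (K * ratio N w i j))%R).
- by move=> n i; rewrite mulr_ge0 ?ratio_ge0.
- move=> i; apply: cvgMr; have [Wi|Wi] := pselect (W w i); last first.
    rewrite conformal_supp//; under eq_cvg do rewrite ratio_suppl//.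
    exact: cvg_cst.
  apply/cvgrPdist_le => e e0; have [n hn] := ratio_cvg Dw Wi e0.
  by exists n => // m nm; exact: hn.
- exists N => // n Nn i; apply: ler_pM; rewrite ?ratio_ge0 ?hK//.
- have C0 : (0 <= C)%R by exact: le_trans (fC 0%N).
  under eq_eseriesr do rewrite mulrA EFinM.
  rewrite ge0_nneseriesZl; last by rewrite lee_fin mulr_ge0// ltW.
    by rewrite ratio_sum1// mule1 ltry.
  by move=> i; rewrite lee_fin ratio_ge0.
Qed.

End Averages.

Lemma exists_path w : D w -> exists jn : nat -> nat, forall n, W (iter n th w) (jn n).
Proof.
move=> Dw; have h n : exists j, W (iter n th w) j by exact: (Wne (invariant_iter Dth n Dw)).
by exists (fun n => projT1 (cid (h n))) => n; case: cid.
Qed.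

Lemma conformal_sum1 w : D w -> \sum_(i <oo) (conformal_vec w i)%:E = 1.
Proof.
move=> Dw; have [jn Wjn] := exists_path Dw.
have := @ratio_average_cvg w (fun=> 1%R) 1%R jn Dw (fun=> ler01) (fun=> lexx _) Wjn.
under eq_eseriesr do rewrite mul1r.
under eq_cvg do (under eq_eseriesr do rewrite mul1r).
under eq_cvg do rewrite ratio_sum1//.
by move=> /cvg_lim <-//; rewrite lim_cst.
Qed.

Definition colsum w k : R := fine (kapp (Bk w) (one w) k).
(** The value forced on the eigenvalue by summing the equation of the right eigenvector over i, as
    its entries sum to 1. *)
Definition growth w : R := fine (\sum_(k <oo) (colsum w k * conformal_vec (th w) k)%:E).

Lemma colsum_ge0 w k : (0 <= colsum w k)%R.
Proof. by rewrite fine_ge0// kapp_ge0. Qed.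

Lemma colsum_bounds w : D w -> exists s S : R, [/\ (0 < s)%R, (0 < S)%R,
  (forall k, (colsum w k)%:E = kapp (Bk w) (one w) k),
  (forall k, W (th w) k -> (s <= colsum w k)%R) & forall k, (colsum w k <= S)%R].
Proof.
move=> Dw; have [s [S [s0 hs]]] := Bcol Dw.
have S0 : (0 < Num.max S 1)%R by rewrite lt_max ltr01 orbT.
have kle k : kapp (Bk w) (one w) k <= (Num.max S 1)%:E.
  have [Wk|Wk] := pselect (W (th w) k); last by rewrite (kapp_supp Bsupp)// lee_fin ltW.
  by rewrite kapp_one; have /andP[_ /le_trans->//] := hs k Wk; rewrite lee_fin le_max lexx.
have kE k : (colsum w k)%:E = kapp (Bk w) (one w) k.
  by rewrite fineK// ge0_fin_numE ?kapp_ge0// (le_lt_trans (kle k))// ltry.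
exists s, (Num.max S 1)%R; split => // k; last by rewrite -lee_fin kE.
by move=> Wk; rewrite -lee_fin kE kapp_one; have /andP[] := hs k Wk.
Qed.

Lemma growthE w : D w ->
  (growth w)%:E = \sum_(k <oo) (colsum w k * conformal_vec (th w) k)%:E /\ (0 < growth w)%R.
Proof.
move=> Dw; have [s [S [s0 S0 cE cs cS]]] := colsum_bounds Dw.
have mu0 k := conformal_ge0 (th w) k.
have h1 : s%:E <= \sum_(k <oo) (colsum w k * conformal_vec (th w) k)%:E.
  rewrite -[leLHS]mule1 -(conformal_sum1 (Dth Dw)) -ge0_nneseriesZl ?lee_fin ?(ltW s0)//.
  apply: lee_nneseries => k; first by move=> _; rewrite lee_fin mulr_ge0// ltW.
  move=> _; rewrite -EFinM lee_fin.
  have [Wk|Wk] := pselect (W (th w) k); last by rewrite conformal_supp ?mulr0//; exact: Dth.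
  by rewrite ler_wpM2r// cs.
have h2 : \sum_(k <oo) (colsum w k * conformal_vec (th w) k)%:E <= S%:E.
  rewrite -[leRHS]mule1 -(conformal_sum1 (Dth Dw)) -ge0_nneseriesZl ?lee_fin ?(ltW S0)//.
  apply: lee_nneseries => k; first by move=> _; rewrite lee_fin mulr_ge0// colsum_ge0.
  by move=> _; rewrite -EFinM lee_fin ler_wpM2r.
have e : (growth w)%:E = \sum_(k <oo) (colsum w k * conformal_vec (th w) k)%:E.
  rewrite fineK// fin_numE -ltNye -ltey (lt_le_trans _ h1) ?ltNyr//=.
  by rewrite (le_lt_trans h2)// ltry.
by split => //; rewrite -lte_fin e (lt_le_trans _ h1)// lte_fin.
Qed.

(** Limit of an identity at finite time. Both averages converge because B_ik and the column sums are
    bounded in k. *)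
Lemma conformal_eigen w i : D w ->
  \sum_(k <oo) (B w i k * conformal_vec (th w) k)%:E = (growth w * conformal_vec w i)%:E.
Proof.
move=> Dw; have [gE g0] := growthE Dw.
have [Wi|Wi] := pselect (W w i); last first.
  rewrite conformal_supp// mulr0 eseries0// => k _ _.
  by have [->|/Bsupp[]//] := eqVneq (B w i k) 0%R; rewrite mul0r.
have Dw' := Dth Dw.
have [s [S [s0 S0 cE cs cS]]] := colsum_bounds Dw.
have [jn Wjn] := exists_path Dw'.
have Bc k : (B w i k <= colsum w k)%R.
  by rewrite -lee_fin cE kapp_one; apply: (nneseries_ge_term (f := fun l => (B w l k)%:E)) => l; rewrite lee_fin.
have hF := ratio_average_cvg Dw' (B0 w i) (fun k => le_trans (Bc k) (cS k)) Wjn.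
have hG := ratio_average_cvg Dw' (colsum_ge0 w) cS Wjn.
(* After multiplication by [mass n (th w)] at the column, both sides are the entry (i, jn n) of the
   product of length n + 1; this mass is positive and finite, so it cancels. *)
have rel n : \sum_(k <oo) (B w i k * ratio n (th w) k (jn n))%:E =
  (ratio n.+1 w i (jn n))%:E * \sum_(k <oo) (colsum w k * ratio n (th w) k (jn n))%:E.
  have m0 := mass_gt0 Dw' (Wjn n); have mf := mass_fin n (jn n) Dw'.
  have e1 : (\sum_(k <oo) (B w i k * ratio n (th w) k (jn n))%:E) * mass n (th w) (jn n) =
      cocycle th B n.+1 w i (jn n).
    have := @transfer_ratio n (th w) (Bk w i) (jn n) Dw' (Bk0 w i) (Wjn n).
    rewrite transferE// => <-//.
    move=> k Wk; rewrite /Bk; have [->//|/Bsupp[]//] := eqVneq (B w i k) 0%R.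
  have e2 : (\sum_(k <oo) (colsum w k * ratio n (th w) k (jn n))%:E) * mass n (th w) (jn n) =
      mass n.+1 w (jn n).
    have := @transfer_ratio n (th w) (fun k => (colsum w k)%:E) (jn n) Dw' _ (Wjn n).
    move=> <-.
    - rewrite /mass /=; congr (transfer _ _ _ _ _ _); apply/funext => k; exact: cE.
    - by move=> k; rewrite lee_fin colsum_ge0.
    - by move=> k Wk; rewrite cE (kapp_supp Bsupp).
  have e3 : (\sum_(k <oo) (B w i k * ratio n (th w) k (jn n))%:E) * mass n (th w) (jn n) =
    (ratio n.+1 w i (jn n))%:E * (\sum_(k <oo) (colsum w k * ratio n (th w) k (jn n))%:E) * mass n (th w) (jn n).
    by rewrite e1 -muleA e2 ratio_mass.
  by apply/eqP; rewrite eq_le -(lee_pmul2r mf m0) -[X in _ && X](lee_pmul2r mf m0) e3 lexx.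
have hR : (ratio n.+1 w i (jn n))%:E @[n --> \oo] --> (conformal_vec w i)%:E.
  apply: cvg_EFin; first by near=> n.
  apply/cvgrPdist_le => e e0; have [n hn] := ratio_cvg Dw Wi e0.
  exists n => // m nm; apply: hn; first exact: leqW.
  by rewrite iterSr.
have hM : (ratio n.+1 w i (jn n))%:E * \sum_(k <oo) (colsum w k * ratio n (th w) k (jn n))%:E
    @[n --> \oo] --> (conformal_vec w i)%:E * (growth w)%:E.
  by apply: cvgeM => //; rewrite gE.
have := hF; under eq_cvg do rewrite rel.
move=> /(cvg_unique _ hM) <-//.
by rewrite mulrC EFinM.
Unshelve. all: by end_near. Qed.

Hypothesis thm : measurable_fun setT th.
Hypothesis Wm : forall a, measurable [set w | W w a].
Hypothesis Bm : forall i j, measurable_fun setT (fun w => B w i j).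

Lemma measurable_cocycle n i j : measurable_fun setT (fun w => cocycle th B n w i j).
Proof.
elim: n i => [|n IH] i /=; first exact: measurable_cst.
apply: measurable_fun_nneseries => k.
  by move=> w; rewrite mule_ge0 ?cocycle_ge0// lee_fin.
apply: emeasurable_funM; first exact/measurable_EFinP.
exact: (measurableT_comp (IH k)).
Qed.

Lemma measurable_one i : measurable_fun setT (fun w => one w i).
Proof. by have /measurable_EFinP := @measurable_fun_indicator _ _ R _ (Wm i). Qed.

Lemma measurable_mass n j : measurable_fun setT (fun w => mass n w j).
Proof.
rewrite (_ : (fun w => _) = fun w => \sum_(i <oo) (one w i * cocycle th B n w i j)); last first.
  by apply/funext => w; rewrite /mass transferE.
apply: measurable_fun_nneseries => k.
  by move=> w; rewrite mule_ge0 ?cocycle_ge0.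
by apply: emeasurable_funM; [exact: measurable_one|exact: measurable_cocycle].
Qed.

Lemma measurable_ratio n i j : measurable_fun setT (fun w => ratio n w i j).
Proof.
apply: measurable_funM; first exact/measurable_fun_fine/measurable_cocycle.
apply: ge0_measurable_funV; first by move=> w; rewrite fine_ge0// mass_ge0.
exact/measurable_fun_fine/measurable_mass.
Qed.

Lemma measurable_conformal_vec i : measurable_fun setT (fun w => conformal_vec w i).
Proof.
apply: measurable_fun_fine; apply: measurable_fun_ereal_inf => n.
apply: measurable_fun_ereal_sup => j.
by apply/measurable_EFinP; exact: measurable_ratio.
Qed.

Lemma measurable_colsum k : measurable_fun setT (fun w => colsum w k).
Proof.
apply: measurable_fun_fine; apply: measurable_fun_nneseries => i.
  by move=> w; rewrite mule_ge0.
apply: emeasurable_funM; first exact: measurable_one.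
exact/measurable_EFinP.
Qed.

Lemma measurable_growth : measurable_fun setT growth.
Proof.
apply: measurable_fun_fine; apply: measurable_fun_nneseries => k.
  by move=> w; rewrite lee_fin mulr_ge0 ?colsum_ge0 ?conformal_ge0.
apply/measurable_EFinP; apply: measurable_funM; first exact: measurable_colsum.
exact: (measurableT_comp (measurable_conformal_vec k)).
Qed.

End ConformalVector.

(** * A block with comparable columns *)

Section GoodBlock.
Context (R : realType) (Omega : Type) (th : Omega -> Omega).
Variables (W : Omega -> set nat) (B : Omega -> nat -> nat -> R).
Hypothesis B0 : forall w i j, 0 <= B w i j.
Hypothesis Bsupp : forall w i j, B w i j != 0 -> W w i /\ W (th w) j.

Lemma uniform_positive (P : nat -> R -> Prop) N :
  (forall n x y, x <= y -> P n y -> P n x) ->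
  (forall n, (n < N)%N -> exists2 x, 0 < x & P n x) ->
  exists2 x, 0 < x & forall n, (n < N)%N -> P n x.
Proof.
move=> Pmono; elim: N => [|N IH] h; first by exists 1.
have [x x0 hx] := IH (fun n nN => h n (leqW nN)).
have [y y0 hy] := h N (ltnSn N).
exists (Num.min x y); first by rewrite lt_min x0 y0.
move=> n; rewrite ltnS leq_eqVlt => /orP[/eqP->|nN].
  by apply: Pmono hy; rewrite ge_min lexx orbT.
by apply: Pmono (hx n nN); rewrite ge_min lexx.
Qed.

Local Open Scope ereal_scope.

Lemma cocycle_path_gt0 n w (x : nat -> nat) :
  (forall k, (k < n)%N -> B (iter k th w) (x k) (x k.+1) != 0%R) ->
  0 < cocycle th B n w (x 0%N) (x n).
Proof.
elim: n w x => [|n IH] w x h; first by rewrite /= eqxx lte_fin.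
apply: (nneseries_gt0 (k := x 1%N)).
  by move=> k; rewrite mule_ge0 ?lee_fin ?cocycle_ge0.
rewrite mule_gt0 ?lte_fin ?lt0r ?B0 ?(h 0%N)//.
apply: (IH (th w) (fun k => x k.+1)) => k kn.
by rewrite -iterSr; exact: h.
Qed.

Variables (w : Omega) (m N : nat) (K K' C : R).
Let v := iter m th (th w).
Hypotheses (K_gt0 : (0 < K)%R) (K'_gt0 : (0 < K')%R) (C_gt0 : (0 < C)%R).
Hypothesis ratio_w : forall i j k, W w i -> W (th w) j -> W (th w) k ->
  B w i k != 0%R -> (B w i j <= K * B w i k)%R.
Hypothesis ratio_v : forall i j k, W v i -> W (th v) j -> W (th v) k ->
  B v i k != 0%R -> (B v i j <= K' * B v i k)%R.
Hypothesis big_images : forall i, W w i -> exists2 b, (b < N)%N & B w i b != 0%R.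
Hypothesis big_preimages : forall j, W (th v) j -> exists2 c, (c < N)%N & B v c j != 0%R.
Hypothesis connected : forall b c, (b < N)%N -> (c < N)%N -> W (th w) b -> W v c ->
  0 < cocycle th B m (th w) b c.
Hypothesis connected_fin : forall b c, W (th w) b ->
  cocycle th B m (th w) b c \is a fin_num.
Hypothesis mass_le : forall j, kapp (cocycle th B m.+1 (th w)) (letter_one R W (th w)) j <= C%:E.

(** Leave i by a letter b of the finite set, travel m steps to a letter c of it, and enter j from c.
    This bounds the entry (i, j) below by B_ib d1 d2, while the ratio condition at w bounds the
    entry (i, k) above by B_ib K C. The factor B_ib, the only one depending on i, cancels. The
    length m + 2 counts the two outer steps. *)
Lemma good_block : exists2 Q : R, (0 < Q)%R & forall i j k, W w i ->
  W (iter m.+2 th w) j -> W (iter m.+2 th w) k ->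
  cocycle th B m.+2 w i k <= Q%:E * cocycle th B m.+2 w i j.
Proof.
have [d1 d10 hd1] : exists2 x : R, (0 < x)%R & forall b, (b < N)%N ->
    forall c, (c < N)%N -> W (th w) b -> W v c ->
    x%:E <= cocycle th B m (th w) b c.
  apply: (@uniform_positive (fun b x => forall c, (c < N)%N -> W (th w) b -> W v c ->
    x%:E <= cocycle th B m (th w) b c)).
    by move=> b x y xy h c cN Wb Wc; apply: le_trans (h _ cN Wb Wc); rewrite lee_fin.
  move=> b bN; apply: (@uniform_positive (fun c x => W (th w) b -> W v c ->
    x%:E <= cocycle th B m (th w) b c)).
    by move=> c x y xy h Wb Wc; apply: le_trans (h Wb Wc); rewrite lee_fin.
  move=> c cN; have [[Wb Wc]|h] := pselect (W (th w) b /\ W v c); last first.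
    by exists 1%R => // Wb Wc; case: h.
  have c0 := connected bN cN Wb Wc; have cf := connected_fin c Wb.
  exists (fine (cocycle th B m (th w) b c)); first by rewrite fine_gt0// c0 ltey_eq cf.
  by rewrite fineK.
(* There may be infinitely many j; the ratio condition at v bounds all nonzero entries of row c
   below by a multiple of any one of them. *)
have [d2 d20 hd2] : exists2 x : R, (0 < x)%R & forall c, (c < N)%N ->
    forall j, B v c j != 0%R -> (x <= B v c j)%R.
  apply: (@uniform_positive (fun c x => forall j, B v c j != 0%R -> (x <= B v c j)%R)).
    by move=> c x y xy h j cj; exact: le_trans (h j cj).
  move=> c cN; have [[j0 cj0]|h] := pselect (exists j, B v c j != 0%R); last first.
    by exists 1%R => // j cj; case: h; exists j.
  exists (B v c j0 / K')%R; first by rewrite divr_gt0// lt0r cj0 B0.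
  move=> j cj; rewrite ler_pdivrMr// mulrC.
  by have [W1 W2] := Bsupp cj; have [_ W3] := Bsupp cj0; exact: ratio_v.
exists (K * C / (d1 * d2))%R; first by rewrite divr_gt0 ?mulr_gt0.
move=> i j k Wi Wj Wk; have [b bN ib] := big_images Wi; have [_ Wb] := Bsupp ib.
have Wj' : W (th v) j by move: Wj; rewrite /v -iterSr -iterS.
have [c cN cj] := big_preimages Wj'; have [Wc _] := Bsupp cj.
have ib0 : (0 < B w i b)%R by rewrite lt0r ib B0.
have up : cocycle th B m.+2 w i k <= (B w i b * (K * C))%:E.
  apply: (@le_trans _ _ ((K * B w i b)%:E * kapp (cocycle th B m.+1 (th w)) (letter_one R W (th w)) k)).
    rewrite /kapp -ge0_nneseriesZl; last 2 first.
    - by move=> l; rewrite mule_ge0 ?cocycle_ge0// lee_fin.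
    - by rewrite lee_fin mulr_ge0// ltW.
    rewrite [leLHS](_ : _ = \sum_(l <oo) ((B w i l)%:E * cocycle th B m.+1 (th w) l k))//.
    apply: lee_nneseries => l.
      by move=> _ _; rewrite mule_ge0 ?cocycle_ge0// lee_fin.
    move=> _; rewrite muleA; apply: lee_wpmul2r; first exact: cocycle_ge0.
    have [Wl|Wl] := pselect (W (th w) l).
      by rewrite letter_oneT// mule1 lee_fin; exact: ratio_w.
    have [->|/Bsupp[]//] := eqVneq (B w i l) 0%R.
    by rewrite letter_oneF// mule0.
  apply: (@le_trans _ _ ((K * B w i b)%:E * C%:E)).
    by apply: lee_wpmul2l => //; rewrite lee_fin mulr_ge0// ltW.
  by rewrite -EFinM lee_fin; lra.
have lo : (B w i b * (d1 * d2))%:E <= cocycle th B m.+2 w i j.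
  apply: le_trans (@cocycle_ge _ _ _ _ B0 1 m.+1 w i b j).
  rewrite cocycle1// EFinM; apply: lee_wpmul2l; first by rewrite lee_fin ltW.
  rewrite -addn1; apply: le_trans (@cocycle_ge _ _ _ _ B0 m 1 (th w) b c j).
  rewrite cocycle1// EFinM; apply: lee_pmul; rewrite ?lee_fin ?(ltW d10) ?(ltW d20)//.
    exact: hd1.
  exact: hd2.
apply: (le_trans up); apply: (@le_trans _ _ ((K * C / (d1 * d2))%:E * (B w i b * (d1 * d2))%:E)).
  rewrite -EFinM lee_fin [X in (_ <= X)%R]mulrCA divfK//.
  by rewrite gt_eqF ?mulr_gt0.
by apply: lee_wpmul2l => //; rewrite lee_fin divr_ge0 ?mulr_ge0 ?ltW.
Qed.

End GoodBlock.

(** * Invariant sets of full measure and visits in both time directions *)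

Section FullInvariantSet.
Context (d : measure_display) (Omega : measurableType d) (R : realType).
Variables (P : probability Omega R) (th thi : Omega -> Omega).
Hypothesis hth : ergodic_automorphism P th thi.

Lemma inverse_preserving (E : set Omega) : measurable E -> P (thi @^-1` E) = P E.
Proof.
move=> mE; rewrite -(ea_preserving hth); last first.
  by rewrite -[X in measurable X]setTI; exact: (ea_measurable_inv hth measurableT mE).
congr (P _); apply/seteqP; split=> w /=; by rewrite (ea_thK hth).
Qed.

Lemma inverse_ergodic (E : set Omega) : measurable E -> thi @^-1` E = E ->
  P E = 0%E \/ P E = 1%E.
Proof.
move=> mE iE; apply: (ea_ergodic hth) => //.
by rewrite -{1}iE; apply/seteqP; split=> w /=; rewrite (ea_thK hth).
Qed.

Lemma preserving_iter (f : Omega -> Omega) n (E : set Omega) :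
  measurable_fun setT f -> (forall E, measurable E -> P (f @^-1` E) = P E) ->
  measurable E -> P (iter n f @^-1` E) = P E.
Proof.
move=> mf Pf; elim: n E => // n IH E mE.
have -> : iter n.+1 f @^-1` E = iter n f @^-1` (f @^-1` E) by [].
rewrite IH ?Pf//.
by rewrite -[X in measurable X]setTI; exact: (mf measurableT _ mE).
Qed.

(** Removing all forward and backward preimages of the exceptional null set turns almost sure
    statements into pointwise ones valid along whole orbits. *)
Lemma full_invariant_set (Q : set Omega) : {ae P, forall w, Q w} ->
  exists D : set Omega, [/\ measurable D, {ae P, forall w, D w},
    (forall w, D w -> D (th w)), (forall w, D w -> D (thi w)) & D `<=` Q].
Proof.
move=> [N [mN N0 QN]].
have mith n : measurable (iter n th @^-1` N).
  exact: (measurable_preimage_iter (ea_measurable hth)).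
have mithi n : measurable (iter n thi @^-1` N).
  exact: (measurable_preimage_iter (ea_measurable_inv hth)).
pose E := (\bigcup_n iter n th @^-1` N) `|` (\bigcup_n iter n thi @^-1` N).
have mE : measurable E by apply: measurableU; exact: bigcupT_measurable.
exists (~` E); split.
- exact: measurableC.
- exists E; split => //; last by move=> w /=; rewrite /setC/= notK.
  apply/negligibleP => //; apply: negligibleU; apply: negligible_bigcup => n; apply/negligibleP => //.
    have := preserving_iter n (ea_measurable hth) (ea_preserving hth) mN.
    by rewrite N0.
  have := preserving_iter n (ea_measurable_inv hth) inverse_preserving mN.
  by rewrite N0.
- move=> w nE [[n _ h]|[[|n] _ h]]; apply: nE.
  + by left; exists n.+1 => //=; rewrite -iterS iterSr.
  + by left; exists 1%N.
  + by right; exists n => //; move: h; rewrite /preimage/= -iterS iterSr (ea_thK hth).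
- move=> w nE [[[|n] _ h]|[n _ h]]; apply: nE.
  + by right; exists 1%N.
  + by left; exists n => //; move: h; rewrite /preimage/= -iterS iterSr (ea_thiK hth).
  + by right; exists n.+1 => //=; rewrite -iterS iterSr.
- by move=> w nE; apply: contrapT => nQ; apply: nE; left; exists 0%N => //; exact: QN.
Qed.

Lemma visits_unbounded (f : Omega -> Omega) (G : set Omega) q w : (0 < q)%N ->
  ~ sparse f G q w -> exists K, forall n, (n <= q * visits f G n w + K)%N.
Proof.
move=> q0 /existsNP[K hK]; exists K => n; rewrite leqNgt; apply/negP => h.
by apply: hK; exists n.
Qed.

Lemma frequent_visits (G : set Omega) : measurable G -> (0 < P G)%E ->
  exists q, [/\ (0 < q)%N,
    {ae P, forall w, exists K, forall n, (n <= q * visits th G n w + K)%N} &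
    {ae P, forall w, exists K, forall n, (n <= q * visits thi G n w + K)%N}].
Proof.
move=> mG G0.
have [q q0 hq] := positive_frequency (ea_measurable hth) (ea_preserving hth) (ea_ergodic hth) mG G0.
have [q' q'0 hq'] := positive_frequency (ea_measurable_inv hth) inverse_preserving inverse_ergodic mG G0.
exists (q + q')%N; split; first by rewrite addn_gt0 q0.
- exists (sparse th G q); split => //.
    exact: (measurable_sparse (ea_measurable hth) mG).
  move=> w /= h; apply: contrapT => sw; apply: h.
  have [K hK] := visits_unbounded q0 sw; exists K => n.
  by rewrite (leq_trans (hK n))// leq_add2r leq_mul2r leq_addr orbT.
- exists (sparse thi G q'); split => //.
    exact: (measurable_sparse (ea_measurable_inv hth) mG).
  move=> w /= h; apply: contrapT => sw; apply: h.
  have [K hK] := visits_unbounded q'0 sw; exists K => n.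
  by rewrite (leq_trans (hK n))// leq_add2r leq_mul2r leq_addl orbT.
Qed.

End FullInvariantSet.

(** * The left eigenvector obtained from the time reversal *)

Section EigenfunctionOfReversal.
Context (Omega : Type) (R : realType).
Variables (th thi : Omega -> Omega) (W : Omega -> set nat).
Variable B : Omega -> nat -> nat -> R.
Hypotheses (thK : cancel th thi).
Hypothesis B0 : forall w i j, 0 <= B w i j.
Hypothesis Bsupp : forall w i j, B w i j != 0%R -> W w i /\ W (th w) j.
Variables (D : set Omega) (mu : Omega -> nat -> R) (lam : Omega -> R).
Hypotheses (Dth : forall w, D w -> D (th w)).

(* The time reversal of [B] in the sense of Markov chains: its conformal vector
   is the product of the left and right eigenvectors of [B]. *)
Definition reversal (w : Omega) (i j : nat) : R :=
  (mu w i * B (thi w) j i * (mu (thi w) j)^-1)%R.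

Local Open Scope ereal_scope.
Hypothesis mu_ge0 : forall w i, (0 <= mu w i)%R.
Hypothesis mu_supp : forall w i, D w -> ~ W w i -> mu w i = 0%R.
Hypothesis mu_gt0 : forall w i, D w -> W w i -> (0 < mu w i)%R.
Hypothesis mu_sum1 : forall w, D w -> \sum_(i <oo) (mu w i)%:E = 1.
Hypothesis mu_right : forall w i, D w ->
  \sum_(k <oo) (B w i k * mu (th w) k)%:E = (lam w * mu w i)%:E.
Hypothesis lam_gt0 : forall w, D w -> (0 < lam w)%R.
Variables (pi : Omega -> nat -> R) (lam' : Omega -> R).
Hypothesis pi_ge0 : forall w i, (0 <= pi w i)%R.
Hypothesis pi_supp : forall w i, D w -> ~ W w i -> pi w i = 0%R.
Hypothesis pi_gt0 : forall w i, D w -> W w i -> (0 < pi w i)%R.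
Hypothesis pi_sum1 : forall w, D w -> \sum_(i <oo) (pi w i)%:E = 1.
Hypothesis pi_right : forall w i, D w ->
  \sum_(k <oo) (reversal w i k * pi (thi w) k)%:E = (lam' w * pi w i)%:E.
Hypothesis lam'_gt0 : forall w, D w -> (0 < lam' w)%R.

Definition eigenfunction (w : Omega) (i : nat) : R := (pi w i * (mu w i)^-1)%R.
Local Notation h := eigenfunction.

Lemma eigenfunction_ge0 w i : (0 <= h w i)%R.
Proof. by rewrite mulr_ge0 ?invr_ge0// pi_ge0. Qed.

Lemma eigenfunction_supp w i : D w -> ~ W w i -> h w i = 0%R.
Proof. by move=> Dw Wi; rewrite /h pi_supp// mul0r. Qed.

Lemma eigenfunction_gt0 w i : D w -> W w i -> (0 < h w i)%R.
Proof. by move=> Dw Wi; apply: divr_gt0; [exact: pi_gt0|exact: mu_gt0]. Qed.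

Lemma eigenfunction_mu w i : D w -> (h w i * mu w i)%R = pi w i.
Proof.
move=> Dw; have [Wi|Wi] := pselect (W w i); last by rewrite pi_supp// mu_supp// mulr0.
by rewrite divfK// gt_eqF// mu_gt0.
Qed.

Lemma eigenfunction_sum1 w : D w -> \sum_(i <oo) (h w i * mu w i)%:E = 1.
Proof. by move=> Dw; under eq_eseriesr do rewrite eigenfunction_mu//; exact: pi_sum1. Qed.

Let left_rev w j : D w -> \sum_(i <oo) (h w i * B w i j)%:E =
  (lam' (th w) * h (th w) j)%:E.
Proof.
move=> Dw; have D' := Dth Dw.
have [Wj|Wj] := pselect (W (th w) j); last first.
  rewrite eigenfunction_supp// mulr0 eseries0// => i _ _.
  by have [->|/Bsupp[]//] := eqVneq (B w i j) 0%R; rewrite mulr0.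
have m0 := mu_gt0 D' Wj.
have := pi_right j D'; rewrite thK => e.
rewrite {2}/h [(pi _ _ * _)%R]mulrC mulrCA EFinM -e -ge0_nneseriesZl; last 2 first.
- by move=> i; rewrite lee_fin !mulr_ge0 ?invr_ge0.
- by rewrite lee_fin invr_ge0 ltW.
apply: eq_eseriesr => i _; rewrite -EFinM /reversal thK /h; congr EFin.
have mi : ((mu (th w) j)^-1 * mu (th w) j = 1)%R by rewrite mulVf// gt_eqF.
have -> : ((mu (th w) j)^-1 * (mu (th w) j * B w i j / mu w i * pi w i) =
  ((mu (th w) j)^-1 * mu (th w) j) * (B w i j / mu w i * pi w i))%R by rewrite !mulrA.
by rewrite mi mul1r; lra.
Qed.

(** Evaluate h B_w mu in two orders: from the left it gives the eigenvalue of the reversal, from the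
    right that of B, each times the sum of h mu, which is 1. *)
Lemma pairing w : D w -> lam' (th w) = lam w.
Proof.
move=> Dw; have D' := Dth Dw.
have e1 : \sum_(j <oo) (mu (th w) j)%:E * \sum_(i <oo) (h w i * B w i j)%:E =
   (lam' (th w))%:E.
  under eq_eseriesr do rewrite left_rev// -EFinM mulrCA EFinM.
  rewrite ge0_nneseriesZl; last 2 first.
  - by move=> i; rewrite lee_fin mulr_ge0 ?eigenfunction_ge0.
  - by rewrite lee_fin ltW// lam'_gt0//; exact: Dth.
  under eq_eseriesr do rewrite mulrC.
  by rewrite eigenfunction_sum1// mule1.
have e2 : \sum_(j <oo) (mu (th w) j)%:E * \sum_(i <oo) (h w i * B w i j)%:E = (lam w)%:E.
  transitivity (\sum_(j <oo) \sum_(i <oo) ((mu (th w) j)%:E * (h w i * B w i j)%:E)).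
    apply: eq_eseriesr => j _; rewrite ge0_nneseriesZl ?lee_fin// => i.
    by rewrite lee_fin mulr_ge0 ?eigenfunction_ge0.
  rewrite nneseries_interchange; last first.
    by move=> i k; apply: mule_ge0; rewrite lee_fin// mulr_ge0// eigenfunction_ge0.
  rewrite -[RHS]mule1 -(eigenfunction_sum1 Dw) -ge0_nneseriesZl; last 2 first.
  - by move=> i; rewrite lee_fin mulr_ge0 ?eigenfunction_ge0.
  - by rewrite lee_fin ltW// lam_gt0.
  apply: eq_eseriesr => i _; rewrite -EFinM mulrCA EFinM -mu_right// -ge0_nneseriesZl; last 2 first.
  - by move=> j; rewrite lee_fin mulr_ge0.
  - by rewrite lee_fin eigenfunction_ge0.
  by apply: eq_eseriesr => j _; rewrite -!EFinM; congr EFin; lra.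
by apply: EFin_inj; rewrite -e1 e2.
Qed.

Lemma eigenfunction_left w j : D w ->
  \sum_(i <oo) (h w i * B w i j)%:E = (lam w * h (th w) j)%:E.
Proof. by move=> Dw; rewrite left_rev// pairing. Qed.

End EigenfunctionOfReversal.

(** * Rate of convergence and lower bound for the left eigenvector *)

Section RateOfConvergence.
Context (d : measure_display) (Omega : measurableType d) (R : realType).
Variables (th thi : Omega -> Omega) (W : Omega -> set nat).
Variable B : Omega -> nat -> nat -> R.
Hypotheses (thiK : cancel thi th).
Hypothesis B0 : forall w i j, 0 <= B w i j.
Hypothesis Bsupp : forall w i j, B w i j != 0%R -> W w i /\ W (th w) j.
Variables (D G : set Omega) (n0 : nat) (eta rho Q : R).
Hypotheses (Dth : forall w, D w -> D (th w)) (Dthi : forall w, D w -> D (thi w)).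
Hypothesis Wne : forall w, D w -> W w !=set0.
Hypotheses (n0_gt0 : (0 < n0)%N) (eta01 : (0 < eta <= 1)%R) (rho01 : (0 < rho < 1)%R).
Hypothesis rho_eta : (1 - eta <= rho ^+ n0)%R.
Hypothesis crG : forall w, D w -> G w -> cross_ratio_ge eta (cocycle th B n0 w).
Variables (mu h : Omega -> nat -> R) (lam : Omega -> R).
Hypothesis mu_ge0 : forall w i, (0 <= mu w i)%R.
Hypothesis h_ge0 : forall w i, (0 <= h w i)%R.
Hypothesis h_gt0 : forall w i, D w -> W w i -> (0 < h w i)%R.
Hypothesis h_supp : forall w i, D w -> ~ W w i -> h w i = 0%R.
Hypothesis lam_gt0 : forall w, D w -> (0 < lam w)%R.
Local Open Scope ereal_scope.
Hypothesis hmu_sum1 : forall w, D w -> \sum_(i <oo) (h w i * mu w i)%:E = 1.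
Hypothesis mu_right : forall w i, D w ->
  \sum_(k <oo) (B w i k * mu (th w) k)%:E = (lam w * mu w i)%:E.
Hypothesis h_left : forall w j, D w ->
  \sum_(i <oo) (h w i * B w i j)%:E = (lam w * h (th w) j)%:E.

Local Notation Lam := (birkhoff_prod th lam).

Lemma birkhoff_prodS n w : Lam n.+1 w = (Lam n w * lam (iter n th w))%R.
Proof. by rewrite /birkhoff_prod big_ord_recr. Qed.

Lemma birkhoff_prod_gt0 n w : D w -> (0 < Lam n w)%R.
Proof. by move=> Dw; apply: prodr_gt0 => i _; apply: lam_gt0; exact: invariant_iter. Qed.

Lemma transfer_eigenfunction n w j : D w ->
  transfer th B n w (fun i => (h w i)%:E) j = (Lam n w * h (iter n th w) j)%:E.
Proof.
move=> Dw; elim: n j => [|n IH] j; first by rewrite /birkhoff_prod big_ord0 mul1r.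
have L0 := birkhoff_prod_gt0 n Dw.
rewrite transferS birkhoff_prodS /kapp -mulrA iterS EFinM -h_left; last exact: invariant_iter.
rewrite -ge0_nneseriesZl; last 2 first.
- by move=> i; rewrite lee_fin mulr_ge0.
- by rewrite lee_fin ltW.
by apply: eq_eseriesr => i _; rewrite IH -!EFinM mulrA.
Qed.

Lemma cocycle_eigenmeasure n w i : D w ->
  \sum_(j <oo) (cocycle th B n w i j * (mu (iter n th w) j)%:E) = (Lam n w * mu w i)%:E.
Proof.
move=> Dw; elim: n => [|n IH].
  rewrite /birkhoff_prod big_ord0 mul1r -[RHS](@nneseries_delta _ (fun j => (mu w j)%:E) i); last first.
    by move=> j; rewrite lee_fin.
  by apply: eq_eseriesr => j _ /=; rewrite eq_sym.
rewrite birkhoff_prodS mulrAC mulrC EFinM -IH -ge0_nneseriesZl; last 2 first.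
- by move=> j; rewrite mule_ge0 ?cocycle_ge0// lee_fin.
- by rewrite lee_fin ltW// lam_gt0//; exact: invariant_iter.
transitivity (\sum_(j <oo) \sum_(k <oo)
   (cocycle th B n w i k * (B (iter n th w) k j)%:E * (mu (iter n.+1 th w) j)%:E)).
  apply: eq_eseriesr => j _; rewrite cocycleSr// ge0_nneseriesZr ?lee_fin// => k.
  by rewrite mule_ge0 ?cocycle_ge0// lee_fin.
rewrite nneseries_interchange; last first.
  by move=> j k; rewrite !mule_ge0 ?cocycle_ge0// lee_fin.
apply: eq_eseriesr => k _; rewrite muleCA -EFinM -mu_right; last exact: invariant_iter.
rewrite -ge0_nneseriesZl ?cocycle_ge0//; last by move=> j; rewrite lee_fin mulr_ge0.
by apply: eq_eseriesr => j _; rewrite EFinM muleA.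
Qed.

Lemma reference_eigenfunction w : D w -> reference th B W w (fun i => (h w i)%:E).
Proof.
move=> Dw; split.
- by move=> i; rewrite lee_fin.
- by move=> n j; rewrite transfer_eigenfunction.
- move=> n j Wj; rewrite transfer_eigenfunction// lte_fin mulr_gt0 ?birkhoff_prod_gt0//.
  by rewrite h_gt0//; exact: invariant_iter.
- move=> n j Wj; rewrite transfer_eigenfunction// h_supp ?mulr0//.
  exact: invariant_iter.
Qed.

Lemma cocycle_le_eigenfunction n w i j : D w -> W w i ->
  cocycle th B n w i j <= ((h w i)^-1 * (Lam n w * h (iter n th w) j))%:E.
Proof.
move=> Dw Wi; rewrite EFinM -transfer_eigenfunction// -transfer_delta//.
have <- : transfer th B n w (fun k => ((h w i)^-1)%:E * (h w k)%:E) j =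
    ((h w i)^-1)%:E * transfer th B n w (fun k => (h w k)%:E) j.
  by rewrite transferZ ?lee_fin ?invr_ge0// => k; rewrite lee_fin.
apply: le_transfer => // k.
have [->|_] := eqVneq k i; first by rewrite -EFinM mulVf// gt_eqF// h_gt0.
by rewrite -EFinM lee_fin mulr_ge0// invr_ge0.
Qed.

Lemma cocycle_fin_eigen n w i j : D w -> W w i -> cocycle th B n w i j \is a fin_num.
Proof.
move=> Dw Wi; rewrite ge0_fin_numE ?cocycle_ge0//.
by rewrite (le_lt_trans (cocycle_le_eigenfunction n j Dw Wi))// ltry.
Qed.

(** Contraction with reference vector h: the unit vector at i lies between 0 and h / h_i, so the
    initial gap is 1 / h_i, which explains the factor [h w i] on the left. *)
Lemma cocycle_rate n w i j : D w -> W w i -> W (iter n th w) j ->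
  (`|fine (cocycle th B n w i j) / (Lam n w * h (iter n th w) j) - mu w i| * h w i <=
    rho ^+ visits th G n w / rho ^+ n0)%R.
Proof.
move=> Dw Wi Wj.
have Dn := invariant_iter Dth n Dw.
have h0 := h_gt0 Dw Wi; have hn0 := h_gt0 Dn Wj; have L0 := birkhoff_prod_gt0 n Dw.
have /andP[eta0 eta1] := eta01; have /andP[rho0 rho1] := rho01.
have eta01' : (0 <= eta <= 1)%R by rewrite ltW.
have rho01' : (0 < rho <= 1)%R by rewrite rho0 ltW.
have [] := contraction B0 Dth Wne n0_gt0 eta01' rho01' rho_eta crG n Dw (reference_eigenfunction Dw)
  (f := fun k => (k == i)%:R%:E) (m := 0%R) (M := (h w i)^-1%R).
- by move=> k; rewrite lee_fin.
- by [].
- by rewrite invr_ge0.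
- move=> k; rewrite mul0e lee_fin ler0n /=.
  have [->|_] := eqVneq k i; first by rewrite -EFinM mulVf// gt_eqF.
  by rewrite -EFinM lee_fin mulr_ge0// invr_ge0.
move=> m [M [h1 h2 h3 h4 h5]].
have cf k := cocycle_fin_eigen n k Dw Wi.
have b k : W (iter n th w) k ->
    (m <= fine (cocycle th B n w i k) / (Lam n w * h (iter n th w) k) <= M)%R.
  move=> Wk; have := h5 k; rewrite transfer_delta// transfer_eigenfunction//.
  rewrite -(fineK (cf k)) -!EFinM !lee_fin => /andP[l1 l2].
  have p : (0 < Lam n w * h (iter n th w) k)%R by rewrite mulr_gt0// h_gt0.
  by rewrite ler_pdivlMr// ler_pdivrMr// l1.
(* By [cocycle_eigenmeasure], mu_i is the average of the normalized entries of row i with the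
   weights h mu at time n, so any bracket for these entries contains it. *)
have mb : (m <= mu w i <= M)%R.
  have e := cocycle_eigenmeasure n i Dw.
  have e' : \sum_(k <oo) ((Lam n w)%:E * (h (iter n th w) k * mu (iter n th w) k)%:E) = (Lam n w)%:E.
    rewrite ge0_nneseriesZl ?lee_fin ?(ltW L0)//; last by move=> k; rewrite lee_fin mulr_ge0.
    by rewrite hmu_sum1// mule1.
  have M0 : (0 <= M)%R by rewrite (le_trans h1)// (le_trans h2).
  apply/andP; split.
    rewrite -(ler_pM2l L0) -lee_fin -e mulrC EFinM -e' -ge0_nneseriesZl; last 2 first.
    - by move=> k; rewrite -EFinM lee_fin mulr_ge0 ?(ltW L0)// mulr_ge0.
    - by rewrite lee_fin.
    apply: lee_nneseries => k.
      by move=> _ _; rewrite -!EFinM lee_fin mulr_ge0// mulr_ge0 ?(ltW L0)// mulr_ge0.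
    move=> _; have := h5 k; rewrite transfer_delta// transfer_eigenfunction// => /andP[l1 _].
    rewrite [(h _ _ * mu _ _)%:E]EFinM !muleA; apply: lee_wpmul2r; first by rewrite lee_fin.
    by apply: le_trans l1; rewrite -!EFinM lee_fin mulrA.
  rewrite -(ler_pM2l L0) -lee_fin -e [(_ * M)%R]mulrC [leRHS]EFinM -e' -ge0_nneseriesZl; last 2 first.
  - by move=> k; rewrite -EFinM lee_fin mulr_ge0 ?(ltW L0)// mulr_ge0.
  - by rewrite lee_fin.
  apply: lee_nneseries => k.
    by move=> _ _; rewrite mule_ge0 ?cocycle_ge0// lee_fin.
  move=> _; have := h5 k; rewrite transfer_delta// transfer_eigenfunction// => /andP[_ l1].
  rewrite [(h _ _ * mu _ _)%:E]EFinM !muleA; apply: lee_wpmul2r; first by rewrite lee_fin.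
  by apply: (le_trans l1); rewrite -!EFinM lee_fin mulrA.
have rn0 : (0 < rho ^+ n0)%R by rewrite exprn_gt0.
rewrite ler_pdivlMr//.
apply: (@le_trans _ _ ((M - m) * h w i * rho ^+ n0)%R).
  rewrite !ler_wpM2r ?(ltW h0) ?(ltW rn0)// ler_norml.
  by have := b j Wj; move: mb; lra.
move: h4; rewrite subr0 -(ler_pM2r h0) -!mulrA mulVf ?gt_eqF// mulr1 => h4.
by apply: le_trans h4; lra.
Qed.

Section LowerBound.
Hypothesis Q_gt0 : (0 < Q)%R.
Hypothesis comparable_columns : forall w, D w -> G w -> forall i j k,
  W (iter n0 th w) j -> W (iter n0 th w) k ->
  cocycle th B n0 w i k <= Q%:E * cocycle th B n0 w i j.
Hypothesis Bcol : forall w, D w -> exists s S : R, (0 < s)%R /\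
  forall j, W (th w) j -> s%:E <= \sum_(i <oo) (B w i j)%:E <= S%:E.
Hypothesis Ghit_inv : forall w, D w -> exists k, G (iter k thi w).

Let bounded_below w := exists2 c : R, (0 < c)%R & forall i, W w i -> (c <= h w i)%R.

(** The left eigenvector equation transports a lower bound by means of the lower bound on column
    sums. *)
Lemma bounded_below_step w : D w -> bounded_below w -> bounded_below (th w).
Proof.
move=> Dw [c c0 hc]; have [s [S [s0 hs]]] := Bcol Dw; have l0 := lam_gt0 Dw.
exists (c * s / lam w)%R; first by rewrite divr_gt0// mulr_gt0.
move=> j Wj; rewrite ler_pdivrMr// mulrC [leRHS]mulrC -lee_fin -h_left//.
have /andP[h1 _] := hs j Wj.
apply: (@le_trans _ _ (c%:E * \sum_(i <oo) (B w i j)%:E)).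
  by rewrite mulrC EFinM; apply: lee_wpmul2l => //; rewrite lee_fin ltW.
rewrite -ge0_nneseriesZl; last 2 first.
- by move=> i; rewrite lee_fin.
- by rewrite lee_fin ltW.
apply: lee_nneseries => i; first by move=> _ _; rewrite -EFinM lee_fin mulr_ge0// ltW.
move=> _; rewrite -EFinM lee_fin.
have [->|/Bsupp[Wi _]] := eqVneq (B w i j) 0%R; first by rewrite !mulr0.
by rewrite ler_wpM2r// hc.
Qed.

(** At the end of the block h is a multiple of h B^n0, so comparability of columns becomes
    comparability of the entries of h. *)
Lemma bounded_below_block w : D w -> G w -> bounded_below (iter n0 th w).
Proof.
move=> Dw Gw; have Dn := invariant_iter Dth n0 Dw.
have [k Wk] := Wne Dn; have L0 := birkhoff_prod_gt0 n0 Dw.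
exists (h (iter n0 th w) k / Q)%R; first by rewrite divr_gt0// h_gt0.
move=> j Wj; rewrite ler_pdivrMr// mulrC -(ler_pM2l L0) mulrCA -lee_fin [leRHS]EFinM.
rewrite -!transfer_eigenfunction// !transferE//; try by move=> i; rewrite lee_fin.
rewrite /kapp -ge0_nneseriesZl; last 2 first.
- by move=> i; rewrite mule_ge0 ?cocycle_ge0// lee_fin.
- by rewrite lee_fin ltW.
apply: lee_nneseries => i; first by move=> _ _; rewrite mule_ge0 ?cocycle_ge0// lee_fin.
move=> _; rewrite muleCA; apply: lee_wpmul2l; first by rewrite lee_fin.
exact: comparable_columns.
Qed.

Lemma eigenfunction_bounded_below w : D w ->
  exists2 c : R, (0 < c)%R & forall i, W w i -> (c <= h w i)%R.
Proof.
move=> Dw.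
(* Going back n0 steps before the search ensures that the good block found is completed before w;
   the remaining k steps are single ones. *)
have [k Gk] := Ghit_inv (invariant_iter Dthi n0 Dw).
have Dk : D (iter k thi (iter n0 thi w)) by do 2 apply: (invariant_iter Dthi).
have iK n v : iter n th (iter n thi v) = v.
  by elim: n v => // n IH v; rewrite iterSr iterS thiK IH.
have h1 := bounded_below_block Dk Gk.
suff h2 n : bounded_below (iter n th (iter n0 th (iter k thi (iter n0 thi w)))).
  have := h2 k; rewrite -iterD addnC iterD iK iK.
  by [].
elim: n => // n IH; apply: bounded_below_step => //.
by do 2 apply: (invariant_iter Dth).
Qed.

End LowerBound.

End RateOfConvergence.

(** * Both eigenvectors from visits in both time directions *)

Section TwoSided.
Context (d : measure_display) (Omega : measurableType d) (R : realType).
Variables (th thi : Omega -> Omega) (W : Omega -> set nat).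
Variable B : Omega -> nat -> nat -> R.
Hypotheses (thK : cancel th thi) (thiK : cancel thi th).
Hypothesis B0 : forall w i j, 0 <= B w i j.
Hypothesis Bsupp : forall w i j, B w i j != 0%R -> W w i /\ W (th w) j.
Variables (D G : set Omega) (n0 : nat) (eta rho Q : R).
Hypotheses (Dth : forall w, D w -> D (th w)) (Dthi : forall w, D w -> D (thi w)).
Hypothesis Wne : forall w, D w -> W w !=set0.
Hypotheses (n0_gt0 : (0 < n0)%N) (eta01 : (0 < eta <= 1)%R) (rho01 : (0 < rho < 1)%R).
Hypothesis rho_eta : (1 - eta <= rho ^+ n0)%R.
Hypothesis Q_gt0 : 0 < Q.
Hypothesis comparable_columns : forall w, D w -> G w -> forall i j k,
  W (iter n0 th w) j -> W (iter n0 th w) k ->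
  (cocycle th B n0 w i k <= Q%:E * cocycle th B n0 w i j)%E.
Hypothesis Q_eta : eta * Q ^+ 2 <= 1.
Hypothesis Bcol : forall w, D w -> exists s S : R, (0 < s)%R /\
  forall j, W (th w) j -> (s%:E <= \sum_(i <oo) (B w i j)%:E <= S%:E)%E.
Hypothesis Brow : forall w, D w -> forall i, W w i -> exists j, B w i j != 0.
Hypothesis Gvisits : forall w, D w -> forall N, exists n, (N <= visits th G n w)%N.
Hypothesis Gvisits_inv : forall w, D w -> forall N, exists n, (N <= visits thi G n w)%N.
Local Open Scope ereal_scope.

(** The columns j and j' are exchanged in both factors, each exchange costing Q; this is the origin
    of eta Q^2 <= 1. *)
Lemma cross_ratio_block w : D w -> G w -> cross_ratio_ge eta (cocycle th B n0 w).
Proof.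
move=> Dw Gw i i' j j'; set c := cocycle th B n0 w.
have /andP[eta0 _] := eta01.
have c0 a b : 0 <= c a b by exact: cocycle_ge0.
have cs a b : ~ W (iter n0 th w) b -> c a b = 0.
  move=> Wb; apply: contrapT => /eqP h.
  by have [] := cocycle_supp B0 Bsupp n0_gt0 h.
have [Wj|Wj] := pselect (W (iter n0 th w) j); last by rewrite !(cs _ j)// mul0e !mule0.
have [Wj'|Wj'] := pselect (W (iter n0 th w) j'); last by rewrite !(cs _ j')// mul0e !mule0.
apply: (@le_trans _ _ (eta%:E * ((Q%:E * c i j) * (Q%:E * c i' j')))).
  apply: lee_wpmul2l; first by rewrite lee_fin ltW.
  by apply: lee_pmul => //; exact: comparable_columns.
have -> : eta%:E * (Q%:E * c i j * (Q%:E * c i' j')) =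
    (eta * Q ^+ 2)%:E * (c i j * c i' j').
  by rewrite [X in eta%:E * X]muleACA [LHS]muleA -!EFinM expr2.
by rewrite -[leRHS]mul1e; apply: lee_wpmul2r; [exact: mule_ge0|rewrite lee_fin].
Qed.

Definition eigenmeasure : Omega -> nat -> R := conformal_vec th W B.
Definition eigenvalue : Omega -> R := growth th W B.
Local Notation mu := eigenmeasure.
Local Notation lam := eigenvalue.

Let mu_ge0 w i : (0 <= mu w i)%R. Proof. exact: conformal_ge0. Qed.
Let mu_supp w i : D w -> ~ W w i -> mu w i = 0%R.
Proof. exact: (conformal_supp B0 Bsupp Dth Bcol). Qed.
Let mu_gt0 w i : D w -> W w i -> (0 < mu w i)%R.
Proof. exact: (conformal_gt0 B0 Bsupp Dth Wne eta01 cross_ratio_block Bcol Brow Gvisits). Qed.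
Let mu_sum1 w : D w -> \sum_(i <oo) (mu w i)%:E = 1.
Proof. exact: (conformal_sum1 B0 Bsupp Dth Wne n0_gt0 eta01 rho01 rho_eta cross_ratio_block Bcol Gvisits). Qed.
Let mu_right w i : D w -> \sum_(k <oo) (B w i k * mu (th w) k)%:E = (lam w * mu w i)%:E.
Proof. exact: (conformal_eigen B0 Bsupp Dth Wne n0_gt0 eta01 rho01 rho_eta cross_ratio_block Bcol Gvisits). Qed.
Let lam_gt0 w : D w -> (0 < lam w)%R.
Proof.
by move=> Dw; have [] := growthE B0 Bsupp Dth Wne n0_gt0 eta01 rho01 rho_eta cross_ratio_block Bcol Gvisits Dw.
Qed.

Local Notation reversal := (reversal thi B mu).

Let rev_ge0 w i j : (0 <= reversal w i j)%R.
Proof. by rewrite !mulr_ge0 ?invr_ge0. Qed.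

Let rev_supp w i j : reversal w i j != 0%R -> W w i /\ W (thi w) j.
Proof.
rewrite /reversal mulf_eq0 negb_or mulf_eq0 negb_or => /andP[/andP[_ h] _].
by have [Wj] := Bsupp h; rewrite thiK.
Qed.

Let DthiN n w : D w -> D (iter n thi w).
Proof. exact: (invariant_iter Dthi). Qed.

Let iter_thiK n w : iter n th (iter n thi w) = w.
Proof. by elim: n w => // n IH w; rewrite iterSr iterS thiK IH. Qed.

Let iter_th_thi n w : iter n th (iter n.+1 thi w) = thi w.
Proof. by rewrite iterSr iter_thiK. Qed.

(** The product of reversals is the transposed forward product over the same stretch of orbit; the
    intermediate factors mu telescope. *)
Lemma cocycle_reversal n w i j : D w -> W (iter n thi w) j ->
  cocycle thi reversal n w i j =
  (mu w i)%:E * cocycle th B n (iter n thi w) j i * ((mu (iter n thi w) j)^-1)%:E.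
Proof.
elim: n w i => [|n IH] w i Dw Wj.
  rewrite /= eq_sym; case: eqVneq => [<-|_]; last by rewrite mule0 mul0e.
  by rewrite mule1 -EFinM divff// gt_eqF// mu_gt0.
rewrite [cocycle th B _ _ _ _]cocycleSr// iter_th_thi [LHS]/=.
rewrite -ge0_nneseriesZl; last 2 first.
- by move=> k; rewrite mule_ge0 ?cocycle_ge0// lee_fin.
- by rewrite lee_fin.
rewrite -ge0_nneseriesZr; last 2 first.
- by move=> k; rewrite !mule_ge0 ?cocycle_ge0// lee_fin.
- by rewrite lee_fin invr_ge0.
apply: eq_eseriesr => k _.
have [Bk|Bk] := eqVneq (B (thi w) k i) 0%R.
  by rewrite /reversal Bk mulr0 mul0r mul0e !mule0 mul0e.
have [Wk _] := Bsupp Bk.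
rewrite (IH (thi w)); [|exact: Dthi|by rewrite -iterSr].
rewrite -!iterSr /reversal.
have mk : mu (thi w) k != 0%R by rewrite gt_eqF// mu_gt0//; exact: Dthi.
set c := cocycle _ _ _ _ _ _; set x := ((mu (iter n.+1 thi w) j)^-1)%R.
have -> : (mu w i * B (thi w) k i * (mu (thi w) k)^-1)%:E * ((mu (thi w) k)%:E * c * x%:E) =
  ((mu w i * B (thi w) k i * (mu (thi w) k)^-1)%:E * (mu (thi w) k)%:E) * c * x%:E.
  by rewrite !muleA.
rewrite -EFinM divfK//; congr (_ * _).
by rewrite [c * _]muleC muleA -EFinM.
Qed.

(** A reversed block of length n0 from w covers the forward block that starts n0 steps earlier. *)
Let revG : set Omega := [set w | G (iter n0 thi w)].

(** Transposition permutes the four entries of a cross ratio, and the diagonal factors are the same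
    on both sides. *)
Let rev_cross w : D w -> revG w -> cross_ratio_ge eta (cocycle thi reversal n0 w).
Proof.
move=> Dw Gw i i' j j'; set c := cocycle thi reversal n0 w.
have c0 a b : 0 <= c a b by exact: cocycle_ge0.
have cs a b : ~ W (iter n0 thi w) b -> c a b = 0.
  move=> Wb; apply: contrapT => /eqP h.
  by have [] := cocycle_supp rev_ge0 rev_supp n0_gt0 h.
have [Wj|Wj] := pselect (W (iter n0 thi w) j); last by rewrite !(cs _ j)// mul0e !mule0.
have [Wj'|Wj'] := pselect (W (iter n0 thi w) j'); last by rewrite !(cs _ j')// mul0e !mule0.
rewrite /c !cocycle_reversal//.
have h := cross_ratio_block (DthiN n0 Dw) Gw j j' i i'.
have e x y z t (u v : \bar R) : x * u * y * (z * v * t) = (x * z * (y * t)) * (u * v).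
  by rewrite (AC (3*3) (1*4*(3*6)*(2*5))).
rewrite [X in _ * X <= _]e [leRHS]e muleCA.
rewrite [((mu (iter n0 thi w) j')^-1)%:E * _]muleC; apply: lee_wpmul2l.
  by rewrite -!EFinM lee_fin !mulr_ge0 ?invr_ge0.
by rewrite [cocycle _ _ _ _ j' i * _]muleC.
Qed.

(** The eigenvector equation for mu says that every admissible column of the reversal sums to
    [lam (thi w)]. No bound on the row sums of B enters. *)
Let rev_col w : D w -> exists s S : R, (0 < s)%R /\
  forall j, W (thi w) j -> s%:E <= \sum_(i <oo) (reversal w i j)%:E <= S%:E.
Proof.
move=> Dw; have Di := Dthi Dw; exists (lam (thi w)), (lam (thi w)); split; first exact: lam_gt0.
move=> j Wj; have m0 := mu_gt0 Di Wj.
suff -> : \sum_(i <oo) (reversal w i j)%:E = (lam (thi w))%:E by rewrite lexx.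
have := mu_right j Di; rewrite thiK => h.
have -> : (lam (thi w))%:E = (lam (thi w) * mu (thi w) j)%:E * ((mu (thi w) j)^-1)%:E.
  by rewrite -EFinM mulfK// gt_eqF.
rewrite -h -ge0_nneseriesZr; last 2 first.
- by move=> i; rewrite lee_fin mulr_ge0.
- by rewrite lee_fin invr_ge0.
by apply: eq_eseriesr => i _; rewrite -EFinM /reversal [(mu w i * _)%R]mulrC.
Qed.

Let col_gt0 w j : D w -> W (th w) j -> exists i, B w i j != 0%R.
Proof.
move=> Dw Wj; apply: contrapT => /forallNP h.
have [s [S [s0 hs]]] := Bcol Dw; have /andP[+ _] := hs j Wj.
rewrite eseries0; last by move=> i _ _; congr EFin; apply/eqP/negPn/negP/h.
by rewrite leNgt lte_fin s0.
Qed.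

Let rev_row w : D w -> forall i, W w i -> exists j, reversal w i j != 0%R.
Proof.
move=> Dw i Wi; have Di := Dthi Dw.
have [|j Bj] := @col_gt0 (thi w) i Di; first by rewrite thiK.
exists j; have [Wj _] := Bsupp Bj.
by rewrite /reversal !mulf_neq0 ?invr_neq0// gt_eqF// mu_gt0.
Qed.

Let visits_revG n w : visits thi revG n w = visits thi G n (iter n0 thi w).
Proof.
elim: n w => //= n IH w; rewrite IH -iterS iterSr; congr (_ + _)%N.
Qed.

Let rev_visits w : D w -> forall N, exists n, (N <= visits thi revG n w)%N.
Proof.
move=> Dw N; have [n hn] := Gvisits_inv (DthiN n0 Dw) N.
by exists n; rewrite visits_revG.
Qed.

Local Notation pi := (conformal_vec thi W reversal).

Let pi_ge0 w i : (0 <= pi w i)%R. Proof. exact: conformal_ge0. Qed.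
Let pi_supp w i : D w -> ~ W w i -> pi w i = 0%R.
Proof. exact: (conformal_supp rev_ge0 rev_supp Dthi rev_col). Qed.
Let pi_gt0 w i : D w -> W w i -> (0 < pi w i)%R.
Proof. exact: (conformal_gt0 rev_ge0 rev_supp Dthi Wne eta01 rev_cross rev_col rev_row rev_visits). Qed.
Let pi_sum1 w : D w -> \sum_(i <oo) (pi w i)%:E = 1.
Proof. exact: (conformal_sum1 rev_ge0 rev_supp Dthi Wne n0_gt0 eta01 rho01 rho_eta rev_cross rev_col rev_visits). Qed.
Let pi_right w i : D w -> \sum_(k <oo) (reversal w i k * pi (thi w) k)%:E =
  (growth thi W reversal w * pi w i)%:E.
Proof. exact: (conformal_eigen rev_ge0 rev_supp Dthi Wne n0_gt0 eta01 rho01 rho_eta rev_cross rev_col rev_visits). Qed.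

Let growth_rev_gt0 w : D w -> (0 < growth thi W reversal w)%R.
Proof.
by move=> Dw; have [] := growthE rev_ge0 rev_supp Dthi Wne n0_gt0 eta01 rho01 rho_eta
  rev_cross rev_col rev_visits Dw.
Qed.

Hypotheses (thm : measurable_fun setT th) (thim : measurable_fun setT thi).
Hypothesis Wm : forall a, measurable [set w | W w a].
Hypothesis Bm : forall i j, measurable_fun setT (fun w => B w i j).

Let measurable_reversal i j : measurable_fun setT (fun w => reversal w i j).
Proof.
have mm k : measurable_fun setT (fun w => mu w k) by exact: (measurable_conformal_vec B0 thm Wm Bm).
apply: measurable_funM.
  by apply: measurable_funM => //; exact: (measurableT_comp (Bm j i)).
apply: ge0_measurable_funV => //.
exact: (measurableT_comp (mm j)).
Qed.

Theorem exists_eigenvectors : exists (lam : Omega -> R) (mu h : Omega -> nat -> R),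
  [/\ measurable_fun setT lam,
      forall i, measurable_fun setT (fun w => mu w i),
      forall i, measurable_fun setT (fun w => h w i),
      forall w i, (0 <= mu w i)%R /\ (0 <= h w i)%R &
      forall w, D w ->
        [/\ (0 < lam w)%R,
            forall i, W w i -> (0 < mu w i)%R /\ (0 < h w i)%R,
            forall i, ~ W w i -> mu w i = 0%R /\ h w i = 0%R,
            \sum_(i <oo) (mu w i)%:E = 1 /\ \sum_(i <oo) (h w i * mu w i)%:E = 1 &
            forall i, \sum_(k <oo) (B w i k * mu (th w) k)%:E = (lam w * mu w i)%:E /\
              \sum_(k <oo) (h w k * B w k i)%:E = (lam w * h (th w) i)%:E]].
Proof.
have mm k : measurable_fun setT (fun w => mu w k) by exact: (measurable_conformal_vec B0 thm Wm Bm).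
have mp k : measurable_fun setT (fun w => pi w k).
  exact: (measurable_conformal_vec rev_ge0 thim Wm measurable_reversal).
exists lam, mu, (eigenfunction mu pi); split.
- exact: (measurable_growth B0 thm Wm Bm).
- exact: mm.
- move=> i; apply: measurable_funM; first exact: mp.
  by apply: ge0_measurable_funV; [move=> w; exact: mu_ge0|exact: mm].
- by move=> w i; split => //; exact: eigenfunction_ge0.
move=> w Dw; split.
- exact: lam_gt0.
- by move=> i Wi; split; [exact: mu_gt0|exact: (eigenfunction_gt0 mu_gt0 pi_gt0)].
- by move=> i Wi; split; [exact: mu_supp|exact: (eigenfunction_supp _ pi_supp)].
- split; first exact: mu_sum1.
  exact: (eigenfunction_sum1 mu_supp mu_gt0 pi_supp pi_sum1).
move=> i; split; first exact: mu_right.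
exact: (eigenfunction_left thK B0 Bsupp Dth mu_ge0 mu_supp mu_gt0 mu_right lam_gt0 pi_ge0
  pi_supp pi_sum1 pi_right growth_rev_gt0).
Qed.

End TwoSided.

(** * Restriction to admissible entries and diagonal normalization *)

Section Restriction.
Context (d : measure_display) (Omega : measurableType d) (R : realType).
Variables (th : Omega -> Omega) (W : Omega -> set nat).

Lemma esum_nneseries (V : set nat) (f g : nat -> \bar R) :
  (forall i, V i -> f i = g i) -> (forall i, ~ V i -> g i = 0%E) ->
  (forall i, (0 <= g i)%E) -> (\esum_(i in V) f i = \sum_(i <oo) g i)%E.
Proof.
move=> fg g0 gge0; rewrite nneseries_esumT// esum_mkcond; apply: eq_esum => i _.
have [Vi|Vi] := pselect (V i); first by rewrite mem_set// fg.
by rewrite memNset// g0.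
Qed.

Variable A : Omega -> nat -> nat -> R.

(* The absolute value only matters on the null set where [A] may be negative. *)
Definition restricted (w : Omega) (i j : nat) : R :=
  if `[< W w i /\ W (th w) j >] then `|A w i j| else 0.

Lemma restricted_ge0 w i j : 0 <= restricted w i j.
Proof. by rewrite /restricted; case: ifP. Qed.

Lemma restricted_supp w i j : restricted w i j != 0 -> W w i /\ W (th w) j.
Proof. by rewrite /restricted; case: asboolP => //; rewrite eqxx. Qed.

Lemma measurable_restricted : measurable_fun setT th -> measurable_family W ->
  random_matrix th W A -> forall i j, measurable_fun setT (fun w => restricted w i j).
Proof.
move=> thm Wm Am i j.
have mE : measurable [set w | W w i /\ W (th w) j].
  apply: measurableI; first exact: Wm.
  by rewrite -[X in measurable X]setTI; exact: (thm measurableT _ (Wm j)).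
have mA : measurable_fun [set w | W w i /\ W (th w) j] (fun w => `|A w i j|).
  exact: (@measurableT_comp _ _ _ _ _ _ (@Num.norm R R)).
have /(measurable_restrictT _ mE) := mA.
apply: eq_measurable_fun => w _; rewrite /restricted /patch.
by rewrite -[w \in _]/(`[< W w i /\ W (th w) j >]).
Qed.

Variable D : set Omega.
Hypotheses (Dth : forall w, D w -> D (th w)).
Hypothesis A_ge0 : forall w, D w -> forall i j, W w i -> W (th w) j -> 0 <= A w i j.

Lemma restrictedE w i j : D w -> W w i -> W (th w) j -> restricted w i j = A w i j.
Proof.
move=> Dw Wi Wj; rewrite /restricted; case: asboolP => [_|[]//].
by rewrite ger0_norm// A_ge0.
Qed.

Lemma restricted_neq0 w i j : D w -> restricted w i j != 0 -> 0 < A w i j.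
Proof.
move=> Dw r0; have [Wi Wj] := restricted_supp r0.
by rewrite -(restrictedE Dw Wi Wj) lt0r r0 restricted_ge0.
Qed.

Local Open Scope ereal_scope.

Lemma mxcocycle_restricted n w i j : D w -> W w i ->
  mxcocycle th W A n w i j = cocycle th restricted n w i j.
Proof.
elim: n w i => [//|n IH] w i Dw Wi /=.
apply: esum_nneseries => [k Wk|k Wk|k].
- by rewrite IH// ?restrictedE//; exact: Dth.
- have [->|/restricted_supp[]//] := eqVneq (restricted w i k) 0%R.
  by rewrite mul0e.
- by rewrite mule_ge0 ?cocycle_ge0// ?lee_fin ?restricted_ge0//; exact: restricted_ge0.
Qed.

Variables (lam : Omega -> R) (h : Omega -> nat -> R).
Hypothesis lam_gt0 : forall w, D w -> (0 < lam w)%R.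
Hypothesis h_gt0 : forall w i, D w -> W w i -> (0 < h w i)%R.

(** The normalization is a conjugation by diagonal matrices, so only its end factors survive in a
    product. *)
Lemma mxcocycle_normalized n w i j : D w -> W w i -> W (iter n th w) j ->
  mxcocycle th W (normalized_matrix th A lam h) n w i j =
  cocycle th restricted n w i j * (h w i / (birkhoff_prod th lam n w * h (iter n th w) j))%:E.
Proof.
elim: n w i => [|n IH] w i Dw Wi Wj.
  rewrite /= /birkhoff_prod big_ord0 mul1r; case: eqVneq Wj => [<- _|_ _]; last by rewrite mul0e.
  by rewrite divff ?mule1// gt_eqF// h_gt0.
rewrite [LHS]/= [cocycle _ _ _ _ _ _]/=.
have hn0 : (0 < h (iter n.+1 th w) j)%R by rewrite h_gt0//; exact: invariant_iter.
have l0 := lam_gt0 Dw.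
have L0 : (0 < birkhoff_prod th lam n (th w))%R.
  by apply: prodr_gt0 => k _; apply: lam_gt0; apply: invariant_iter => //; exact: Dth.
have LS : birkhoff_prod th lam n.+1 w = (lam w * birkhoff_prod th lam n (th w))%R.
  by rewrite /birkhoff_prod big_ord_recl; congr (_ * _)%R; apply: eq_bigr => k _; rewrite -iterSr.
rewrite -ge0_nneseriesZr; last 2 first.
- by move=> k; rewrite mule_ge0 ?cocycle_ge0// ?lee_fin ?restricted_ge0//; exact: restricted_ge0.
- by rewrite lee_fin LS !mulr_ge0 ?invr_ge0 ?mulr_ge0// ?ltW// h_gt0.
apply: esum_nneseries => [k Wk|k Wk|k].
- rewrite IH; [|exact: Dth|by []|by rewrite -iterSr].
  rewrite -iterSr.
  have hk : (0 < h (th w) k)%R by rewrite h_gt0//; exact: Dth.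
  rewrite muleCA -EFinM [(restricted w i k)%:E * _]muleC -muleA -EFinM; congr (_ * _%:E).
  rewrite /normalized_matrix restrictedE// LS; field.
  by rewrite !gt_eqF.
- have [->|/restricted_supp[]//] := eqVneq (restricted w i k) 0%R.
  by rewrite !mul0e.
- rewrite !mule_ge0 ?cocycle_ge0// ?lee_fin ?restricted_ge0//; first exact: restricted_ge0.
  by rewrite LS !mulr_ge0 ?invr_ge0 ?mulr_ge0// ?ltW// h_gt0.
Qed.

End Restriction.

(** * Good blocks have positive probability *)

Section GoodEvent.
Context (d : measure_display) (Omega : measurableType d) (R : realType).
Variables (P : probability Omega R) (th thi : Omega -> Omega).
Variables (W : Omega -> set nat) (A : Omega -> nat -> nat -> R).
Hypothesis hth : ergodic_automorphism P th thi.
Hypothesis hW : measurable_family W.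
Hypothesis hA : random_matrix th W A.
Hypothesis hA0 : {ae P, forall w, forall i j, W w i -> W (th w) j -> 0 <= A w i j}.
Variables (Obi Obp : set Omega).
Let alpha w i j := Num.sg (A w i j).
Hypothesis hbip : markov_chain_bip P th thi W alpha Obi Obp.
Hypothesis hratio : {ae P, forall w, (th @^-1` (Obi `|` Obp)) w ->
  (ereal_sup [set r | exists i j k : nat,
     [/\ W w i, W (th w) j, W (th w) k, A w i k != 0%R &
         r = (A w i j / A w i k)%:E]] < +oo)%E}.
Let logcol w := ereal_sup [set `|lne (\esum_(i in W w) (A w i j)%:E)|%E | j in W (th w)].
Hypothesis hint : P.-integrable setT logcol.

Let letter a w := letter_event th W alpha a w.

(** The almost sure hypotheses collected at a single point, with mixing times N chosen once for all
    pairs of letters. *)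
Definition regular (N : nat -> nat -> Omega -> nat) (w : Omega) : Prop :=
  [/\ (forall i j, W w i -> W (th w) j -> 0 <= A w i j) /\
      (forall i, W w i -> (0 < \esum_(j in W (th w)) (alpha w i j)%:E)%E),
      (forall a b n, letters P th W alpha a -> letters P th W alpha b ->
        (N a b w <= n)%N -> W w a -> letter b (iter n th w) ->
        (cylinder th W alpha w [:: a] `&`
          (iter n Defs.shift) @^-1` cylinder th W alpha (iter n th w) [:: b]) !=set0),
      (forall a, ~ letters P th W alpha a -> ~ letter a w) /\ logcol w \is a fin_num,
      ((th @^-1` (Obi `|` Obp)) w -> exists2 K : R, 0 < K &
        forall i j k, W w i -> W (th w) j -> W (th w) k -> A w i k != 0 ->
          A w i j / A w i k <= K) &
      forall M, exists n, (M <= visits th Obp n w)%N].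

Lemma ae_and (X Y : Omega -> Prop) : {ae P, forall w, X w} -> {ae P, forall w, Y w} ->
  {ae P, forall w, X w /\ Y w}.
Proof. by move=> hX hY; exact: filterI. Qed.

Lemma unbounded_visits (f : Omega -> Omega) (G : set Omega) q w :
  (exists K, forall n, (n <= q * visits f G n w + K)%N) ->
  forall M, exists n, (M <= visits f G n w)%N.
Proof.
move=> [K hK] M; exists (q * M + K).+1; rewrite leqNgt; apply/negP => h.
have := hK (q * M + K).+1; rewrite leqNgt ltnS leq_add2r leq_mul2l.
by rewrite (ltnW h) orbT.
Qed.

Lemma ae_regular : exists N, {ae P, forall w, regular N w}.
Proof.
have [N hN] : exists N : nat -> nat -> Omega -> nat, forall a b,
    letters P th W alpha a -> letters P th W alpha b ->
    {ae P, forall w, forall n, (N a b w <= n)%N -> W w a -> letter b (iter n th w) ->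
      (cylinder th W alpha w [:: a] `&`
        (iter n Defs.shift) @^-1` cylinder th W alpha (iter n th w) [:: b]) !=set0}.
  have hN a b : exists N : Omega -> nat,
      letters P th W alpha a -> letters P th W alpha b ->
      {ae P, forall w, forall n, (N w <= n)%N -> W w a -> letter b (iter n th w) ->
      (cylinder th W alpha w [:: a] `&`
        (iter n Defs.shift) @^-1` cylinder th W alpha (iter n th w) [:: b]) !=set0}.
    have [[la lb]|h] := pselect (letters P th W alpha a /\ letters P th W alpha b).
      by have [N hN] := bip_mixing hbip la lb; exists N.
    by exists (fun=> 0%N) => la lb; exfalso; apply: h.
  exists (fun a b => projT1 (cid (hN a b))) => a b.
  by case: cid.
exists N.
have h1 : {ae P, forall w, forall a b n, letters P th W alpha a -> letters P th W alpha b ->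
        (N a b w <= n)%N -> W w a -> letter b (iter n th w) ->
        (cylinder th W alpha w [:: a] `&`
          (iter n Defs.shift) @^-1` cylinder th W alpha (iter n th w) [:: b]) !=set0}.
  apply: ae_foralln => a; apply: ae_foralln => b.
  have [[la lb]|h] := pselect (letters P th W alpha a /\ letters P th W alpha b).
    by apply: filterS (hN a b la lb) => w h n _ _; exact: h.
  by apply: aeW => w n la lb; exfalso; apply: h.
(* There are countably many letters, so those with negligible event can be discarded together;
   mixing is then available for every letter that occurs. *)
have h2 : {ae P, forall w, forall a, ~ letters P th W alpha a -> ~ letter a w}.
  apply: ae_foralln => a.
  have [la|la] := pselect (letters P th W alpha a); first by apply: aeW => w /(_ la).
  have /contrapT [E [mE E0 lE]] := la.
  by exists E; split => // w /= /not_implyP[_ /contrapT]; exact: lE.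
have h3 : {ae P, forall w, logcol w \is a fin_num}.
  by apply: filterS (integrable_ae measurableT hint) => w; exact.
have [q [q0 h4 _]] := frequent_visits hth (bip_mbp hbip) (bip_bp_gt0 hbip).
have h5 := rmc_row (bip_chain hbip).
have := ae_and (ae_and (ae_and hA0 h5) (ae_and h1 (ae_and h2 h3))) (ae_and hratio h4).
apply: filterS => w [[[a1 a2] [a3 [a4 a5]]] [a6 a7]]; split => //.
  move=> /a6; set S := [set r | _] => S_oo.
  have [K hK] : exists K : R, (ereal_sup S <= K%:E)%E.
    case: (ereal_sup S) S_oo => [r _|//|_]; first by exists r.
    by exists 0; rewrite leNye.
  exists (Num.max K 1); first by rewrite lt_max ltr01 orbT.
  move=> i j k Wi Wj Wk Aik; rewrite le_max -lee_fin; apply/orP; left.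
  by apply: le_trans hK; apply: ereal_sup_ubound; exists i, j, k.
exact: unbounded_visits a7.
Qed.

Section RegularOrbits.
Variables (N : nat -> nat -> Omega -> nat) (D : set Omega).
Hypotheses (Dth : forall w, D w -> D (th w)) (Dthi : forall w, D w -> D (thi w)).
Hypothesis Dreg : forall w, D w -> regular N w.
Let B := restricted th W A.
Let thK := ea_thK hth.
Let thiK := ea_thiK hth.

Lemma regular_ge0 w : D w -> forall i j, W w i -> W (th w) j -> 0 <= A w i j.
Proof. by move=> /Dreg[[]]. Qed.

Let B0 w i j : 0 <= B w i j. Proof. exact: restricted_ge0. Qed.
Let Bsupp w i j : B w i j != 0 -> W w i /\ W (th w) j.
Proof. exact: restricted_supp. Qed.

Lemma alpha1_neq0 w i j : D w -> W w i -> W (th w) j -> alpha w i j = 1 -> B w i j != 0.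
Proof.
move=> Dw Wi Wj a1; rewrite /B (restrictedE regular_ge0)//; apply: contra_eqN a1 => /eqP e.
by rewrite /alpha e sgr0 eq_sym oner_neq0.
Qed.

Lemma neq0_alpha1 w i j : D w -> B w i j != 0 -> alpha w i j = 1.
Proof. by move=> Dw b; rewrite /alpha gtr0_sg//; exact: (restricted_neq0 regular_ge0 Dw b). Qed.

Lemma regular_row w : D w -> forall i, W w i -> exists j, B w i j != 0.
Proof.
move=> Dw i Wi; have [[_ row] _ _ _ _] := Dreg Dw.
apply: contrapT => /forallNP h; have := row _ Wi; rewrite esum1 ?ltxx// => j Wj.
have /negP := h j; rewrite negbK /B (restrictedE regular_ge0)// => /eqP e.
by rewrite /alpha e sgr0.
Qed.

(** Mixing speaks of infinite sequences: since every row has a nonzero entry, a letter can be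
    continued forever by a choice of successors. *)
Lemma regular_letter w a : D w -> W w a -> letter a w.
Proof.
move=> Dw Wa.
have [next hnext] : exists next : Omega -> nat -> nat, forall v i, D v -> W v i -> B v i (next v i) != 0.
  have h v i : exists j, D v -> W v i -> B v i j != 0.
    have [[Dv Wi]|nh] := pselect (D v /\ W v i).
      by have [j hj] := regular_row Dv Wi; exists j.
    by exists 0%N => Dv Wi; exfalso; apply: nh.
  by exists (fun v i => projT1 (cid (h v i))) => v i; case: cid.
pose x := fix x n := if n is m.+1 then next (iter m th w) (x m) else a.
have Wx n : W (iter n th w) (x n).
  elim: n => // n IH /=.
  by have [] := Bsupp (hnext _ _ (invariant_iter Dth n Dw) IH).
exists x; split.
- move=> n; split => //.
  apply: neq0_alpha1; first exact: invariant_iter.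
  by apply: hnext; [exact: invariant_iter|exact: Wx].
- by case.
Qed.

Lemma regular_letters w a : D w -> W w a -> letters P th W alpha a.
Proof.
move=> Dw Wa; apply: contrapT => na.
have [_ _ [h _] _ _] := Dreg Dw.
exact: h na (regular_letter Dw Wa).
Qed.

Let colsum_esum w j : D w -> W (th w) j ->
  (\esum_(i in W w) (A w i j)%:E = \sum_(i <oo) (B w i j)%:E)%E.
Proof.
move=> Dw Wj; apply: esum_nneseries => [i Wi|i Wi|i].
- by rewrite /B (restrictedE regular_ge0).
- by have [->|/Bsupp[]//] := eqVneq (B w i j) 0.
- by rewrite lee_fin.
Qed.

(** Were it empty, the supremum [logcol] at [thi w] would be taken over the empty set and equal
    [-oo], which is not finite. *)
Lemma regular_nonempty w : D w -> W w !=set0.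
Proof.
move=> Dw; have [_ _ [_ fin] _ _] := Dreg (Dthi Dw).
apply: contrapT => /set0P/negP/negPn/eqP W0; move: fin.
by rewrite /logcol thiK W0 image_set0 ereal_sup0.
Qed.

Lemma regular_col w : D w -> exists s S : R, (0 < s)%R /\
  forall j, W (th w) j -> (s%:E <= \sum_(i <oo) (B w i j)%:E <= S%:E)%E.
Proof.
move=> Dw; have [_ _ [_ fin] _ _] := Dreg Dw.
pose T := fine (logcol w); exists (expR (- T)), (expR T); split; first exact: expR_gt0.
move=> j Wj; rewrite -colsum_esum//; set s := (\esum_(i in W w) _)%E.
have s0 : (0 <= s)%E by apply: esum_ge0 => i Wi; rewrite lee_fin regular_ge0.
have sT : (`|lne s| <= T%:E)%E.
  by rewrite /T fineK//; apply: ereal_sup_ubound; exists j.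
case: s s0 sT => [r|//|//]; rewrite lee_fin => r0.
have [->|rn0] := eqVneq r 0; first by rewrite le0_lneNy.
have rp : 0 < r by rewrite lt0r rn0.
rewrite lne_EFin// lee_fin ler_norml => /andP[l1 l2].
by rewrite !lee_fin -{1 2}(lnK rp) !ler_expR l1 l2.
Qed.

Lemma connected_cocycle w a b n : D w -> W w a -> W (iter n th w) b ->
  (N a b w <= n)%N -> (0 < cocycle th B n w a b)%E.
Proof.
move=> Dw Wa Wb Nn; have Dn := invariant_iter Dth n Dw.
have [_ mix _ _ _] := Dreg Dw.
have [x [[xs x0] [_ xn]]] := mix _ _ _ (regular_letters Dw Wa) (regular_letters Dn Wb) Nn Wa
  (regular_letter Dn Wb).
have x0a : x 0%N = a by exact: (x0 0%N).
have xnb : x n = b.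
  have shiftE m (y : nat -> nat) k : iter m Defs.shift y k = y (m + k)%N.
    elim: m y k => // m IH y k.
    by rewrite iterSr IH /Defs.shift addSn.
  by have := xn 0%N isT; rewrite shiftE addn0.
rewrite -x0a -xnb; apply: cocycle_path_gt0 => // k kn.
have [Wk ak] := xs k; have [Wk1 _] := xs k.+1.
by apply: alpha1_neq0 => //; exact: invariant_iter.
Qed.

Lemma eventually_hit (f : Omega -> Omega) (G : set Omega) w :
  (forall M, exists n, (M <= visits f G n w)%N) ->
  forall M, exists2 n, (M <= n)%N & G (iter n f w).
Proof.
move=> h M; have [n hn] := h M.+1.
have nM : (M < n)%N by exact: leq_trans hn (visits_le _ _ _ _).
move: hn; rewrite -(subnKC (ltnW nM)) visitsD => hn.
have v0 : (0 < visits f G (n - M) (iter M f w))%N.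
  by have := visits_le f G M w; lia.
have [k Gk] := exists_hit v0; exists (k + M)%N; first exact: leq_addl.
by rewrite iterD.
Qed.

(** The return times to [Obp] are unbounded, so one of them exceeds the finitely many mixing times
    between letters of the finite set; [good_block] then applies. *)
Lemma regular_block w : D w -> Obi (th w) -> exists m, exists2 Q : R, 0 < Q &
  forall i j k, W (iter m.+2 th w) j -> W (iter m.+2 th w) k ->
  (cocycle th B m.+2 w i k <= Q%:E * cocycle th B m.+2 w i j)%E.
Proof.
move=> Dw Ow; have D1 := Dth Dw.
have [I finI [hbi hbp]] := bip_letters hbip.
have [M hM] : exists M, forall b, I b -> (b < M)%N.
  have /finite_seqP[s Is] := finI; exists (\max_(b <- s) b).+1 => b.
  by rewrite Is /= => bs; rewrite ltnS; exact: leq_bigmax_seq.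
have rat v : D v -> (Obi `|` Obp) (th v) -> exists2 K : R, 0 < K &
    forall i j k, W v i -> W (th v) j -> W (th v) k -> B v i k != 0 -> B v i j <= K * B v i k.
  move=> Dv Ov; have [_ _ _ rat _] := Dreg Dv; have [K K0 hK] := rat Ov.
  exists K => // i j k Wi Wj Wk; rewrite /B !(restrictedE regular_ge0)// => Aik.
  have a0 : 0 < A v i k by rewrite lt0r Aik regular_ge0.
  by rewrite -ler_pdivrMr//; exact: hK.
pose n1 := (\max_(b < M) \max_(c < M) N b c (th w))%N.
have hn1 b c : (b < M)%N -> (c < M)%N -> (N b c (th w) <= n1)%N.
  move=> bM cM; apply: leq_trans (leq_bigmax (Ordinal bM)) => /=.
  exact: leq_trans (leq_bigmax (F := fun c : 'I_M => N b c (th w)) (Ordinal cM)).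
have [_ _ _ _ vis] := Dreg (Dth D1).
have [m n1m Om] := eventually_hit vis n1.
pose v := iter m th (th w).
have Dv : D v by exact: invariant_iter.
have Ov : Obp (th v) by rewrite /v -iterS iterSr.
have [K K0 hK] := rat w Dw (or_introl Ow).
have [K' K'0 hK'] := rat v Dv (or_intror Ov).
have [c0 [C [_ C0 hC]]] := mass_bounds B0 Bsupp Dth regular_col m.+1 D1.
have bi i : W w i -> exists2 b, (b < M)%N & B w i b != 0.
  move=> Wi; have [|b Ib [_ h1 h2]] := hbi _ Ow i; first by rewrite thK.
  exists b; first exact: hM.
  have := h2 0%N isT; have := h1 1%N isT; rewrite /= thK => Wb.
  exact: alpha1_neq0.
have bp j : W (th v) j -> exists2 c, (c < M)%N & B v c j != 0.
  move=> Wj; have [c Ic [_ h1 h2]] := hbp _ Ov j Wj.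
  exists c; first exact: hM.
  have := h2 0%N isT; have := h1 0%N isT; rewrite /= thK => Wc.
  exact: alpha1_neq0.
have [|||Q Q0 hQ] := @good_block R Omega th W B B0 Bsupp w m M K K' C K0 K'0 C0 hK hK' bi bp.
- move=> b c bM cM Wb Wc; apply: connected_cocycle => //.
  exact: leq_trans (hn1 _ _ bM cM) n1m.
- by move=> b c Wb; exact: (cocycle_fin B0 Bsupp Dth regular_col).
- move=> j; rewrite -transferE//; have /andP[_ h] := hC j; apply: (le_trans h).
  rewrite -[leRHS]mule1; apply: lee_wpmul2l; first by rewrite lee_fin ltW.
  by rewrite /letter_one lee_fin; case: asbool.
exists m, Q => // i j k Wj Wk.
have [Wi|Wi] := pselect (W w i); first exact: hQ.
rewrite (_ : cocycle th B m.+2 w i k = 0)%E.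
  by rewrite mule_ge0 ?cocycle_ge0// lee_fin ltW.
apply: contrapT => /eqP c.
by have [] := cocycle_supp B0 Bsupp (isT : (0 < m.+2)%N) c.
Qed.

(** The bound is a natural number so that countably many events exhaust all good blocks. *)
Definition block_event (n q : nat) : set Omega := [set w | forall i j k,
  W (iter n th w) j -> W (iter n th w) k ->
  (cocycle th B n w i k <= q%:R%:E * cocycle th B n w i j)%E].

Lemma measurable_block_event n q : measurable (block_event n q).
Proof.
have mth := ea_measurable hth.
have mB : forall i j, measurable_fun setT (fun w => B w i j).
  exact: measurable_restricted.
have mW j : measurable [set w | W (iter n th w) j].
  exact: (measurable_preimage_iter mth n (hW j)).
rewrite (_ : block_event n q = \bigcap_i \bigcap_j \bigcap_k
   (~` [set w | W (iter n th w) j] `|` (~` [set w | W (iter n th w) k] `|`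
   [set w | (cocycle th B n w i k <= q%:R%:E * cocycle th B n w i j)%E]))).
  apply: bigcapT_measurable => i; apply: bigcapT_measurable => j.
  apply: bigcapT_measurable => k.
  do 2 (apply: measurableU; first exact: measurableC).
  rewrite -[X in measurable X]setTI; apply: measurable_lee => //.
    exact: measurable_cocycle.
  by apply: measurable_funeM; exact: measurable_cocycle.
apply/seteqP; split=> w h.
- move=> i _ j _ k _; have [Wj|Wj] := pselect (W (iter n th w) j); last by left.
  right; have [Wk|Wk] := pselect (W (iter n th w) k); last by left.
  by right; exact: h.
- by move=> i j k Wj Wk; have [//|[//|]] := h i I j I k I.
Qed.

(** Up to a null set these countably many events cover the preimage of [Obi], which has positive
    measure, so they cannot all be null. *)
Lemma frequent_block : {ae P, forall w, D w} ->
  exists m q, (0 < P (block_event m.+2 q))%E.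
Proof.
move=> aeD; apply: contrapT => /forallNP h.
have h0 m q : P.-negligible (block_event m.+2 q).
  apply/negligibleP; first exact: measurable_block_event.
  apply/eqP; rewrite eq_le measure_ge0 andbT leNgt; apply/negP => p.
  by apply: (h m); exists q.
have : P.-negligible (th @^-1` Obi).
  apply: (@negligibleS _ _ _ _ (~` D `|` \bigcup_m \bigcup_q block_event m.+2 q)).
    move=> w Ow; have [Dw|Dw] := pselect (D w); last by left.
    right; have [m [Q Q0 hQ]] := regular_block Dw Ow.
    exists m => //; exists (Num.bound Q) => // i j k Wj Wk.
    apply: (le_trans (hQ i j k Wj Wk)); apply: lee_wpmul2r; first exact: cocycle_ge0.
    by rewrite lee_fin ltW// archi_boundP// ltW.
  apply: negligibleU; first exact: aeD.
  by apply: negligible_bigcup => m; apply: negligible_bigcup => q; exact: h0.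
have mO : measurable (th @^-1` Obi).
  by rewrite -[X in measurable X]setTI; exact: (ea_measurable hth measurableT (bip_mbi hbip)).
move=> /negligibleP => /(_ mO) P0; have := bip_bi_gt0 hbip.
have := ea_preserving hth (bip_mbi hbip).
by rewrite P0 => <-; rewrite ltxx.
Qed.

End RegularOrbits.

End GoodEvent.

(** * Measurable choice of times, roots of rates, reversed visit counts *)

Section FirstTime.
Context (d : measure_display) (Omega : measurableType d) (R : realType).
Variable P : probability Omega R.

Lemma exists_RV d' (V : measurableType d') (f : Omega -> V) : measurable_fun setT f ->
  exists X : {RV P >-> V}, (X : Omega -> V) = f.
Proof.
move=> mf.
pose X : {mfun Omega >-> V} := HB.pack f (isMeasurableFun.Build _ _ _ _ _ mf).
by exists X.
Qed.

(** The first time at which E holds, with default value 0 where there is none; the sets F n where it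
    equals n are disjoint and measurable. *)
Lemma exists_measurable_time (E : nat -> set Omega) : (forall n, measurable (E n)) ->
  exists L : {RV P >-> nat}, forall w, (exists n, E n w) -> E (L w) w.
Proof.
move=> mE.
pose F n := E n `\` \bigcup_(k in [set k | (k < n)%N]) E k.
have mF n : measurable (F n).
  by apply: measurableD => //; exact: bigcup_measurable.
have hf w : exists m, ((exists n, E n w) -> F m w) /\ (~ (exists n, E n w) -> m = 0%N).
  have [[n En]|h] := pselect (exists n, E n w); last by exists 0%N.
  have ex : exists n, `[< E n w >] by exists n; exact/asboolP.
  exists (ex_minn ex); split => [_|h]; last by exfalso; apply: h; exists n.
  case: ex_minnP => m /asboolP Em min; split => // -[k /= km Ek].
  by have := min k; rewrite leqNgt km /= => /(_ (asboolT Ek)).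
pose f w := projT1 (cid (hf w)).
have fF w : (exists n, E n w) -> F (f w) w by rewrite /f; case: cid => m [].
have f0 w : ~ (exists n, E n w) -> f w = 0%N by rewrite /f; case: cid => m [].
have Finj m n w : F m w -> F n w -> m = n.
  move=> [Em nm] [En nn]; apply/eqP; rewrite eqn_leq; apply/andP; split; rewrite leqNgt; apply/negP => l.
    by apply: nm; exists n.
  by apply: nn; exists m.
have mU : measurable (\bigcup_n E n) by exact: bigcupT_measurable.
have mf : measurable_fun setT f.
  move=> _ Y _; rewrite setTI.
  rewrite (_ : f @^-1` Y = (\bigcup_(n in Y) F n) `|` (~` (\bigcup_n E n) `&` [set _ | Y 0%N])).
    apply: measurableU; first exact: bigcup_measurable.
    by apply: measurableI; [exact: measurableC|exact: measurable_cst_set].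
  apply/seteqP; split=> w /=.
  - have [h|h] := pselect (exists n, E n w) => Yf.
      by left; exists (f w) => //; exact: fF.
    right; split; last by rewrite -(f0 _ h).
    by move=> [n _ En]; apply: h; exists n.
  - move=> [[n Yn Fn]|[nE Y0]].
      by rewrite (Finj (f w) n w)//; apply: fF; exists n; case: Fn.
    by rewrite f0// => -[n En]; apply: nE; exists n.
have [L LE] := exists_RV mf.
by exists L => w h; rewrite LE; have [] := fF w h.
Qed.

End FirstTime.

Section Rates.
Context (R : realType).

Lemma bernoulli_inequality (x : R) n : 0 <= x <= 1 -> 1 - n%:R * x <= (1 - x) ^+ n.
Proof.
move=> /andP[x0 x1]; elim: n => [|n IH]; first by rewrite mul0r subr0 expr0.
rewrite exprS -natr1; apply: (@le_trans _ _ ((1 - x) * (1 - n%:R * x))).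
  have : 0 <= n%:R * x * x by rewrite !mulr_ge0.
  lra.
by rewrite ler_wpM2l// subr_ge0.
Qed.

(** The witness 1 - (1 - x) / n works by Bernoulli's inequality. *)
Lemma exists_root_above (x : R) n : (0 < n)%N -> 0 < x < 1 ->
  exists2 y : R, 0 < y < 1 & x <= y ^+ n.
Proof.
move=> n0 /andP[x0 x1]; have n1 : 1 <= n%:R :> R by rewrite ler1n.
have np : 0 < n%:R :> R by rewrite ltr0n.
exists (1 - (1 - x) / n%:R).
  rewrite subr_gt0 ltrBlDr ltrDl divr_gt0 ?subr_gt0// andbT ltr_pdivrMr// mul1r.
  by rewrite (lt_le_trans _ n1)// ltrBlDr ltrDl.
have := @bernoulli_inequality ((1 - x) / n%:R) n; rewrite mulrCA divff ?gt_eqF// mulr1 subKr; apply.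
rewrite divr_ge0 ?subr_ge0 ?(ltW x1) ?(ltW np)//= ler_pdivrMr// mul1r (le_trans _ n1)//.
by rewrite lerBlDr lerDl ltW.
Qed.

End Rates.

(** Both counts run over the points g w, ..., g^k w; the forward orbit stops just before w, hence
    the shift to [g w]. *)
Lemma visits_reverse (T : Type) (f g : T -> T) (G : set T) k w : cancel g f ->
  visits f G k (iter k g w) = visits g G k (g w).
Proof.
move=> gK; elim: k => //= k IH.
rewrite gK IH; transitivity (visits g G (k + 1) (g w)); last by rewrite addn1.
by rewrite visitsD /= addn0 addnC -iterSr.
Qed.

Section SupNorm.
Context (R : realType).

Lemma sup_norm_le (I J : set nat) (M : nat -> nat -> \bar R) (c : \bar R) :
  (forall i j, I i -> J j -> (`|M i j| <= c)%E) -> (sup_norm I J M <= c)%E.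
Proof. by move=> h; apply: ge_ereal_sup => _ [i Ii [j Jj <-]]; exact: h. Qed.

End SupNorm.

(** * Choice of the constants and of the random times *)

Theorem mainTheorem12 (d : measure_display) (Omega : measurableType d)
    (R : realType) (P : probability Omega R) (th thi : Omega -> Omega)
    (W : Omega -> set nat) (A : Omega -> nat -> nat -> R)
    (hth : ergodic_automorphism P th thi)
    (hW : measurable_family W)
    (hA : random_matrix th W A)
    (hA0 : {ae P, forall w, forall i j, W w i -> W (th w) j -> 0 <= A w i j})
    (hbip : summable_matrix_bip P th thi W A) :
  exists (lam : {RV P >-> R}) (h mu : Omega -> nat -> R),
  [/\ random_vector W h /\ random_vector W mu,
      {ae P, forall w,
        [/\ 0 < lam w,
            (forall i, W w i -> 0 < h w i) /\ (forall i, W w i -> 0 < mu w i),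
            (\esum_(i in W w) (mu w i)%:E = 1)%E &
            (\esum_(i in W w) (h w i * mu w i)%:E = 1)%E]},
      {ae P, forall w,
        (forall j, W (th w) j ->
          (\esum_(i in W w) (h w i * A w i j)%:E = (lam w * h (th w) j)%:E)%E) /\
        (forall i, W w i ->
          (\esum_(j in W (th w)) (A w i j * mu (th w) j)%:E
             = (lam w * mu w i)%:E)%E)},
      (exists (s : R) (C : {RV P >-> R}),
        [/\ 0 < s < 1,
            {ae P, forall w, 0 < C w} &
            {ae P, forall w, forall n : nat,
              (sup_norm (W w) (W (iter n th w)) (fun i j =>
                 mxcocycle th W A n w i j
                   * ((birkhoff_prod th lam n w * h (iter n th w) j)^-1)%:E
                 - (mu w i)%:E)
               <= (C w * s ^+ n)%:E)%E /\
              (sup_norm (W w) (W (iter n th w)) (fun i j =>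
                 ((birkhoff_prod th lam n w)^-1)%:E * mxcocycle th W A n w i j
                 - (mu w i * h (iter n th w) j)%:E)
               <= (C w)%:E
                  * ereal_sup [set (h (iter n th w) j)%:E
                              | j in W (iter n th w)]
                  * (s ^+ n)%:E)%E}]) &
      (exists (t : R) (l k : nat -> {RV P >-> nat}) (nu : Omega -> nat -> R),
        [/\ 0 < t < 1,
            random_vector W nu,
            {ae P, forall w, (forall i, W w i -> 0 < nu w i) /\
                             (\esum_(i in W w) (nu w i)%:E = 1)%E} &
            {ae P, forall w, forall n : nat,
              (sup_norm (W w) (W (iter (l n w) th w)) (fun i j =>
                 mxcocycle th W (normalized_matrix th A lam h) (l n w) w i j
                 - (nu w i)%:E)
               <= (4 * t ^+ n)%:E)%E /\
              (sup_norm (W (iter (k n w) thi w)) (W w) (fun i j =>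
                 mxcocycle th W (normalized_matrix th A lam h) (k n w)
                   (iter (k n w) thi w) i j
                 - (nu (iter (k n w) thi w) i)%:E)
               <= (4 * t ^+ n)%:E)%E}])].
Proof.
have [Obi [Obp [hb hr hi]]] := hbip.
have mth := ea_measurable hth; have mthi := ea_measurable_inv hth.
have thK := ea_thK hth; have thiK := ea_thiK hth.
have [N aeN] := ae_regular hth hA0 hb hr hi.
have [D1 [mD1 aeD1 D1th D1thi D1reg]] := full_invariant_set hth aeN.
have [m [q PG]] := frequent_block hth hW hA hb hi D1th D1reg aeD1.
set B := restricted th W A.
have B0 w i j : 0 <= B w i j by exact: restricted_ge0.
have Bsupp w i j : B w i j != 0 -> W w i /\ W (th w) j by exact: restricted_supp.
have mB i j : measurable_fun setT (fun w => B w i j) by exact: measurable_restricted.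
pose n0 := m.+2.
pose G := block_event th W A n0 q.
have mG : measurable G by exact: (measurable_block_event hth hW hA).
have [q' [q'0 fw bw]] := frequent_visits hth mG PG.
(* A second invariant set is required: frequency of visits can only be imposed once G is known, and
   G was found from regularity. *)
have [D [mD aeD Dth Dthi Dgood]] := full_invariant_set hth (ae_and aeD1 (ae_and fw bw)).
have DD1 w : D w -> D1 w by move=> /Dgood[].
have Wne w : D w -> W w !=set0.
  by move=> /DD1; exact: (regular_nonempty hth D1thi D1reg).
have Bcol w : D w -> exists s S : R, 0 < s /\
    forall j, W (th w) j -> (s%:E <= \sum_(i <oo) (B w i j)%:E <= S%:E)%E.
  by move=> /DD1; exact: (regular_col D1reg).
have Brow w : D w -> forall i, W w i -> exists j, B w i j != 0.
  by move=> /DD1; exact: (regular_row D1reg).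
have A_ge0 w : D w -> forall i j, W w i -> W (th w) j -> 0 <= A w i j.
  by move=> /DD1; exact: (regular_ge0 D1reg).
(* Raising q by 2 gives Q >= 2 and keeps eta = Q^-2 strictly below 1, even for q = 0 or 1. *)
pose Q : R := q.+2%:R.
have Q2 : 2 <= Q by rewrite ler_nat.
have Q0 : 0 < Q by lra.
pose eta := (Q ^+ 2)^-1.
have eta01 : 0 < eta < 1.
  rewrite invr_gt0 exprn_gt0//= invf_lt1 ?exprn_gt0//.
  by rewrite expr_gt1// ?ltW//; lra.
have etaQ : eta * Q ^+ 2 <= 1 by rewrite mulVf// gt_eqF// exprn_gt0.
have [rho rho01 rho_eta] : exists2 rho : R, 0 < rho < 1 & 1 - eta <= rho ^+ n0.
  by apply: exists_root_above => //; move: eta01; lra.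
have comp w : D w -> G w -> forall i j k,
    W (iter n0 th w) j -> W (iter n0 th w) k ->
    (cocycle th B n0 w i k <= Q%:E * cocycle th B n0 w i j)%E.
  move=> _ Gw i j k Wj Wk; apply: (le_trans (Gw i j k Wj Wk)).
  by apply: lee_wpmul2r; rewrite ?cocycle_ge0// lee_fin ler_nat -addn2 leq_addr.
have eta01' : 0 < eta <= 1 by have /andP[-> /ltW ->] := eta01.
have Gfw w : D w -> forall M, exists n, (M <= visits th G n w)%N.
  by move=> /Dgood[_ [hfw _]]; exact: unbounded_visits hfw.
have Gbw w : D w -> forall M, exists n, (M <= visits thi G n w)%N.
  by move=> /Dgood[_ [_ hbw]]; exact: unbounded_visits hbw.
have [lam [mu [h [mlam mmu mh ge0 eig]]]] := exists_eigenvectors thK thiK B0 Bsupp Dth Dthi Wne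
  (isT : (0 < n0)%N) eta01' rho01 rho_eta comp etaQ Bcol Brow Gfw Gbw mth mthi hW mB.
have [lamX lamE] := exists_RV P mlam.
have lam0 w : D w -> 0 < lam w by case/eig.
have mu0 w i : D w -> W w i -> 0 < mu w i by move=> /eig[_ h1 _ _ _] /h1[].
have h0 w i : D w -> W w i -> 0 < h w i by move=> /eig[_ h1 _ _ _] /h1[].
have mus w i : D w -> ~ W w i -> mu w i = 0 by move=> /eig[_ _ h1 _ _] /h1[].
have hs w i : D w -> ~ W w i -> h w i = 0 by move=> /eig[_ _ h1 _ _] /h1[].
have mu1 w : D w -> (\sum_(i <oo) (mu w i)%:E = 1)%E by move=> /eig[_ _ _ [h1 _] _].
have hmu1 w : D w -> (\sum_(i <oo) (h w i * mu w i)%:E = 1)%E by move=> /eig[_ _ _ [_ h1] _].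
have right_eig w i : D w -> (\sum_(k <oo) (B w i k * mu (th w) k)%:E = (lam w * mu w i)%:E)%E.
  by move=> /eig[_ _ _ _ h1]; have [] := h1 i.
have left_eig w i : D w -> (\sum_(k <oo) (h w k * B w k i)%:E = (lam w * h (th w) i)%:E)%E.
  by move=> /eig[_ _ _ _ h1]; have [] := h1 i.
have mu_ge0 w i : 0 <= mu w i by have [] := ge0 w i.
have h_ge0 w i : 0 <= h w i by have [] := ge0 w i.
have crG w : D w -> G w -> cross_ratio_ge eta (cocycle th B n0 w).
  exact: (cross_ratio_block B0 Bsupp (isT : (0 < n0)%N) eta01' comp etaQ).
have rate n w i j := @cocycle_rate _ _ _ th W B B0 D G n0 eta rho Dth Wne
  (isT : (0 < n0)%N) eta01' rho01 rho_eta crG mu h lam mu_ge0 h_ge0 h0 hs lam0 hmu1 right_eig left_eig n w i j.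
have cfin n w i j := @cocycle_fin_eigen _ _ _ th W B B0 D Dth h lam h_ge0 h0 lam0 left_eig n w i j.
have Ghit w : D w -> exists k, G (iter k thi w).
  by move=> Dw; have [n hn] := Gbw w Dw 1%N; exact: exists_hit hn.
have hlow := eigenfunction_bounded_below thiK B0 Bsupp Dth Dthi Wne h_ge0 h0 lam0 left_eig Q0 comp Bcol Ghit.
have [/andP[rho0 rho1] rn0] : (0 < rho < 1) /\ 0 < rho ^+ n0.
  by split=> //; rewrite exprn_gt0//; case/andP: rho01.
have LamP n w : D w -> 0 < birkhoff_prod th lam n w.
  by move=> Dw; apply: prodr_gt0 => i _; apply: lam0; exact: invariant_iter.
have hn0 n w j : D w -> W (iter n th w) j -> 0 < h (iter n th w) j.
  by move=> Dw; apply: h0; exact: invariant_iter.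
exists lamX, h, mu; rewrite lamE; split.
- by split=> i; apply: measurable_funTS.
- apply: filterS aeD => w Dw; split.
  + exact: lam0.
  + by split=> i; [exact: h0|exact: mu0].
  + rewrite (@esum_nneseries _ _ _ (fun i => (mu w i)%:E)) ?mu1// => i; last by rewrite lee_fin.
    by move=> Wi; rewrite mus.
  + rewrite (@esum_nneseries _ _ _ (fun i => (h w i * mu w i)%:E)) ?hmu1// => i.
      by move=> Wi; rewrite mus// mulr0.
    by rewrite lee_fin mulr_ge0.
- apply: filterS aeD => w Dw; split=> [j Wj|i Wi].
  + rewrite -left_eig//; apply: esum_nneseries => i.
    * by move=> Wi; rewrite /B (restrictedE A_ge0).
    * by move=> Wi; rewrite hs// mul0r.
    * by rewrite lee_fin mulr_ge0.
  + rewrite -right_eig//; apply: esum_nneseries => j.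
    * by move=> Wj; rewrite /B (restrictedE A_ge0).
    * by move=> Wj; rewrite mus ?mulr0//; exact: Dth.
    * by rewrite lee_fin mulr_ge0.
(* From rho <= s^q' and n <= q' visits + K it follows that rho^visits <= s^(n - K), up to writing
   s^-K as a factor. *)
- have [s s01 hsq] := exists_root_above q'0 rho01; have /andP[s0 s1] := s01.
  have sn0 n : 0 < s ^+ n by rewrite exprn_gt0.
  pose c1 n w := rho ^+ visits th G n w / s ^+ n.
  have c1_ge0 n w : 0 <= c1 n w by rewrite divr_ge0 ?exprn_ge0 ?ltW.
  (* K depends on w through a mere existence statement; this supremum, bounded by s^-K, is
     measurable. Likewise [H] is a measurable form of the reciprocal of the lower bound for h. *)
  pose C1 w : \bar R := ereal_sup (range (fun n => (c1 n w)%:E)).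
  pose H w : \bar R := ereal_sup (range (fun i => ((h w i)^-1)%:E)).
  pose C w := fine (C1 w) / rho ^+ n0 * fine (H w).
  have mC : measurable_fun setT C.
    apply: measurable_funM.
      apply: measurable_funM => //; apply: measurable_fun_fine; apply: measurable_fun_ereal_sup => n.
      apply/measurable_EFinP; apply: measurable_funM => //.
      have mv Y : measurable (visits th G n @^-1` Y) by exact: (measurable_visits mth mG).
      by move=> _ Y mY; rewrite setTI; exact: (mv [set k | Y (rho ^+ k)]).
    apply: measurable_fun_fine; apply: measurable_fun_ereal_sup => i.
    by apply/measurable_EFinP; apply: ge0_measurable_funV.
  have [CX CE] := exists_RV P mC.
  have C1fin w : D w -> C1 w \is a fin_num /\ forall n, c1 n w <= fine (C1 w).
    move=> /Dgood[_ [[K hK] _]].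
    have ub : (C1 w <= (s ^- K)%:E)%E.
      apply: ge_ereal_sup => _ [n _ <-]; rewrite lee_fin /c1.
      rewrite ler_pdivrMr// mulrC ler_pdivlMr//.
      apply: (@le_trans _ _ (s ^+ (q' * visits th G n w) * s ^+ K)).
        by rewrite ler_wpM2r ?(ltW (sn0 _))// exprM lerXn2r ?nnegrE ?(ltW (sn0 _)) ?(ltW rho0).
      by rewrite -exprD ler_wiXn2l ?(ltW s0) ?(ltW s1).
    have lb n : ((c1 n w)%:E <= C1 w)%E by apply: ereal_sup_ubound; exists n.
    have f : C1 w \is a fin_num.
      rewrite fin_numE -ltNye -ltey (le_lt_trans ub) ?ltry// andbT.
      by rewrite (lt_le_trans _ (lb 0%N)) ?ltNyr.
    by split => // n; rewrite -lee_fin fineK.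
  have Hfin w : D w -> H w \is a fin_num /\ forall i, (h w i)^-1 <= fine (H w).
    move=> Dw; have [c c0 hc] := hlow w Dw.
    have ub : (H w <= (c^-1)%:E)%E.
      apply: ge_ereal_sup => _ [i _ <-]; rewrite lee_fin.
      have [Wi|Wi] := pselect (W w i); last by rewrite hs// invr0 invr_ge0 ltW.
      by rewrite lef_pV2 ?posrE ?hc// h0.
    have lb i : (((h w i)^-1)%:E <= H w)%E by apply: ereal_sup_ubound; exists i.
    have f : H w \is a fin_num.
      rewrite fin_numE -ltNye -ltey (le_lt_trans ub) ?ltry// andbT.
      by rewrite (lt_le_trans _ (lb 0%N)) ?ltNyr.
    by split => // i; rewrite -lee_fin fineK.
  have C0 w : D w -> 0 < C w.
    move=> Dw; have [_ h1] := C1fin w Dw; have [_ h2] := Hfin w Dw.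
    have [i Wi] := Wne w Dw.
    (* The term n = 0 equals 1. *)
    have p1 : 0 < fine (C1 w) by apply: lt_le_trans (h1 0%N); rewrite /c1 /= !expr0 divr1.
    have p2 : 0 < fine (H w) by apply: lt_le_trans (h2 i); rewrite invr_gt0 h0.
    by rewrite /C mulr_gt0// divr_gt0.
  have key w n i j : D w -> W w i -> W (iter n th w) j ->
      `|fine (cocycle th B n w i j) / (birkhoff_prod th lam n w * h (iter n th w) j) - mu w i|
        <= C w * s ^+ n.
    move=> Dw Wi Wj; have [_ h1] := C1fin w Dw; have [_ h2] := Hfin w Dw.
    have hi0 := h0 w i Dw Wi.
    have := rate n w i j Dw Wi Wj; rewrite -ler_pdivlMr// => /le_trans; apply.
    have h3 : rho ^+ visits th G n w <= fine (C1 w) * s ^+ n by rewrite -ler_pdivrMr//; exact: h1.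
    have -> : C w * s ^+ n = (fine (C1 w) * s ^+ n) / rho ^+ n0 * fine (H w)
      by rewrite /C [LHS]mulrAC [_ / _ * s ^+ n]mulrAC.
    apply: ler_pM => //; rewrite ?invr_ge0 ?divr_ge0 ?exprn_ge0 ?(ltW rho0) ?(ltW hi0) ?(ltW rn0)//.
    by rewrite ler_wpM2r// invr_ge0 ltW.
  exists s, CX; rewrite CE; split => //.
    by apply: filterS aeD => w; exact: C0.
  apply: filterS aeD => w Dw n; split; apply: sup_norm_le => i j Wi Wj.
  + rewrite (mxcocycle_restricted Dth A_ge0)// -(fineK (cfin n w i j Dw Wi)) -EFinM -EFinB lee_fin.
    exact: key.
  + have hj := hn0 n w j Dw Wj; have L0 := LamP n w Dw.
    apply: (@le_trans _ _ ((C w)%:E * (h (iter n th w) j)%:E * (s ^+ n)%:E)%E).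
      rewrite (mxcocycle_restricted Dth A_ge0)// -(fineK (cfin n w i j Dw Wi)) -!EFinM -EFinB lee_fin.
      have kk := ler_wpM2r (ltW hj) (key w n i j Dw Wi Wj).
      rewrite -[X in _ * X <= _](gtr0_norm hj) -normrM mulrBl in kk.
      have -> : (birkhoff_prod th lam n w)^-1 * fine (cocycle th B n w i j) =
        fine (cocycle th B n w i j) / (birkhoff_prod th lam n w * h (iter n th w) j) * h (iter n th w) j.
        by field; rewrite !gt_eqF.
      by rewrite [leRHS]mulrAC.
    apply: lee_wpmul2r; first by rewrite lee_fin ltW.
    apply: lee_wpmul2l; first by rewrite lee_fin ltW// C0.
    by apply: ereal_sup_ubound; exists j.
(* Any t in (0,1) would do: the times l_n and k_n can be taken so late that [T n] visits have
   occurred. *)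
- pose t : R := 2^-1.
  have t0 n : 0 < 4 * t ^+ n by rewrite mulr_gt0// exprn_gt0// invr_gt0.
  have hT n : exists T, forall v, (T <= v)%N -> rho ^+ v / rho ^+ n0 <= 4 * t ^+ n.
    have [T hT] := exists_small_power rho01 (mulr_gt0 (t0 n) rn0).
    by exists T => v Tv; rewrite ler_pdivrMr// hT.
  pose T n := projT1 (cid (hT n)).
  have TP n v : (T n <= v)%N -> rho ^+ v / rho ^+ n0 <= 4 * t ^+ n.
    by rewrite /T; case: cid => T' /= h1; exact: h1.
  have mv n Y : measurable (visits th G n @^-1` Y) by exact: (measurable_visits mth mG).
  pose E n l := [set w | (T n <= visits th G l w)%N].
  (* Visits are counted forward from the past point; [visits_reverse] makes them backward visits
     from [thi w], so some l exists for each n. *)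
  pose F n l := [set w | (T n <= visits th G l (iter l thi w))%N].
  have mE n l : measurable (E n l) by exact: (mv l [set v | (T n <= v)%N]).
  have mF n l : measurable (F n l).
    exact: (measurable_preimage_iter mthi l (mE n l)).
  pose L n := projT1 (cid (exists_measurable_time P (mE n))).
  pose K n := projT1 (cid (exists_measurable_time P (mF n))).
  have LP n w : D w -> E n (L n w) w.
    by move=> Dw; rewrite /L; case: cid => X hX /=; apply: hX; exact: Gfw.
  have KP n w : D w -> F n (K n w) w.
    move=> Dw; rewrite /K; case: cid => X hX /=; apply: hX.
    have [l hl] := Gbw (thi w) (Dthi w Dw) (T n); exists l.
    by rewrite /F /= visits_reverse.
  pose nu w i := h w i * mu w i.
  (* The factor h_i of the normalized matrix is the one in [cocycle_rate], so the bound depends on w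
     only through the visits. It can therefore be used at the moving base point in the past. *)
  have est w n i j : D w -> W w i -> W (iter n th w) j ->
      (`|mxcocycle th W (normalized_matrix th A lam h) n w i j - (nu w i)%:E| <=
        (rho ^+ visits th G n w / rho ^+ n0)%:E)%E.
    move=> Dw Wi Wj; have hi0 := h0 w i Dw Wi; have hj := hn0 n w j Dw Wj; have L0 := LamP n w Dw.
    rewrite (mxcocycle_normalized Dth A_ge0 lam0 h0)// -(fineK (cfin n w i j Dw Wi)) -EFinM -EFinB lee_fin.
    apply: le_trans (rate n w i j Dw Wi Wj).
    rewrite -{2}(gtr0_norm hi0) -normrM mulrBl /nu [h w i * mu w i]mulrC.
    by rewrite [_ / _ * h w i]mulrAC -mulrA.
  exists t, L, K, nu; split.
  + by rewrite invr_gt0 ltr0n /= invf_lt1// ltr1n.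
  + by move=> i; apply: measurable_funTS; apply: measurable_funM.
  + apply: filterS aeD => w Dw; split=> [i Wi|]; first by rewrite mulr_gt0 ?h0 ?mu0.
    rewrite (@esum_nneseries _ _ _ (fun i => (nu w i)%:E)) ?hmu1// => i.
      by move=> Wi; rewrite /nu mus// mulr0.
    by rewrite lee_fin mulr_ge0.
  apply: filterS aeD => w Dw n; split; apply: sup_norm_le => i j Wi Wj.
  + by apply: (le_trans (est w _ i j Dw Wi Wj)); rewrite lee_fin; apply: TP; exact: LP.
  + have iK l v : iter l th (iter l thi v) = v.
      by elim: l v => // l IH v; rewrite iterSr iterS thiK IH.
    have Dk := invariant_iter Dthi (K n w) Dw.
    apply: (le_trans (est _ _ i j Dk Wi _)); first by rewrite iK.
    by rewrite lee_fin; apply: TP; exact: KP.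
Qed.
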